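(* Let $\mathcal{M}$ be an $m$-dimensional $C^\infty$ manifold in $\mathbb{R}^d$ with $1\le m\le d$, and let $\boldsymbol{X}$ be a random vector in $\mathbb{R}^d$ with $\boldsymbol{X}\in\mathcal{M}$ and law $\mu$. Assume that for every point $\boldsymbol{x}\in\mathcal{M}$ and every chart $(U,\psi)$ of $\mathcal{M}$ such that $U$ is a coordinate neighborhood of $\boldsymbol{x}$ and $\psi:U\to V\subset\mathbb{R}^m$, the pushforward $\psi_*\mu_U$ of the restriction $\mu_U$ of $\mu$ to $U$ is absolutely continuous with respect to Lebesgue measure on $V$. Let $\mathcal{G}_n$ be the directed nearest neighbor graph of $n$ independent copies $\boldsymbol{X}_1,\dots,\boldsymbol{X}_n$ of $\boldsymbol{X}$, with edge set $\mathcal{E}(\mathcal{G}_n)$. Then, as $n\to\infty$, $$\mathrm{E}\Big(\frac1n\,\#\big\{(i,j)\text{ distinct}:\ i\to j,\ j\to i\in\mathcal{E}(\mathcal{G}_n)\big\}\Big)\longrightarrow \frac{V_m}{U_m}=:\mathfrak{q}_m,$$ where $V_m$ is the volume of the unit ball in $\mathbb{R}^m$ and $U_m$ is the volume of the union of two unit balls in $\mathbb{R}^m$ whose centers are a unit distance apart.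
   Context: A $C^\infty$ manifold in $\mathbb{R}^d$ means a smooth embedded submanifold of $\mathbb{R}^d$. A chart on $\mathcal{M}$ is a pair $(U,\psi)$ with $U$ an open subset of $\mathcal{M}$ and $\psi:U\to V=\psi(U)$ a homeomorphism onto an open subset of $\mathbb{R}^m$, belonging to the smooth structure of $\mathcal{M}$ (so $\psi$ and $\psi^{-1}$ are $C^\infty$); $U$ is called a coordinate neighborhood of each of its points. The directed nearest neighbor graph $\mathcal{G}_n$ has vertex set $\{1,\dots,n\}$, and $i\to j$ is an edge if and only if $\boldsymbol{X}_j$ ($j\ne i$) is the nearest neighbor of $\boldsymbol{X}_i$ in Euclidean distance of $\mathbb{R}^d$ among the other sample points; possible ties are broken by an arbitrary fixed measurable rule depending only on $\boldsymbol{X}_1,\dots,\boldsymbol{X}_n$. The pairs $(i,j)$ counted are ordered pairs of distinct indices. *)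

(* Defs.v *)
From HB Require Import structures.
From mathcomp Require Import all_boot all_order all_algebra.
From mathcomp Require Import all_classical all_reals all_analysis.
Import Order.TTheory GRing.Theory Num.Theory.
Import numFieldNormedType.Exports.

Set Implicit Arguments.
Unset Strict Implicit.
Unset Printing Implicit Defensive.

Local Open Scope classical_set_scope.
Local Open Scope ring_scope.

(* The sigma-algebra on matrices, in particular on R^n = 'rV[R]_n, is the
   Borel one: it is generated by the open sets. *)
HB.instance Definition _ (R : realType) (m n : nat) :=
  @isMeasurable.Build (sigma_display (@open 'M[R]_(m, n))) 'M[R]_(m, n)
    <<s @open 'M[R]_(m, n) >>
    (@sigma_algebra0 _ setT _) (@sigma_algebraC _ _)
    (@sigma_algebra_bigcup _ setT _).

(* Lebesgue measure on R^n as the n-fold product of Lebesgue measure on R: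
   R^(n+1) is identified with R * R^n through (t, v) |-> row_mx t v, and R^0
   is a point of mass 1. *)
Fixpoint lebesgue_rV (R : realType) (n : nat) : set 'rV[R]_n -> \bar R :=
  match n return set 'rV[R]_n -> \bar R with
  | 0 => dirac (0 : 'rV[R]_0)
  | n'.+1 => pushforward (lebesgue_measure \x lebesgue_rV (R := R) (n := n'))%E
      (fun tv : R * 'rV[R]_n' => row_mx (tv.1%:M : 'rV[R]_1) tv.2)
  end.

(* The norm provided by the library on 'rV[R]_n is the sup norm; the topology
   is the same, but balls and nearest neighbors are Euclidean. *)
Definition edist (R : realType) (n : nat) (x y : 'rV[R]_n) : R :=
  Num.sqrt (\sum_(i < n) (x 0 i - y 0 i) ^+ 2).

Definition eball1 (R : realType) (n : nat) (c : 'rV[R]_n) : set 'rV[R]_n :=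
  [set x | edist c x < 1].

Section smooth.
Context {R : realType}.

(* All iterated partial derivatives of order at most k exist and are
   continuous at every point of W. Meant for W open. *)
Fixpoint Ck (n p k : nat) (W : set 'rV[R]_n) (f : 'rV[R]_n -> 'rV[R]_p)
    : Prop :=
  (forall x, W x -> {for x, continuous f}) /\
  match k with
  | 0 => True
  | k'.+1 => forall i : 'I_n,
      (forall x, W x -> derivable f x (delta_mx 0 i)) /\
      Ck k' W (fun x => 'D_(delta_mx 0 i) f x)
  end.

(* A map on an arbitrary subset S of R^n is C^oo when it extends, near each
   point of S, to a C^oo map on an open subset of R^n. *)
Definition smooth_on (n p : nat) (S : set 'rV[R]_n) (f : 'rV[R]_n -> 'rV[R]_p)
    : Prop :=
  forall x, S x -> exists (W : set 'rV[R]_n) (g : 'rV[R]_n -> 'rV[R]_p),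
    [/\ open W, W x, (forall k, Ck k W g) & forall y, W y -> S y -> g y = f y].

Variables d m : nat.

(* psi is total, but only its values on U matter. The image V is psi @` U, and
   phi is the inverse of psi. Since C^oo maps are continuous, psi is in
   particular a homeomorphism from U onto V. For an embedded submanifold, the
   C^oo structure of M is the one in which C^oo means smooth_on. *)
Definition chart (M U : set 'rV[R]_d) (psi : 'rV[R]_d -> 'rV[R]_m) : Prop :=
  [/\ exists2 W : set 'rV[R]_d, open W & U = M `&` W,
      open (psi @` U),
      smooth_on U psi &
      exists phi : 'rV[R]_m -> 'rV[R]_d,
        (forall x, U x -> phi (psi x) = x) /\ smooth_on (psi @` U) phi].

Definition smooth_submanifold (M : set 'rV[R]_d) : Prop :=
  forall x, M x -> exists (U : set 'rV[R]_d) (psi : 'rV[R]_d -> 'rV[R]_m),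
    chart M U psi /\ U x.

(* psi_* mu_U is absolutely continuous w.r.t. Lebesgue measure on V. *)
Definition chart_abs_continuous (mu : set 'rV[R]_d -> \bar R)
    (U : set 'rV[R]_d) (psi : 'rV[R]_d -> 'rV[R]_m) : Prop :=
  pushforward (fun B => mu (B `&` U)) psi `<<
    (fun A : set 'rV[R]_m => lebesgue_rV (A `&` psi @` U)).

End smooth.
Arguments smooth_submanifold {R d} m M.

Definition mutually_independent (R : realType) (d d' : measure_display)
    (Omega : measurableType d) (T : measurableType d') (P : probability Omega R)
    (I : finType) (X : I -> Omega -> T) : Prop :=
  forall (J : {set I}) (A : I -> set T), (forall i, measurable (A i)) ->
    P (\bigcap_(i in [set` J]) X i @^-1` A i) =
    (\prod_(i in J) P (X i @^-1` A i))%E.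

Section nearest_neighbor.
Context {R : realType} {d n : nat}.

(* nn x i is the index of the nearest neighbor of the point number i of the
   sample x, ties being resolved by nn. With a single sample point there is no
   neighbor, the value of nn is then irrelevant. *)
Definition nn_rule (nn : n.-tuple 'rV[R]_d -> 'I_n -> 'I_n) : Prop :=
  (forall i j, measurable [set x : n.-tuple 'rV[R]_d | nn x i = j]) /\
  ((1 < n)%N -> forall x i, nn x i != i /\
     forall k, k != i ->
       edist (tnth x i) (tnth x (nn x i)) <= edist (tnth x i) (tnth x k)).

Definition nn_edge (nn : n.-tuple 'rV[R]_d -> 'I_n -> 'I_n)
    (x : n.-tuple 'rV[R]_d) : rel 'I_n :=
  [rel i j | (j != i) && (nn x i == j)].

Definition mutual_pairs (nn : n.-tuple 'rV[R]_d -> 'I_n -> 'I_n)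
    (x : n.-tuple 'rV[R]_d) : {set 'I_n * 'I_n} :=
  [set p | [&& p.1 != p.2, nn_edge nn x p.1 p.2 & nn_edge nn x p.2 p.1]].

End nearest_neighbor.

Definition ball_volume (R : realType) (m : nat) : R :=
  fine (lebesgue_rV (eball1 (0 : 'rV[R]_m))).

(* The centers are the origin and the first basis vector. *)
Definition two_balls_volume (R : realType) (m : nat) : R :=
  fine (lebesgue_rV (eball1 (0 : 'rV[R]_m) `|`
    eball1 (\row_(i < m) (val i == 0%N)%:R : 'rV[R]_m))).

Definition qconst (R : realType) (m : nat) : R :=
  ball_volume R m / two_balls_volume R m.

(* Main.v *)
(* For a set C(x, y) depending on two points, (n - 1) times the integral of
   (1 - mu(C(x, y)))^(n - 2) over (x, y) is the expected number of indices j such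
   that no third sample point lies in C(X_1, X_j). When C(x, y) is the union of
   the closed balls of radius |x - y| about x and y, this bounds the expected
   proportion of points in mutual pairs from below. It is bounded from above by
   one minus the difference of these integrals for the closed ball about x alone
   and for its union with the open ball about y, since this difference counts
   points that are not the nearest neighbor of their nearest neighbor.

   At mu-almost every x, a chart is almost affine and x corresponds to a density
   point of the image measure with positive density, so that mu(B(x, r)) and
   mu(B(x, r) u B(y, r)), r = |x - y|, are equivalent to a V_m r^m and a U_m r^m
   for some a > 0. If mu(C(x, y)) is equivalent to b r^m, it follows that
   mu {y | mu(C(x, y)) <= s} is equivalent to (a V_m / b) s as s -> 0, whence
   (n - 1) int (1 - mu(C(x, y)))^(n - 2) mu(dy) tends to a V_m / b, which is 1 or
   V_m / U_m. Both bounds then converge to V_m / U_m by a one-sided dominated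
   convergence argument. *)

From Pilot Require Import Defs.
From HB Require Import structures.
From mathcomp Require Import all_boot all_order all_algebra.
From mathcomp Require Import all_classical all_reals all_analysis.
From mathcomp Require Import measurable_realfun ring lra.
Import Order.TTheory GRing.Theory Num.Theory.
Import numFieldNormedType.Exports.
Import Pilot.Defs.

Set Implicit Arguments.
Unset Strict Implicit.
Unset Printing Implicit Defensive.

Local Open Scope classical_set_scope.
Local Open Scope ring_scope.

(** * Lebesgue measure on row vectors *)

Section borel_rV.
Context {R : realType}.

(** Nothing bounds (n - 1) int (1 - mu(C(x, y)))^(n - 2) mu(dy) uniformly in n and x by an evident
    integrable function of x, the density of mu being arbitrary. So only lower bounds of Fatou type
    are taken: for the closed union, with limit q, and for the difference between the ball alone and
    its union with the open ball, a non-negative function of x with limit 1 - q. The mutual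
    proportion is at least the first integral and, added to the second, at most 1; since q + (1 - q)
    = 1 it is squeezed. Using the closed ball in one bound and the open ball in the other makes both
    valid for every rule on ties.

    Euclidean balls of R^d must be measured in a chart. The derivative of the inverse chart factors
    as an invertible m x m matrix T followed by an isometric embedding, so the balls become nearly
    ellipsoids {u : |(u - v) T| < r}, of volume C V_m r^m; the constant C is absorbed in a. Sup-norm
    balls, whose volume is explicit, serve for topology, covering and differentiation; Euclidean
    geometry enters only through these ellipsoids. *)

Lemma ball_rVP n (x y : 'rV[R]_n) (e : R) : 0 < e ->
  ball x e y <-> forall j, `|x 0 j - y 0 j| < e.
Proof.
move=> e0; split=> [[_ h] j|h]; first exact: (h 0 j).
by split=> // i j; rewrite ord1; exact: h.
Qed.

Lemma norm_rV_leP n (x : 'rV[R]_n) (e : R) : 0 <= e ->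
  `|x| <= e <-> forall j, `|x 0 j| <= e.
Proof.
move=> e0; rewrite [`|x|]mx_normrE; split=> [/bigmax_leP[_ h] j|h].
  exact: (h (0, j)).
by apply/bigmax_leP; split=> // -[i j] _; rewrite ord1.
Qed.

Lemma coord_le_norm n (x : 'rV[R]_n) j : `|x 0 j| <= `|x|.
Proof. by have /norm_rV_leP h := lexx `|x|; exact: h. Qed.

Definition ratball n (c : 'rV[rat]_n * rat) : set 'rV[R]_n :=
  ball (map_mx ratr c.1 : 'rV[R]_n) (ratr c.2).

(** Coordinates of x are rounded within r and the radius is a rational between 2 r and 3 r, hence
    the factor 4. The bound on the rational radius serves the covering argument, where a ball of
    radius r is traded for a rational ball of comparable volume. *)
Lemma ratball_between n (x : 'rV[R]_n) (r : R) : 0 < r ->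
  exists c, [/\ ball x r `<=` ratball c, ratball c `<=` ball x (4 * r) &
                0 < (ratr c.2 : R) <= 3 * r].
Proof.
move=> r0.
have [p] : exists q, ratr q \in `](2 * r), (3 * r)[ by apply: rat_in_itvoo; lra.
rewrite in_itv/= => /andP[p1 p2].
have /choice[q hq] : forall j, exists q : rat, `|ratr q - x 0 j| < r.
  move=> j; have [q] : exists q, ratr q \in `](x 0 j - r), (x 0 j + r)[.
    by apply: rat_in_itvoo; lra.
  by rewrite in_itv/= => q12; exists q; rewrite distrC ltr_distlC.
exists (\row_j q j, p); rewrite /ratball /=; split; last by rewrite (ltW p2) andbT; lra.
- move=> y /(ball_rVP _ _ r0) xy; apply/ball_rVP; first lra.
  move=> j; rewrite !mxE -(subrK (x 0 j) (ratr (q j))) -addrA.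
  by apply: le_lt_trans (ler_normD _ _) _; have := xy j; have := hq j; lra.
- move=> y /ball_rVP xy; apply/ball_rVP; first lra.
  move=> j; rewrite -(subrK (ratr (q j)) (x 0 j)) -addrA.
  apply: le_lt_trans (ler_normD _ _) _.
  have p0 : 0 < ratr p :> R by lra.
  by have := xy p0 j; rewrite !mxE => h; have := hq j; rewrite (distrC (x 0 j)); lra.
Qed.

Lemma open_ratball n (O : set 'rV[R]_n) x : open O -> O x ->
  exists c, ratball c x /\ ratball c `<=` O.
Proof.
move=> oO Ox; have /nbhs_ballP[e/= e0 eO] : nbhs x O by exact: open_nbhs_nbhs.
have e40 : 0 < e / 4 by lra.
have [c [xc cx _]] := ratball_between x e40.
exists c; split; first by apply: xc; exact: ballxx.
by apply: subset_trans cx _; rewrite (_ : 4 * (e / 4) = e)//; lra.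
Qed.

Lemma open_ratballE n (O : set 'rV[R]_n) : open O ->
  O = \bigcup_(c in [set c | ratball c `<=` O]) ratball c.
Proof.
move=> oO; apply/seteqP; split=> [x Ox|x [c cO cx]]; last exact: cO.
by have [c [xc cO]] := open_ratball oO Ox; exists c.
Qed.

Lemma countable_bigcup_in_measurable d (T : measurableType d) (U : countType)
    (D : set U) (F : U -> set T) :
  (forall i, D i -> measurable (F i)) -> measurable (\bigcup_(i in D) F i).
Proof.
move=> mF; rewrite bigcup_mkcond; apply: countable_bigcupT_measurable.
  exact: countableP.
by move=> i; case: ifPn => // /[!inE] Di; exact: mF.
Qed.

Lemma open_measurable_rV n (O : set 'rV[R]_n) : open O -> measurable O.
Proof. exact: sub_sigma_algebra. Qed.

Lemma closed_measurable_rV n (O : set 'rV[R]_n) : closed O -> measurable O.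
Proof.
by move=> cO; rewrite -(setCK O); apply: measurableC; apply: open_measurable_rV;
  exact: closed_openC.
Qed.

Lemma measurable_ball_rV n (x : 'rV[R]_n) r : measurable (ball x r).
Proof. by apply: open_measurable_rV; exact: ball_open. Qed.

Lemma measurable_fun_open d (T : measurableType d) n (f : T -> 'rV[R]_n)
    (D : set T) :
  (forall O, open O -> measurable (D `&` f @^-1` O)) -> measurable_fun D f.
Proof.
move=> h; apply: (measurability (@open 'rV[R]_n)) => //.
by move=> _ [V oV <-]; exact: h.
Qed.

Lemma measurable_coord n (j : 'I_n) :
  measurable_fun setT (fun x : 'rV[R]_n => x 0 j).
Proof.
apply: (measurability _ (measurable_realfun.RGenOpens.measurableE R)).
move=> _ [_ [a [b ->]] <-]; rewrite setTI; apply: open_measurable_rV.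
apply: (@open_comp _ _ (fun x : 'rV[R]_n => x 0 j)); last exact: interval_open.
by move=> x _; exact: coord_continuous.
Qed.

(** An open set is a countable union of rational sup-norm balls, and membership in such a ball is a
    finite conjunction of conditions on coordinates. *)
Lemma measurable_fun_rV d (T : measurableType d) n (f : T -> 'rV[R]_n) :
  (forall j, measurable_fun setT (fun t => f t 0 j)) -> measurable_fun setT f.
Proof.
move=> mf; apply: measurable_fun_open => O oO; rewrite setTI (open_ratballE oO).
rewrite preimage_bigcup; apply: countable_bigcup_in_measurable => c _.
have [c0|c0] := ltP 0 (ratr c.2 : R); last first.
  rewrite (_ : ratball c = set0) ?preimage_set0//.
  by apply/seteqP; split=> // y []; rewrite ltNge c0.
rewrite (_ : _ @^-1` _ = \bigcap_(j in [set: 'I_n])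
    ((fun t => f t 0 j) @^-1` ball (ratr (c.1 0 j) : R) (ratr c.2))); last first.
  apply/seteqP; split=> [t /(ball_rVP _ _ c0) h j _|t h].
    by have := h j; rewrite mxE.
  by apply/ball_rVP => // j; rewrite mxE; exact: h.
apply: fin_bigcap_measurable => [|j _]; first exact: finite_finset.
by rewrite -[X in measurable X]setTI; apply: mf => //; exact: measurable_ball.
Qed.

Lemma measurable_fun_subrV d (T : measurableType d) n (f g : T -> 'rV[R]_n) :
  measurable_fun setT f -> measurable_fun setT g ->
  measurable_fun setT (fun t => f t - g t).
Proof.
move=> mf mg; apply: measurable_fun_rV => j.
rewrite (_ : (fun _ => _) = (fun t => f t 0 j - g t 0 j)); last first.
  by apply/funext => t; rewrite !mxE.
by apply: measurable_funB; exact: (measurableT_comp (measurable_coord j)).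
Qed.

Lemma measurable_fun_mulmx d (T : measurableType d) n p (f : T -> 'rV[R]_n)
    (A : 'M[R]_(n, p)) :
  measurable_fun setT f -> measurable_fun setT (fun t => f t *m A).
Proof.
move=> mf; apply: measurable_fun_rV => j.
rewrite (_ : (fun _ => _) = (fun t => \sum_i f t 0 i * A i j)); last first.
  by apply/funext => t; rewrite !mxE.
apply: measurable_sum => i; apply: measurable_funM => //.
exact: (measurableT_comp (measurable_coord i)).
Qed.

Lemma measurable_fun_edist d (T : measurableType d) n (f g : T -> 'rV[R]_n) :
  measurable_fun setT f -> measurable_fun setT g ->
  measurable_fun setT (fun t => edist (f t) (g t)).
Proof.
move=> mf mg; rewrite /edist.
apply: (measurableT_comp (continuous_measurable_fun (@sqrt_continuous R))).
apply: measurable_sum => i; apply: measurable_funX; apply: measurable_funB.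
  exact: (measurableT_comp (measurable_coord i)).
exact: (measurableT_comp (measurable_coord i)).
Qed.

(** Lindelöf property: for each rational ball contained in some [U i], one such index is kept. [i0]
    is the default for rational balls contained in no [U i] and for integers that encode no ball. *)
Lemma countable_cover_rV n (M : set 'rV[R]_n) (I : Type) (U : I -> set 'rV[R]_n)
    (i0 : I) :
  (forall i, open (U i)) -> M `<=` \bigcup_i U i ->
  exists s : nat -> I, M `<=` \bigcup_k U (s k).
Proof.
move=> oU MU.
have /choice[g hg] : forall c, exists i, (exists i', @ratball n c `<=` U i') ->
    @ratball n c `<=` U i.
  move=> c; have [[i hi]|h] := pselect (exists i', @ratball n c `<=` U i').
    by exists i.
  by exists i0.
exists (fun k => if unpickle k is Some c then g c else i0) => x Mx.
have [i _ Uix] := MU _ Mx; have [c [xc cU]] := open_ratball (oU i) Uix.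
exists (pickle c) => //; rewrite pickleK; apply: hg xc.
by exists i.
Qed.

End borel_rV.

(** * Product structure, uniqueness and translation invariance of Lebesgue measure *)

Section lebesgue_rV_measure.
Context {R : realType}.

Definition box n (B : 'I_n -> set R) : set 'rV[R]_n :=
  [set x | forall i, B i (x 0 i)].

Lemma measurable_box n (B : 'I_n -> set R) :
  (forall i, measurable (B i)) -> measurable (box B).
Proof.
move=> mB; rewrite (_ : box B = \bigcap_(i in [set: 'I_n])
    ((fun x : 'rV[R]_n => x 0 i) @^-1` B i)); last first.
  by apply/seteqP; split=> [x h i _|x h i]; exact: h.
apply: fin_bigcap_measurable => [|i _]; first exact: finite_finset.
by rewrite -[X in measurable X]setTI; exact: measurable_coord.
Qed.

Lemma ball_rV_box n (x : 'rV[R]_n) r : 0 < r ->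
  ball x r = box (fun i => `](x 0 i - r), (x 0 i + r)[%classic).
Proof.
move=> r0; apply/seteqP; split=> [y /(ball_rVP _ _ r0) h i/=|y h].
  by have := h i; rewrite in_itv/= ltr_distlC.
by apply/ball_rVP => // i; have := h i; rewrite /= in_itv/= ltr_distlC.
Qed.

Lemma measurable_rV_box n : @measurable _ 'rV[R]_n =
  <<s [set A | exists2 B, (forall i, measurable (B i)) & A = box B] >>.
Proof.
apply/seteqP; split; last first.
  apply: smallest_sub; first exact: sigma_algebra_measurable.
  by move=> _ [B mB ->]; exact: measurable_box.
apply: smallest_sub; first exact: smallest_sigma_algebra.
move=> V oV; rewrite (open_ratballE oV).
pose G := [set A : set 'rV[R]_n | exists2 B, (forall i, measurable (B i)) & A = box B].
apply: (@countable_bigcup_in_measurable _ (g_sigma_algebraType G)) => c _.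
have [c0|c0] := ltP 0 (ratr c.2 : R).
  apply: sub_sigma_algebra; rewrite /ratball ball_rV_box//.
  by exists (fun i => `](map_mx ratr c.1 : 'rV[R]_n) 0 i - ratr c.2,
    (map_mx ratr c.1 : 'rV[R]_n) 0 i + ratr c.2[%classic).
rewrite (_ : ratball c = set0); first exact: measurable0.
by apply/seteqP; split=> // y []; rewrite ltNge c0.
Qed.

Lemma row_mx_head n (t : R) (v : 'rV[R]_n) :
  (row_mx (t%:M : 'rV[R]_1) v : 'rV[R]_n.+1) 0 ord0 = t.
Proof.
rewrite (_ : ord0 = lshift n (0 : 'I_1) :> 'I_n.+1); last exact: val_inj.
by apply: etrans (row_mxEl _ _ _ _) _; rewrite mxE eqxx mulr1n.
Qed.

Lemma row_mx_tail n (t : R) (v : 'rV[R]_n) i :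
  (row_mx (t%:M : 'rV[R]_1) v : 'rV[R]_n.+1) 0 (lift ord0 i) = v 0 i.
Proof. by rewrite -rshift1; exact: row_mxEr. Qed.

Lemma measurable_row_mx n : measurable_fun setT
  (fun tv : R * 'rV[R]_n => row_mx (tv.1%:M : 'rV[R]_1) tv.2 : 'rV[R]_n.+1).
Proof.
apply: measurable_fun_rV => j; case: (unliftP ord0 j) => [k ->|->].
  rewrite (_ : (fun _ => _) = (fun tv : R * 'rV[R]_n => tv.2 0 k)).
    exact: (measurableT_comp (measurable_coord k)).
  by apply/funext => -[t v] /=; rewrite row_mx_tail.
rewrite (_ : (fun _ => _) = fst)//; apply/funext => -[t v] /=.
by rewrite row_mx_head.
Qed.

Lemma row_mx_preimage_box n (B : 'I_n.+1 -> set R) :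
  (fun tv : R * 'rV[R]_n => row_mx (tv.1%:M : 'rV[R]_1) tv.2 : 'rV[R]_n.+1) @^-1`
  box B = B ord0 `*` box (fun i => B (lift ord0 i)).
Proof.
apply/seteqP; split=> -[t v] /=.
  move=> h; split=> [|i /=]; first by have := h ord0; rewrite row_mx_head.
  by have := h (lift ord0 i); rewrite row_mx_tail.
move=> [h0 h] j; case: (unliftP ord0 j) => [k ->|->].
  by rewrite row_mx_tail; exact: h.
by rewrite row_mx_head.
Qed.

Lemma prode_fin n (F : 'I_n -> R) :
  (\prod_(i < n) (F i)%:E = (\prod_(i < n) F i)%:E)%E.
Proof. by elim/big_rec2 : _ => // i x y _ ->. Qed.

(** [lebesgue_rV] is a bare set function, and its recursive clause is a product measure only once
    the lower-dimensional one is a sigma-finite measure. The induction therefore carries a packaged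
    measure; the formula on boxes travels with it and yields sigma-finiteness in the next
    dimension. *)
Lemma lebesgue_rV_exists n : exists2 mu : {sigma_finite_measure set 'rV[R]_n -> \bar R},
  @lebesgue_rV R n = mu & forall B : 'I_n -> set R, (forall i, measurable (B i)) ->
    (mu (box B) = \prod_(i < n) lebesgue_measure (B i))%E.
Proof.
elim: n => [|n [mu muE muB]].
  exists (dirac (0 : 'rV[R]_0)) => // B _; rewrite big_ord0 /= diracE.
  by rewrite mem_set//; case.
have mf := @measurable_row_mx n.
pose nu0 : {measure set 'rV[R]_n.+1 -> \bar R} :=
  @measure_function_pushforward__canonical__measure_function_Measure _ _ _ _ _
    (lebesgue_measure \x mu)%E _ mf.
have nuB B : (forall i, measurable (B i)) ->
    (nu0 (box B) = \prod_(i < n.+1) lebesgue_measure (B i))%E.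
  move=> mB; rewrite /nu0 /= /pushforward row_mx_preimage_box.
  rewrite product_measure1E; [|exact: mB|exact: measurable_box].
  by rewrite muB// big_ord_recl.
have sf : sigma_finite [set: 'rV[R]_n.+1] nu0.
  exists (fun k => box (fun=> `](- k.+1%:R), k.+1%:R[%classic)).
    apply/esym/seteqP; split=> // x _.
    exists (Num.truncn `|x|) => // i /=.
    rewrite in_itv/= -ltr_norml; apply: le_lt_trans (coord_le_norm x i) _.
    exact: truncnS_gt.
  move=> k; split; first exact: measurable_box.
  rewrite nuB//= (eq_bigr (fun=> (k.+1%:R + k.+1%:R)%:E)); last first.
    by move=> i _; rewrite lebesgue_measure_itv/= lte_fin gtrN// -EFinB opprK.
  by rewrite prode_fin ltry.
pose nu : {sigma_finite_measure set 'rV[R]_n.+1 -> \bar R} :=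
  HB.pack_for {sigma_finite_measure set 'rV[R]_n.+1 -> \bar R} (Measure.sort nu0)
    (Measure_isSigmaFinite.Build _ _ _ _ sf).
exists nu => //.
by rewrite /= muE.
Qed.

Let leb0 n : @lebesgue_rV R n set0 = 0%E.
Proof. by have [mu -> _] := lebesgue_rV_exists n; exact: measure0. Qed.

Let leb_ge0 n A : (0 <= @lebesgue_rV R n A)%E.
Proof. by have [mu -> _] := lebesgue_rV_exists n; exact: measure_ge0. Qed.

Let leb_sigma_additive n : semi_sigma_additive (@lebesgue_rV R n).
Proof.
have [mu -> _] := lebesgue_rV_exists n; exact: measure_semi_sigma_additive.
Qed.

HB.instance Definition _ n := isMeasure.Build _ _ _ (@lebesgue_rV R n)
  (leb0 n) (@leb_ge0 n) (@leb_sigma_additive n).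

Let leb_sigma_finite n : sigma_finite setT (@lebesgue_rV R n).
Proof. by have [mu -> _] := lebesgue_rV_exists n; exact: sigma_finiteT. Qed.

HB.instance Definition _ n := Measure_isSigmaFinite.Build _ _ _
  (@lebesgue_rV R n) (leb_sigma_finite n).

Lemma lebesgue_rV_box n (B : 'I_n -> set R) : (forall i, measurable (B i)) ->
  (lebesgue_rV (box B) = \prod_(i < n) lebesgue_measure (B i))%E.
Proof. by have [mu -> h] := lebesgue_rV_exists n; exact: h. Qed.

Lemma lebesgue_rV_ball n (x : 'rV[R]_n) r : 0 < r ->
  lebesgue_rV (ball x r) = ((2 * r) ^+ n)%:E.
Proof.
move=> r0; rewrite ball_rV_box// lebesgue_rV_box//.
rewrite (eq_bigr (fun=> (2 * r)%:E)); last first.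
  move=> i _; rewrite lebesgue_measure_itv/= lte_fin ltrD2l gtrN// -EFinD.
  by congr EFin; lra.
by rewrite prode_fin prodr_const card_ord.
Qed.

Lemma lebesgue_rV_unique n (mu : {measure set 'rV[R]_n -> \bar R}) :
  (forall B : 'I_n -> set R, (forall i, measurable (B i)) ->
    mu (box B) = (\prod_(i < n) lebesgue_measure (B i))%E) ->
  forall A, measurable A -> mu A = lebesgue_rV A.
Proof.
move=> muB A mA; apply/esym; pose G := [set A : set 'rV[R]_n |
  exists2 B, (forall i, measurable (B i)) & A = box B].
apply: (measure_unique G (fun k => ball 0 k.+1%:R)) => //.
- exact: measurable_rV_box.
- move=> _ _ [B mB ->] [C mC ->]; exists (fun i => B i `&` C i).
    by move=> i; exact: measurableI.
  by apply/seteqP; split=> [x [h1 h2] i|x h]; [split|split=> i; have [] := h i].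
- by move=> k; rewrite ball_rV_box//; eexists; last reflexivity.
- apply/seteqP; split=> // x _; exists (Num.truncn `|x|) => //.
  by rewrite -ball_normE /= sub0r normrN truncnS_gt.
- by move=> _ [B mB ->]; rewrite muB// -lebesgue_rV_box.
- move=> k; apply: (@le_lt_trans _ _ ((2 * k.+1%:R) ^+ n)%:E); last exact: ltry.
  by rewrite -(@lebesgue_rV_ball n 0).
Qed.

Lemma lebesgue_measure_shift (a : R) (B : set R) : measurable B ->
  lebesgue_measure [set t | B (t + a)] = lebesgue_measure B.
Proof.
move=> mB; have mf : measurable_fun setT (fun t : measurableTypeR R => (t + a : measurableTypeR R)).
  exact: measurable_funD.
pose nu : {measure set (measurableTypeR R) -> \bar R} :=
  @measure_function_pushforward__canonical__measure_function_Measure _ _ _ _ _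
    (@lebesgue_measure R) _ mf.
apply/esym; apply: (@lebesgue_measure_unique _ nu) => //.
move=> _ [[x y] _ <-]; rewrite /nu /= /pushforward.
rewrite (_ : _ @^-1` _ = `](x - a), (y - a)]%classic); last first.
  by apply/seteqP; split=> t /=; rewrite !in_itv/= ltrBlDr lerBrDr.
rewrite !lebesgue_measure_itv/= !lte_fin ltrD2r; case: ifP => // _.
by rewrite -!EFinB; congr EFin; lra.
Qed.

Lemma measurable_fun_addrV d (T : measurableType d) n (f g : T -> 'rV[R]_n) :
  measurable_fun setT f -> measurable_fun setT g ->
  measurable_fun setT (fun t => f t + g t).
Proof.
move=> mf mg; apply: measurable_fun_rV => j.
rewrite (_ : (fun _ => _) = (fun t => f t 0 j + g t 0 j)); last first.
  by apply/funext => t; rewrite !mxE.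
by apply: measurable_funD; exact: (measurableT_comp (measurable_coord j)).
Qed.

Lemma measurable_preimageT d d' (T : measurableType d) (T' : measurableType d')
    (f : T -> T') (A : set T') :
  measurable_fun setT f -> measurable A -> measurable (f @^-1` A).
Proof. by move=> mf mA; rewrite -[X in measurable X]setTI; exact: mf. Qed.

Lemma lebesgue_rV_shift n (a : 'rV[R]_n) (A : set 'rV[R]_n) : measurable A ->
  lebesgue_rV [set x | A (x + a)] = lebesgue_rV A.
Proof.
move=> mA; have mf : measurable_fun setT (fun x : 'rV[R]_n => x + a).
  exact: measurable_fun_addrV.
pose nu : {measure set 'rV[R]_n -> \bar R} :=
  @measure_function_pushforward__canonical__measure_function_Measure _ _ _ _ _
    (@lebesgue_rV R n) _ mf.
apply: (@lebesgue_rV_unique n nu) => // B mB; rewrite /nu /= /pushforward.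
rewrite (_ : _ @^-1` _ = box (fun i => [set t | B i (t + a 0 i)])); last first.
  by apply/seteqP; split=> x h i; have := h i; rewrite /= mxE.
have mfa b : measurable_fun setT (fun t : R => t + b) by exact: measurable_funD.
rewrite lebesgue_rV_box; last first.
  by move=> i; apply: (measurable_preimageT (mfa _)).
by apply: eq_bigr => i _; exact: lebesgue_measure_shift.
Qed.

(* Integrate 1_E(x) 1_Q(y - x) in both orders. *)
Lemma translation_invariant_unique n
    (mu : {sigma_finite_measure set 'rV[R]_n -> \bar R}) :
  (forall (a : 'rV[R]_n) (A : set 'rV[R]_n), measurable A ->
    mu [set x | A (x + a)] = mu A) ->
  exists c, forall A : set 'rV[R]_n, measurable A -> mu A = (c * lebesgue_rV A)%E.
Proof.
move=> muT; pose Q := box (fun _ : 'I_n => `]0, 1[%classic : set R).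
have mQ : measurable Q by exact: measurable_box.
have Q1 : lebesgue_rV Q = 1%E.
  rewrite lebesgue_rV_box// (eq_bigr (fun=> 1%E)) ?big1// => i _.
  by rewrite lebesgue_measure_itv/= lte_fin ltr01 oppr0 addr0.
have mQN : measurable [set x | Q (- x)].
  apply: (@measurable_preimageT _ _ _ _ (fun x : 'rV[R]_n => - x)) => //.
  by under eq_fun do rewrite -sub0r; exact: measurable_fun_subrV.
exists (mu [set x | Q (- x)]) => A mA.
pose S := [set z : 'rV[R]_n * 'rV[R]_n | A z.1 /\ Q (z.2 - z.1)].
(* The section of [S'] at a given second coordinate y is that of [S] translated by y, so [mu] gives
   both the same mass. In the other direction the sections of [S'] are translates of A, or empty. *)
pose S' := [set z : 'rV[R]_n * 'rV[R]_n | A (z.1 + z.2) /\ Q (- z.1)].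
have mS : measurable S.
  apply: measurableI; first exact: (measurable_preimageT measurable_fst).
  by apply: (measurable_preimageT _ mQ); exact: measurable_fun_subrV.
have mS' : measurable S'.
  apply: measurableI.
    by apply: (measurable_preimageT _ mA); exact: measurable_fun_addrV.
  exact: (measurable_preimageT measurable_fst mQN).
have E1 := @indic_fubini_tonelli _ _ _ _ _ mu (@lebesgue_rV R n) _ mS.
have E2 := @indic_fubini_tonelli _ _ _ _ _ mu (@lebesgue_rV R n) _ mS'.
rewrite !indic_fubini_tonelli_FE// !indic_fubini_tonelli_GE// in E1 E2.
transitivity (\int[mu]_x (@lebesgue_rV R n \o xsection S) x)%E.
  rewrite (eq_integral (fun x => (\1_A x)%:E)); last first.
    move=> x _ /=; rewrite xsectionE indicE; have [xA|xA] := boolP (x \in A).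
      transitivity (lebesgue_rV Q); last by rewrite Q1.
      rewrite -(lebesgue_rV_shift (- x) mQ); congr (lebesgue_rV _).
      by apply/seteqP; split=> y; [case|split=> //=; exact/set_mem].
    rewrite (_ : _ @^-1` _ = set0) ?measure0//.
    by apply/seteqP; split=> // y [/= /mem_set]; rewrite (negbTE xA).
  by rewrite integral_indic// setIT.
rewrite E1; transitivity (\int[mu]_x (@lebesgue_rV R n \o xsection S') x)%E.
  rewrite E2; apply: eq_integral => y _ /=.
  rewrite !ysectionE -(muT y); last by rewrite -ysectionE; exact: measurable_ysection.
  congr (mu _); apply/seteqP; split=> x [/= h1 h2]; split => //=.
    by rewrite opprD addrCA subrr addr0 in h2.
  by rewrite opprD addrCA subrr addr0.
rewrite (eq_integral (fun x => (lebesgue_rV A * (\1_[set x | Q (- x)] x)%:E)%E)).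
  rewrite ge0_integralZl// ?integral_indic// ?setIT 1?muleC//.
  by apply/measurable_EFinP.
move=> x _ /=; rewrite xsectionE indicE; have [xQ|xQ] := boolP (x \in _).
  rewrite mule1 -(lebesgue_rV_shift x mA); congr (lebesgue_rV _).
  apply/seteqP; split=> y /=; first by case; rewrite addrC.
  by rewrite addrC; split=> //=; move/set_mem : xQ.
rewrite mule0 (_ : _ @^-1` _ = set0) ?measure0//.
by apply/seteqP; split=> // y [_ h]; case/negP : xQ; exact/mem_set.
Qed.

End lebesgue_rV_measure.

(** * Euclidean norm, isometries and reflections *)

Section euclidean_norm.
Context {R : realType}.

Definition enorm n (x : 'rV[R]_n) : R := Num.sqrt (\sum_(i < n) x 0 i ^+ 2).

Lemma edistE n (x y : 'rV[R]_n) : edist x y = enorm (x - y).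
Proof. by rewrite /edist /enorm; congr Num.sqrt; apply: eq_bigr => i _; rewrite !mxE. Qed.

Lemma sumsq_ge0 n (x : 'rV[R]_n) : 0 <= \sum_(i < n) x 0 i ^+ 2.
Proof. by apply: sumr_ge0 => i _; exact: sqr_ge0. Qed.

Lemma enorm_ge0 n (x : 'rV[R]_n) : 0 <= enorm x.
Proof. exact: sqrtr_ge0. Qed.

Lemma enorm_sqr n (x : 'rV[R]_n) : enorm x ^+ 2 = \sum_(i < n) x 0 i ^+ 2.
Proof. by rewrite sqr_sqrtr// sumsq_ge0. Qed.

Lemma enorm_sqrE n (x : 'rV[R]_n) : (enorm x ^+ 2)%:M = x *m x^T.
Proof.
apply/matrixP => i j; rewrite !ord1 !mxE eqxx mulr1n enorm_sqr.
by apply: eq_bigr => k _; rewrite mxE expr2.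
Qed.

Lemma enorm0 n : enorm (0 : 'rV[R]_n) = 0.
Proof. by rewrite /enorm big1 ?sqrtr0// => i _; rewrite mxE expr0n. Qed.

Lemma enormZ n a (x : 'rV[R]_n) : enorm (a *: x) = `|a| * enorm x.
Proof.
rewrite /enorm -sqrtr_sqr -sqrtrM ?sqr_ge0//; congr Num.sqrt.
by rewrite mulr_sumr; apply: eq_bigr => i _; rewrite mxE exprMn.
Qed.

Lemma enormN n (x : 'rV[R]_n) : enorm (- x) = enorm x.
Proof. by rewrite -scaleN1r enormZ normrN1 mul1r. Qed.

Lemma enorm_distC n (x y : 'rV[R]_n) : enorm (x - y) = enorm (y - x).
Proof. by rewrite -opprB enormN. Qed.

Lemma coord_le_enorm n (x : 'rV[R]_n) i : `|x 0 i| <= enorm x.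
Proof.
rewrite -sqrtr_sqr; apply: ler_wsqrtr; rewrite (bigD1 i)//= lerDl.
by apply: sumr_ge0 => j _; exact: sqr_ge0.
Qed.

Lemma norm_le_enorm n (x : 'rV[R]_n) : `|x| <= enorm x.
Proof. by apply/norm_rV_leP => [|j]; [exact: enorm_ge0|exact: coord_le_enorm]. Qed.

Lemma enorm_le_norm n (x : 'rV[R]_n) : enorm x <= n%:R * `|x|.
Proof.
rewrite -[leRHS]ger0_norm ?mulr_ge0// -sqrtr_sqr; apply: ler_wsqrtr.
apply: (@le_trans _ _ (\sum_(i < n) `|x| ^+ 2)).
  apply: ler_sum => i _; rewrite -[leLHS]real_normK ?num_real// lerXn2r ?nnegrE//.
  exact: coord_le_norm.
rewrite sumr_const card_ord exprMn -[leLHS]mulr_natl ler_wpM2r ?sqr_ge0//.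
by rewrite -natrX ler_nat; case: n x => // n x; rewrite leq_pmull.
Qed.

Lemma enorm_eq0 n (x : 'rV[R]_n) : enorm x = 0 -> x = 0.
Proof.
move=> x0; apply/eqP; rewrite -normr_le0.
by rewrite (le_trans (norm_le_enorm x))// x0.
Qed.

(** Cauchy-Schwarz: expand the squared norm of |y| x - |x| y, once the cases of a zero vector are
    set apart. *)
Lemma dot_le_enorm n (x y : 'rV[R]_n) :
  \sum_(i < n) x 0 i * y 0 i <= enorm x * enorm y.
Proof.
have [/enorm_eq0 ->|x0] := eqVneq (enorm x) 0.
  by rewrite enorm0 mul0r big1// => i _; rewrite mxE mul0r.
have [/enorm_eq0 ->|y0] := eqVneq (enorm y) 0.
  by rewrite enorm0 mulr0 big1// => i _; rewrite mxE mulr0.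
have xp : 0 < enorm x by rewrite lt0r x0 enorm_ge0.
have yp : 0 < enorm y by rewrite lt0r y0 enorm_ge0.
have := sumsq_ge0 (enorm y *: x - enorm x *: y).
rewrite (eq_bigr (fun i => enorm y ^+ 2 * x 0 i ^+ 2 + enorm x ^+ 2 * y 0 i ^+ 2 -
  2 * (enorm x * enorm y) * (x 0 i * y 0 i))); last by move=> i _; rewrite !mxE; ring.
rewrite sumrB big_split /= -!mulr_sumr -!enorm_sqr.
set S := \sum_(i < n) _.
set X := enorm x in xp *; set Y := enorm y in yp * => h.
have : 0 <= (X * Y) * (X * Y - S) by nra.
by rewrite pmulr_rge0 ?mulr_gt0// subr_ge0.
Qed.

Lemma enormD n (x y : 'rV[R]_n) : enorm (x + y) <= enorm x + enorm y.
Proof.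
rewrite -(@ler_pXn2r _ 2) ?nnegrE ?addr_ge0 ?enorm_ge0// sqrrD !enorm_sqr.
rewrite (eq_bigr (fun i => x 0 i ^+ 2 + y 0 i ^+ 2 + 2 * (x 0 i * y 0 i))); last first.
  by move=> i _; rewrite !mxE; ring.
rewrite big_split /= [X in X + _ <= _]big_split /= -mulr_sumr addrAC lerD2r lerD2l.
by rewrite -[leRHS]mulr_natl ler_pM2l//; exact: dot_le_enorm.
Qed.

Lemma enorm_isometry n p (x : 'rV[R]_n) (Q : 'M[R]_(n, p)) :
  Q *m Q^T = 1%:M -> enorm (x *m Q) = enorm x.
Proof.
move=> QQ; apply/eqP; rewrite -(@eqrXn2 _ 2) ?enorm_ge0//; apply/eqP.
have : (enorm (x *m Q) ^+ 2)%:M = (enorm x ^+ 2)%:M :> 'M[R]_1.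
  by rewrite !enorm_sqrE trmx_mul mulmxA -(mulmxA x) QQ mulmx1.
by move=> /matrixP /(_ 0 0); rewrite !mxE eqxx !mulr1n.
Qed.

(** Reflection along w = z - e, with matrix 1 - k w^T w and k = 2 / |w|^2. As both vectors are unit,
    e . w = - |w|^2 / 2, so e is sent to e + w = z. It serves to bring the second of two ball
    centres to the first basis vector. *)
Lemma householder n (e z : 'rV[R]_n) : enorm e = 1 -> enorm z = 1 ->
  exists2 Q : 'M[R]_n, Q *m Q^T = 1%:M & e *m Q = z.
Proof.
move=> e1 z1; have [->|ez] := eqVneq z e.
  by exists 1%:M; rewrite ?trmx1 ?mulmx1.
pose w := z - e; have w0 : enorm w ^+ 2 != 0.
  rewrite sqrf_eq0; apply/eqP => /enorm_eq0 /eqP; rewrite subr_eq0; exact/negP.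
pose k := 2 / enorm w ^+ 2.
have ww : w *m w^T = (enorm w ^+ 2)%:M by rewrite enorm_sqrE.
have Qt : (1%:M - k *: (w^T *m w))^T = 1%:M - k *: (w^T *m w).
  by rewrite linearB linearZ /= trmx1 trmx_mul trmxK.
exists (1%:M - k *: (w^T *m w)).
  rewrite Qt mulmxBr mulmx1 mulmxBl mul1mx -scalemxAl -scalemxAr scalerA.
  rewrite mulmxA -(mulmxA w^T) ww mul_mx_scalar -scalemxAl scalerA.
  rewrite (_ : k * k * enorm w ^+ 2 = k + k); last first.
    by rewrite /k -mulrA divfK// mulr_natr mulr2n.
  by rewrite scalerDl opprB addrK subrK.
rewrite mulmxBr mulmx1 -scalemxAr mulmxA.
have ew : e *m w^T = (- (enorm w ^+ 2) / 2)%:M.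
  apply/matrixP => i j; rewrite !ord1 [RHS]mxE eqxx mulr1n [LHS]mxE.
  rewrite enorm_sqr; under eq_bigr do rewrite !mxE.
  under [X in _ = - X / _]eq_bigr do rewrite !mxE sqrrB.
  rewrite big_split sumrB /= -!enorm_sqr e1 z1 !expr1n.
  under eq_bigr do rewrite mulrBr -expr2 mulrC.
  rewrite sumrB -enorm_sqr e1 expr1n sumrMnl.
  set S := \sum_(_ < _) _; rewrite -mulr_natl; lra.
rewrite ew mul_scalar_mx scalerA (_ : k * _ = -1); last first.
  by rewrite /k mulNr mulrN mulf_div (mulrC 2) divff// mulf_neq0.
by rewrite scaleN1r opprK addrC subrK.
Qed.

Definition ebasis n : 'rV[R]_n := \row_(i < n) (val i == 0%N)%:R.

Lemma enorm_ebasis n : (0 < n)%N -> enorm (ebasis n) = 1.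
Proof.
case: n => // n _; rewrite /enorm big_ord_recl big1 ?mxE/= ?expr1n ?addr0 ?sqrtr1//.
by move=> i _; rewrite mxE /= expr0n.
Qed.

End euclidean_norm.

(** * Linear changes of variables; volumes of balls and ellipsoids *)

Section lebesgue_rV_linear.
Context {R : realType}.

(** The image of Lebesgue measure under x |-> x T is translation invariant, hence a multiple of
    Lebesgue measure. The constant is later absorbed in the local density and cancels in the ratio
    of volumes. *)
Lemma lebesgue_rV_linear n (T : 'M[R]_n) : T \in unitmx ->
  exists2 c : R, 0 < c & forall A : set 'rV[R]_n, measurable A ->
    lebesgue_rV [set x | A (x *m T)] = (c%:E * lebesgue_rV A)%E.
Proof.
move=> uT; have mT (S : 'M[R]_n) : measurable_fun setT (fun x : 'rV[R]_n => x *m S).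
  exact: measurable_fun_mulmx.
pose mu0 : {measure set 'rV[R]_n -> \bar R} :=
  @measure_function_pushforward__canonical__measure_function_Measure _ _ _ _ _
    (@lebesgue_rV R n) _ (mT T).
pose F k : set 'rV[R]_n := [set y | ball 0 k.+1%:R (y *m invmx T)].
have mF k : measurable (F k) by exact: (measurable_preimageT (mT _) (measurable_ball_rV _ _)).
have muF k : mu0 (F k) = ((2 * k.+1%:R) ^+ n)%:E.
  rewrite -(@lebesgue_rV_ball _ n 0)//; congr (lebesgue_rV _).
  by apply/seteqP; split=> x; rewrite /F /= mulmxK.
have sf : sigma_finite [set: 'rV[R]_n] mu0.
  exists F; last by move=> k; split=> //; rewrite muF ltry.
  apply/esym/seteqP; split=> // x _; exists (Num.truncn `|x *m invmx T|) => //.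
  by rewrite /F /= -ball_normE /= sub0r normrN truncnS_gt.
pose mu : {sigma_finite_measure set 'rV[R]_n -> \bar R} :=
  HB.pack_for {sigma_finite_measure set 'rV[R]_n -> \bar R} (Measure.sort mu0)
    (Measure_isSigmaFinite.Build _ _ _ _ sf).
have [a A mA|c hc] := @translation_invariant_unique R n mu.
  rewrite /mu /= /pushforward -[RHS](lebesgue_rV_shift (a *m invmx T)); last first.
    exact: (measurable_preimageT (mT T) mA).
  congr (lebesgue_rV _); apply/seteqP; split=> x /=.
    by rewrite mulmxDl mulmxKV.
  by rewrite mulmxDl mulmxKV.
(* The constant is so far an extended real. The image [F 0] of the unit sup-norm ball has [mu]-mass
   2 ^ n, which leaves only positive finite values. *)
have := hc _ (mF 0%N); rewrite {1}/mu /= muF mulr1.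
have : (0 <= lebesgue_rV (F 0%N))%E by exact: measure_ge0.
case: (lebesgue_rV (F 0%N)) => [s| |]; last by [].
  rewrite lee_fin => s0.
  have p2 : 0 < 2 ^+ n :> R by exact: exprn_gt0.
  case: c hc => [c hc| |].
  - move=> -[E]; exists c => [|A mA]; last exact: hc.
    rewrite ltNge; apply/negP => c0; move: p2; rewrite E ltNge => /negP; apply.
    exact: mulr_le0_ge0.
  - move=> _; have [->|sn] := eqVneq s 0.
      by rewrite mule0 => -[E]; move: p2; rewrite E ltxx.
    by rewrite gt0_mulye// lte_fin lt0r sn.
  - move=> _; have [->|sn] := eqVneq s 0.
      by rewrite mule0 => -[E]; move: p2; rewrite E ltxx.
    by rewrite gt0_mulNye// lte_fin lt0r sn.
move=> _; have p2 : 0 < 2 ^+ n :> R by exact: exprn_gt0.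
case: c hc => [c hc| |_].
- have [->|c0] := eqVneq c 0.
    by rewrite mul0e => -[E]; move: p2; rewrite E ltxx.
  by rewrite mulr_infty; case: sgrP c0 => //= _ _; rewrite ?mul1e// mulN1e.
- by [].
- by [].
Qed.

Lemma measurable_mulmx_preimage n (T : 'M[R]_n) (A : set 'rV[R]_n) :
  measurable A -> measurable [set x | A (x *m T)].
Proof. by move=> mA; apply: (measurable_preimageT _ mA); exact: measurable_fun_mulmx. Qed.

(** The general linear statement provides some factor; it is identified on a sup-norm ball, whose
    volume is explicit. *)
Lemma lebesgue_rV_scale n r (A : set 'rV[R]_n) : 0 < r -> measurable A ->
  lebesgue_rV [set x | A (r^-1 *: x)] = ((r ^+ n)%:E * lebesgue_rV A)%E.
Proof.
move=> r0 mA; have [|c c0 hc] := @lebesgue_rV_linear n (r^-1)%:M.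
  by rewrite unitmxE det_scalar unitrX// unitfE invr_eq0 gt_eqF.
have E B : [set x : 'rV[R]_n | B (r^-1 *: x)] = [set x | B (x *m (r^-1)%:M)].
  by apply/seteqP; split=> x /=; rewrite mul_mx_scalar.
rewrite E hc//; congr (_%:E * _)%E.
have := hc _ (measurable_ball_rV 0 1); rewrite -E.
rewrite (_ : [set _ | _] = ball 0 r); last first.
  apply/seteqP; split=> x; rewrite -!ball_normE /= !sub0r !normrN normrZ.
    by rewrite normfV gtr0_norm// ltr_pdivrMl// mulr1.
  by rewrite normfV gtr0_norm// ltr_pdivrMl// mulr1.
rewrite !lebesgue_rV_ball// mulr1 exprMn -EFinM => -[/eqP].
by rewrite [in X in _ == X]mulrC (inj_eq (mulfI _)) ?expf_neq0// => /eqP ->.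
Qed.

Lemma eball1E n (c : 'rV[R]_n) : eball1 c = [set x | enorm (x - c) < 1].
Proof. by apply/seteqP; split=> x; rewrite /eball1 /= edistE enorm_distC. Qed.

Lemma measurable_enorm_lt n (T : 'M[R]_n) (c : 'rV[R]_n) r :
  measurable [set x | enorm ((x - c) *m T) < r].
Proof.
rewrite (_ : [set _ | _] = (fun x => edist (x *m T) (c *m T)) @^-1` `]-oo, r[).
  apply: measurable_preimageT; last exact: measurable_itv.
  by apply: measurable_fun_edist => //; exact: measurable_fun_mulmx.
by apply/seteqP; split=> x; rewrite /= in_itv/= edistE mulmxBl.
Qed.

Lemma measurable_eball1 n (c : 'rV[R]_n) : measurable (eball1 c).
Proof.
rewrite eball1E; have := measurable_enorm_lt 1%:M c 1.
by under eq_set do rewrite mulmx1.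
Qed.

Lemma eball1_fin n (c : 'rV[R]_n) : (lebesgue_rV (eball1 c) < +oo)%E.
Proof.
apply: (@le_lt_trans _ _ (lebesgue_rV (ball c 1))).
  apply: le_measure; rewrite ?inE; [exact: measurable_eball1|exact: measurable_ball_rV|].
  rewrite eball1E => x /= h; rewrite -ball_normE/= distrC.
  exact: le_lt_trans (norm_le_enorm _) h.
by rewrite lebesgue_rV_ball// ltry.
Qed.

Lemma ball_volume_gt0 n : 0 < ball_volume R n.
Proof.
rewrite fine_gt0// eball1_fin andbT.
apply: (@lt_le_trans _ _ (lebesgue_rV (ball (0 : 'rV[R]_n) n.+1%:R^-1))).
  by rewrite lebesgue_rV_ball// lte_fin exprn_gt0// mulr_gt0.
apply: le_measure; rewrite ?inE; [exact: measurable_ball_rV|exact: measurable_eball1|].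
rewrite eball1E => x /=; rewrite -ball_normE/= sub0r normrN subr0 => h.
apply: le_lt_trans (enorm_le_norm _) _.
apply: (@le_lt_trans _ _ (n.+1%:R * `|x|)); first by rewrite ler_wpM2r// ler_nat.
by rewrite mulrC -ltr_pdivlMr// mul1r.
Qed.

(** The factor is 1 because the Euclidean unit ball is invariant and has positive finite volume. *)
Lemma lebesgue_rV_orthogonal n (Q : 'M[R]_n) (A : set 'rV[R]_n) :
  Q *m Q^T = 1%:M -> measurable A ->
  lebesgue_rV [set x | A (x *m Q)] = lebesgue_rV A.
Proof.
move=> QQ mA; have [|c c0 hc] := @lebesgue_rV_linear n Q.
  by have [] := mulmx1_unit QQ.
rewrite hc//; have := hc _ (measurable_eball1 0).
rewrite (_ : [set _ | _] = eball1 0); last first.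
  by rewrite eball1E; apply/seteqP; split=> x; rewrite /= !subr0 enorm_isometry.
rewrite -(@fineK _ (lebesgue_rV (eball1 0))); last first.
  by rewrite ge0_fin_numE// eball1_fin.
rewrite -EFinM => -[/eqP]; rewrite -/(ball_volume R n) -[X in X == _]mul1r.
by rewrite (inj_eq (mulIf (lt0r_neq0 (ball_volume_gt0 n)))) => /eqP <-; rewrite mul1e.
Qed.


(** The Euclidean ball about a T pulled back by T: an ellipsoid when T is invertible. Up to small
    errors, this is the shape of a Euclidean ball of R^d in the coordinates of a chart. *)
Definition lball n (T : 'M[R]_n) (a : 'rV[R]_n) (s : R) : set 'rV[R]_n :=
  [set u | enorm ((u - a) *m T) < s].

Lemma measurable_lball n (T : 'M[R]_n) a s : measurable (lball T a s).
Proof. exact: measurable_enorm_lt. Qed.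

Lemma subset_lball n (T : 'M[R]_n) a s t : s <= t -> lball T a s `<=` lball T a t.
Proof. by move=> st u /= h; exact: lt_le_trans h st. Qed.

(** The base point a may differ from the centre b, so that a union of two ellipsoids is normalised
    by one affine change of variables. *)
Lemma lball_affine n (T : 'M[R]_n) a b s : T \in unitmx -> 0 < s ->
  lball T b s = [set u | [set v | [set w | eball1 (s^-1 *: ((b - a) *m T)) (s^-1 *: w)]
    (v *m T)] (u - a)].
Proof.
move=> uT s0; apply/seteqP; split=> u; rewrite /lball /= eball1E /= -scalerBr -mulmxBl;
  by rewrite opprB addrA subrK enormZ ger0_norm ?invr_ge0 ?ltW// ltr_pdivrMl// mulr1.
Qed.

Lemma lebesgue_rV_lball n (T : 'M[R]_n) (c : R) :
  T \in unitmx ->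
  (forall A : set 'rV[R]_n, measurable A ->
    lebesgue_rV [set x | A (x *m T)] = (c%:E * lebesgue_rV A)%E) ->
  forall a s, 0 < s -> lebesgue_rV (lball T a s) = (c * ball_volume R n * s ^+ n)%:E.
Proof.
move=> uT hc a s s0; rewrite (lball_affine a a)//.
have m1 : measurable [set w : 'rV[R]_n | eball1 (s^-1 *: ((a - a) *m T)) (s^-1 *: w)].
  have := measurable_mulmx_preimage (s^-1)%:M (measurable_eball1 (s^-1 *: ((a - a) *m T))).
  by under eq_set do rewrite mul_mx_scalar.
rewrite lebesgue_rV_shift; last exact: measurable_mulmx_preimage.
rewrite hc// (lebesgue_rV_scale s0); last exact: measurable_eball1.
rewrite subrr mul0mx scaler0 -[lebesgue_rV _]fineK ?ge0_fin_numE ?eball1_fin//.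
by rewrite -!EFinM; congr EFin; rewrite -/(ball_volume R n); ring.
Qed.

Lemma two_eball1_fin n (a b : 'rV[R]_n) :
  (lebesgue_rV (eball1 a `|` eball1 b) < +oo)%E.
Proof.
apply: le_lt_trans (measureU2 _ _ _) _; [exact: measurable_eball1..|].
by rewrite lte_add_pinfty// eball1_fin.
Qed.

Lemma lebesgue_rV_two_eball1 n (z : 'rV[R]_n) : (0 < n)%N -> enorm z = 1 ->
  lebesgue_rV (eball1 0 `|` eball1 z) = (two_balls_volume R n)%:E.
Proof.
move=> n0 z1; rewrite /two_balls_volume fineK ?ge0_fin_numE ?two_eball1_fin//.
have [Q QQ <-] := householder (enorm_ebasis n0) z1.
rewrite -(lebesgue_rV_orthogonal QQ); last first.
  by apply: measurableU; exact: measurable_eball1.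
congr (lebesgue_rV _); rewrite !eball1E; apply/seteqP; split=> x /=;
  by rewrite !subr0 -mulmxBl !enorm_isometry.
Qed.

Lemma lebesgue_rV_lballU n (T : 'M[R]_n) (c : R) : (0 < n)%N ->
  T \in unitmx ->
  (forall A : set 'rV[R]_n, measurable A ->
    lebesgue_rV [set x | A (x *m T)] = (c%:E * lebesgue_rV A)%E) ->
  forall a b s, 0 < s -> enorm ((b - a) *m T) = s ->
  lebesgue_rV (lball T a s `|` lball T b s) =
    (c * two_balls_volume R n * s ^+ n)%:E.
Proof.
move=> n0 uT hc a b s s0 abs; rewrite (lball_affine a a)// (lball_affine a b)//.
set z := s^-1 *: ((b - a) *m T).
have z1 : enorm z = 1.
  by rewrite enormZ abs ger0_norm ?invr_ge0 ?ltW// mulVf// gt_eqF.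
rewrite (_ : _ `|` _ = [set u | [set v | [set w | (eball1 0 `|` eball1 z) (s^-1 *: w)]
    (v *m T)] (u - a)]); last first.
  by rewrite subrr mul0mx scaler0.
have mU : measurable (eball1 0 `|` eball1 z).
  by apply: measurableU; exact: measurable_eball1.
have m1 : measurable [set w : 'rV[R]_n | (eball1 0 `|` eball1 z) (s^-1 *: w)].
  have := measurable_mulmx_preimage (s^-1)%:M mU.
  by under eq_set do rewrite mul_mx_scalar.
rewrite lebesgue_rV_shift; last exact: measurable_mulmx_preimage.
rewrite hc// (lebesgue_rV_scale s0)// lebesgue_rV_two_eball1//.
by rewrite -!EFinM; congr EFin; ring.
Qed.

(** The exact volume of the union is available only when the radius equals the distance |(b - a) T|
    of the centres. Passing from radius s to t adds at most the two shells between them. *)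
Lemma lebesgue_rV_lballU_le n (T : 'M[R]_n) (c : R) : T \in unitmx ->
  (forall A : set 'rV[R]_n, measurable A ->
    lebesgue_rV [set x | A (x *m T)] = (c%:E * lebesgue_rV A)%E) ->
  forall a b s t, 0 < s -> s <= t ->
  (lebesgue_rV (lball T a t `|` lball T b t) <=
   lebesgue_rV (lball T a s `|` lball T b s) +
     (2 * (c * ball_volume R n * (t ^+ n - s ^+ n)))%:E)%E.
Proof.
move=> uT hc a b s t s0 st; have t0 := lt_le_trans s0 st.
have D e : lebesgue_rV (lball T e t `\` lball T e s) =
    (c * ball_volume R n * (t ^+ n - s ^+ n))%:E.
  transitivity (lebesgue_rV (lball T e t) -
      lebesgue_rV (lball T e t `&` lball T e s))%E.
    apply: measureD; [exact: measurable_lball|exact: measurable_lball|].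
    by apply: (@le_lt_trans _ _ (c * ball_volume R n * t ^+ n)%:E); rewrite ?ltry// -(lebesgue_rV_lball uT hc e).
  rewrite setIidr; last exact: subset_lball.
  by rewrite !(lebesgue_rV_lball uT hc)// -EFinB mulrBr.
have mD e : measurable (lball T e t `\` lball T e s).
  by apply: measurableD; exact: measurable_lball.
have mU : measurable (lball T a s `|` lball T b s).
  by apply: measurableU; exact: measurable_lball.
apply: (@le_trans _ _ (lebesgue_rV ((lball T a s `|` lball T b s) `|`
  ((lball T a t `\` lball T a s) `|` (lball T b t `\` lball T b s))))).
  apply: le_measure; rewrite ?inE.
  - by apply: measurableU; exact: measurable_lball.
  - by apply: measurableU => //; exact: measurableU.
  - move=> u [h|h].
      by have [h'|h'] := pselect (lball T a s u); [left; left|right; left].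
    by have [h'|h'] := pselect (lball T b s u); [left; right|right; right].
apply: le_trans (measureU2 _ _ _) _ => //; first exact: measurableU.
rewrite leeD2l// (le_trans (measureU2 _ _ _))//.
by rewrite mulr_natl mulr2n EFinD; apply: leeD; [rewrite -(D a)|rewrite -(D b)].
Qed.

Lemma ball_volume_le n : (0 < n)%N -> ball_volume R n <= two_balls_volume R n.
Proof.
move=> n0; rewrite fine_le//.
- by rewrite ge0_fin_numE// eball1_fin.
- by rewrite ge0_fin_numE// two_eball1_fin.
apply: le_measure; rewrite ?inE; [exact: measurable_eball1| |exact: subsetUl].
by apply: measurableU; exact: measurable_eball1.
Qed.

Lemma two_balls_volume_gt0 n : (0 < n)%N -> 0 < two_balls_volume R n.
Proof. by move=> n0; exact: lt_le_trans (ball_volume_gt0 n) (ball_volume_le n0). Qed.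

End lebesgue_rV_linear.

(** * Density points of finite measures *)

Section regularity.
Context {R : realType} {n : nat}.

Lemma measure_increasing_approx d (T : measurableType d)
    (mu : {finite_measure set T -> \bar R}) (F : nat -> set T) :
  (forall k, measurable (F k)) -> {homo F : i j / (i <= j)%N >-> i `<=` j} ->
  forall e, 0 < e -> exists k, (mu (\bigcup_k F k `\` F k) <= e%:E)%E.
Proof.
move=> mF ndF e e0; have mU : measurable (\bigcup_k F k) by exact: bigcupT_measurable.
pose G k := \bigcup_k F k `\` F k.
have G0 : \bigcap_k G k = set0.
  apply/seteqP; split=> // x Gx; have [[i _ Fix] _] := Gx 0%N I.
  by have [_] := Gx i I; exact.
have mG k : measurable (G k) by exact: measurableD.
have : (mu \o G) x @[x --> \oo] --> mu (\bigcap_k G k).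
  apply: nonincreasing_cvg_mu => //.
  - by rewrite ltey_eq fin_num_measure.
  - by rewrite G0.
  - by move=> i j ij; apply/subsetPset => x [Ux nFi]; split=> // /(ndF _ _ ij).
rewrite G0 measure0.
move=> /fine_cvgP[_ /cvgrPdist_le /(_ _ e0)] [k _ /(_ k (leqnn k))] /=.
rewrite sub0r normrN ger0_norm ?fine_ge0// => h; exists k.
by rewrite -(@fineK _ (mu (G k))) ?lee_fin// fin_num_measure.
Qed.

(** The approximable sets form a sigma-algebra: complementation exchanges U and C, and a countable
    union spreads the error over a geometric series. Open sets belong to it as increasing unions of
    closed sets. *)
Lemma finite_measure_regular (mu : {finite_measure set 'rV[R]_n -> \bar R})
    (A : set 'rV[R]_n) : measurable A -> forall e, 0 < e ->
  exists U C, [/\ open U, closed C, C `<=` A, A `<=` U & (mu (U `\` C) <= e%:E)%E].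
Proof.
pose H := [set A : set 'rV[R]_n | forall e, 0 < e ->
  exists U C, [/\ open U, closed C, C `<=` A, A `<=` U & (mu (U `\` C) <= e%:E)%E]].
suff: @measurable _ 'rV[R]_n `<=` H by move=> h mA; exact: h.
apply: smallest_sub; first split.
- move=> e e0; exists set0, set0.
  by split; [exact: open0|exact: closed0|by []|by []|rewrite setD0 measure0 lee_fin ltW].
- move=> B HB e e0; have [U [C [oU cC CB BU h]]] := HB e e0.
  exists (~` C), (~` U); split; [exact: closed_openC|exact: open_closedC| | |].
  + by rewrite setTD; apply: subsetC.
  + by rewrite setTD; apply: subsetC.
  + by rewrite setDE setCK setIC -setDE.
- move=> F HF e e0.
  have /choice[U] : forall k, exists U, exists C, [/\ open U, closed C,
      C `<=` F k, F k `<=` U & (mu (U `\` C) <= (e / 2 / (2 ^ k.+1)%:R)%:E)%E].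
    by move=> k; apply: HF; rewrite !divr_gt0// ltr0n expn_gt0.
  move=> /choice[C /all_and5[oU cC CF FU h]].
  have mC k : measurable (C k) by exact: closed_measurable_rV.
  have mU k : measurable (U k) by exact: open_measurable_rV.
  (* A countable union of closed sets may fail to be closed, so a finite one is kept, long enough to
     lose at most e / 2. *)
  pose G k := \big[setU/set0]_(i < k) C i.
  have mG k : measurable (G k) by exact: bigsetU_measurable.
  have GE : \bigcup_k G k = \bigcup_k C k.
    apply/seteqP; split=> [x [k _]|x [k _ Ckx]].
      by rewrite /G -bigcup_mkord => -[i _ Cix]; exists i.
    by exists k.+1 => //; rewrite /G -bigcup_mkord; exists k => /=.
  have e2 : 0 < e / 2 by rewrite divr_gt0.
  have ndG : {homo G : i j / (i <= j)%N >-> i `<=` j}.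
    move=> i j ij x; rewrite /G -!bigcup_mkord => -[l /= li Clx].
    by exists l => //=; exact: leq_trans ij.
  have [k hk] := @measure_increasing_approx _ _ mu G mG ndG _ e2.
  exists (\bigcup_k U k), (G k); split.
  + exact: bigcup_open.
  + by rewrite /G; apply: closed_bigsetU.
  + by move=> x Gx; have [i _ Cix] : (\bigcup_k C k) x by [rewrite -GE; exists k];
      exists i => //; exact: CF.
  + by move=> x [i _ Fix]; exists i => //; exact: FU.
  + apply: (@le_trans _ _ (mu ((\bigcup_k (U k `\` C k)) `|` (\bigcup_k G k `\` G k)))).
      apply: le_measure; rewrite ?inE.
      * by apply: measurableD => //; exact: bigcupT_measurable.
      * apply: measurableU; first by apply: bigcupT_measurable => i; exact: measurableD.
        by apply: measurableD => //; exact: bigcupT_measurable.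
      * move=> x [[i _ Uix] nG]; have [Cix|nC] := pselect (C i x).
          by right; split=> //; rewrite GE; exists i.
        by left; exists i.
    apply: le_trans (measureU2 _ _ _) _.
    * by apply: bigcupT_measurable => i; exact: measurableD.
    * by apply: measurableD => //; exact: bigcupT_measurable.
    rewrite [e]splitr EFinD; apply: leeD => //.
    apply: le_trans (measure_sigma_subadditive mu _ _ (@subset_refl _ _)) _.
    * by move=> i; exact: measurableD.
    * by apply: bigcupT_measurable => i; exact: measurableD.
    apply: le_trans (epsilon_trick0 xpredT (ltW e2)).
    by apply: lee_nneseries => // i _; exact: h.
move=> V oV e e0.
(* Points at sup-norm distance at least 1 / (k + 1) from the complement of V. *)
pose G k := ~` (\bigcup_(y in ~` V) ball y k.+1%:R^-1) : set 'rV[R]_n.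
have cG k : closed (G k).
  by apply: open_closedC; apply: bigcup_open => y _; exact: ball_open.
have mG k : measurable (G k) by exact: closed_measurable_rV.
have GE : \bigcup_k G k = V.
  apply/seteqP; split=> [x [k _ Gkx]|x Vx].
    apply: contrapT => nVx; apply: Gkx; exists x => //.
    by apply: ballxx; rewrite invr_gt0.
  have /nbhs_ballP[r/= r0 rV] : nbhs x V by exact: open_nbhs_nbhs.
  exists (Num.truncn r^-1) => //; move=> [y nVy xy]; apply: nVy; apply: rV.
  apply: ball_sym; apply: le_ball xy.
  by rewrite -[leRHS]invrK lef_pV2 ?posrE ?invr_gt0// ltW// truncnS_gt.
have [|k hk] := @measure_increasing_approx _ _ mu G mG _ _ e0.
  move=> i j ij x nGx [y nVy xy]; apply: nGx; exists y => //.
  by apply: le_ball xy; rewrite lef_pV2 ?posrE// ler_nat ltnS.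
exists V, (G k); split=> //; last by rewrite -[in X in mu X]GE.
by rewrite -GE => x Gkx; exists k.
Qed.

Lemma finite_measure_outer (mu : {finite_measure set 'rV[R]_n -> \bar R})
    (A : set 'rV[R]_n) : measurable A -> mu A = 0%E -> forall e, 0 < e ->
  exists U, [/\ open U, A `<=` U & (mu U <= e%:E)%E].
Proof.
move=> mA A0 e e0; have [U [C [oU cC CA AU h]]] := finite_measure_regular mu mA e0.
exists U; split=> //; rewrite -(setUIDK U C).
have mU := open_measurable_rV oU; have mC := closed_measurable_rV cC.
have UC0 : mu (U `&` C) = 0%E.
  apply/eqP; rewrite -measure_le0 -A0; apply: le_measure; rewrite ?inE//; first exact: measurableI.
  by move=> x [_ /CA].
have : (mu ((U `&` C) `|` (U `\` C)) <= mu (U `&` C) + mu (U `\` C))%E.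
  by apply: measureU2; [exact: measurableI|exact: measurableD].
by rewrite UC0 add0e => /le_trans; apply.
Qed.

End regularity.

(** * Vitali covering, differentiation of measures and density points *)

Section vitali.
Context {R : realType} {n : nat}.

Lemma exists_seq_max (I : eqType) (r : I -> R) (i : I) (s : seq I) :
  exists2 j, j \in i :: s & forall k, k \in i :: s -> r k <= r j.
Proof.
elim: s i => [|a s IH] i.
  by exists i; rewrite ?mem_head// => k; rewrite inE => /eqP ->.
have [j js jmax] := IH a; have [rij|rji] := leP (r i) (r j).
  exists j; first by rewrite inE js orbT.
  by move=> k; rewrite inE => /orP[/eqP ->//|]; exact: jmax.
exists i; rewrite ?mem_head// => k; rewrite inE => /orP[/eqP ->//|/jmax kj].
exact: le_trans kj (ltW rji).
Qed.

(* Greedy Vitali selection, carried out directly on the measures: a ball of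
   largest radius is kept, and 3 times it absorbs all the balls that meet it. *)
Lemma vitali_bound (nu : {finite_measure set 'rV[R]_n -> \bar R}) (K : R)
    (I : choiceType) (x : I -> 'rV[R]_n) (r : I -> R) : 0 <= K ->
  (forall i, 0 < r i) ->
  forall s : seq I,
  (forall i, i \in s -> (((6 * r i) ^+ n)%:E <= K%:E * nu (ball (x i) (r i)))%E) ->
  (lebesgue_rV (\big[setU/set0]_(i <- s) ball (x i) (r i)) <=
     K%:E * nu (\big[setU/set0]_(i <- s) ball (x i) (r i)))%E.
Proof.
move=> K0 r0 s; have [k] := ubnP (size s); elim: k s => // k IH [|i0 s] sk hs.
  by rewrite big_nil !measure0 mule0.
have [j js jmax] := exists_seq_max r i0 s.
set t := i0 :: s in sk hs js jmax *.
have mB i : measurable (ball (x i) (r i)) by exact: measurable_ball_rV.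
(* The balls disjoint from the chosen one. [j] itself is excluded, so the list is strictly shorter
   and the induction applies. *)
pose t' := [seq i <- t | `[< ball (x i) (r i) `&` ball (x j) (r j) = set0 >]].
have jB : ball (x j) (r j) (x j) by exact: ballxx.
have t'k : (size t' < k)%N.
  apply: (@leq_ltn_trans (size s)); last by move: sk; rewrite /t /= ltnS.
  rewrite -ltnS -[(size s).+1]/(size t) /t' size_filter.
  rewrite -(count_predC (fun i => `[< ball (x i) (r i) `&` ball (x j) (r j) = set0 >]) t).
  rewrite -addn1 leq_add2l -has_count; apply/hasP; exists j => //=.
  by apply/asboolPn => /seteqP[/(_ (x j))] h _; apply: h.
have IH' : (lebesgue_rV (\big[setU/set0]_(i <- t') ball (x i) (r i)) <=
     K%:E * nu (\big[setU/set0]_(i <- t') ball (x i) (r i)))%E.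
  by apply: IH => // i; rewrite mem_filter => /andP[_]; exact: hs.
have mt (u : seq I) : measurable (\big[setU/set0]_(i <- u) ball (x i) (r i)).
  by apply: bigsetU_measurable.
apply: (@le_trans _ _ (lebesgue_rV (ball (x j) (3 * r j) `|`
    \big[setU/set0]_(i <- t') ball (x i) (r i)))).
  apply: le_measure; rewrite ?inE//.
    by apply: measurableU => //; exact: measurable_ball_rV.
  rewrite -!bigcup_seq => y [i /= it iy].
  have [dij|/eqP/set0P[z [zi zj]]] := pselect (ball (x i) (r i) `&` ball (x j) (r j) = set0).
    by right; exists i => //=; rewrite mem_filter it andbT; apply/asboolP.
  left; move: iy zi zj; rewrite -!ball_normE /= => iy zi zj.
  have rij := jmax _ it.
  have -> : x j - y = (x j - z) + ((z - x i) + (x i - y)).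
    by rewrite !addrA subrK subrK.
  apply: le_lt_trans (ler_normD _ _) _.
  have := ler_normD (z - x i) (x i - y); rewrite (distrC z); lra.
apply: le_trans (measureU2 _ _ _) _ => //; first exact: measurable_ball_rV.
apply: (@le_trans _ _ (K%:E * (nu (ball (x j) (r j)) +
    nu (\big[setU/set0]_(i <- t') ball (x i) (r i))))%E).
  rewrite ge0_muleDr; [|exact: measure_ge0|exact: measure_ge0].
  apply: leeD => //; apply: le_trans (hs _ js).
  have -> : ((6 * r j) ^+ n)%:E = lebesgue_rV (ball (x j) (3 * r j)).
    by rewrite lebesgue_rV_ball ?mulr_gt0// mulrA -natrM.
  exact: lexx.
apply: lee_wpmul2l; first by rewrite lee_fin.
have -> : (nu (ball (x j) (r j)) + nu (\big[setU/set0]_(i <- t') ball (x i) (r i)))%E =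
    nu (ball (x j) (r j) `|` \big[setU/set0]_(i <- t') ball (x i) (r i)).
  apply/esym; apply: measureU => //; apply/seteqP; split=> // y [yj].
  rewrite -bigcup_seq => -[i /=]; rewrite mem_filter => /andP[/asboolP dij _] yi.
  by suff : set0 y by []; rewrite -dij.
apply: le_measure; rewrite ?inE//; first exact: measurableU.
rewrite -!bigcup_seq => y [yj|[i /=]]; first by exists j.
by rewrite mem_filter => /andP[_ it] yi; exists i.
Qed.

Lemma negligible_approx (mu : {measure set 'rV[R]_n -> \bar R}) (A : set 'rV[R]_n) :
  (forall e, 0 < e -> exists G, [/\ measurable G, A `<=` G & (mu G <= e%:E)%E]) ->
  mu.-negligible A.
Proof.
move=> h; have /choice[G /all_and3[mG AG Ge]] : forall k, exists G,
    [/\ measurable G, A `<=` G & (mu G <= (k.+1%:R^-1)%:E)%E].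
  by move=> k; apply: h; rewrite invr_gt0.
have mI : measurable (\bigcap_k G k) by exact: bigcapT_measurable.
exists (\bigcap_k G k); split=> //; last by move=> x Ax k _; exact: AG.
apply/eqP; rewrite -measure_le0; apply/lee_addgt0Pr => e e0; rewrite add0e.
apply: le_trans (_ : mu (G (Num.truncn e^-1)) <= _)%E; last first.
  apply: le_trans (Ge _) _; rewrite lee_fin -[leRHS]invrK.
  by rewrite lef_pV2 ?posrE ?invr_gt0// ltW// truncnS_gt.
by apply: le_measure; rewrite ?inE// => x; exact.
Qed.

(** N is enclosed in an open U with nu U <= e / K. Each point concerned lies in a rational ball
    inside U that meets the hypothesis of the covering bound; finite unions of such balls have
    Lebesgue measure at most K nu(U) <= e, and so does their countable union. *)
Lemma vitali_negligible (nu : {finite_measure set 'rV[R]_n -> \bar R})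
    (N : set 'rV[R]_n) (k : R) : measurable N -> nu N = 0%E -> 0 < k ->
  (@lebesgue_rV R n).-negligible [set x | N x /\ forall d, 0 < d ->
     exists r, 0 < r < d /\ ((k * r ^+ n)%:E < nu (ball x r))%E].
Proof.
move=> mN N0 k0; apply: negligible_approx => e e0.
(* The rational ball put around [ball x r] has radius at most 3 r, and (6 * 3 r) ^ n = K k r ^ n. *)
pose K : R := 18 ^+ n / k; have K0 : 0 < K by rewrite divr_gt0// exprn_gt0.
have [U [oU NU Ue]] := finite_measure_outer mN N0 (divr_gt0 e0 K0).
pose good (c : 'rV[rat]_n * rat) : Prop := [/\ 0 < ratr c.2 :> R,
  @ratball R n c `<=` U &
  (((6 * ratr c.2) ^+ n)%:E <= K%:E * nu (@ratball R n c))%E].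
pose F j := if unpickle j is Some c then
  if `[< good c >] then @ratball R n c else set0 else set0.
have mF j : measurable (F j).
  rewrite /F; case: unpickle => // c; case: ifP => // _; exact: measurable_ball_rV.
have FU j : F j `<=` U.
  rewrite /F; case: unpickle => [c|]; last exact: sub0set.
  by case: ifPn => [/asboolP[_ cU _]|_]; [exact: cU|exact: sub0set].
have mG j : measurable (\big[setU/set0]_(i < j) F i) by exact: bigsetU_measurable.
have GE : \bigcup_j \big[setU/set0]_(i < j) F i = \bigcup_j F j.
  apply/seteqP; split=> [x [j _]|x [j _ Fjx]].
    by rewrite -bigcup_mkord => -[i _ Fix]; exists i.
  by exists j.+1 => //; rewrite -bigcup_mkord; exists j => /=.
have bound j : (lebesgue_rV (\big[setU/set0]_(i < j) F i) <= e%:E)%E.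
  pose s := [seq c <- pmap (fun i => unpickle i) (iota 0 j) | `[< good c >]].
  (* The value 1 makes the radius positive also for indices outside the list, as the covering bound
     asks. *)
  pose rr (c : 'rV[rat]_n * rat) : R := if `[< good c >] then ratr c.2 else 1.
  have rr0 c : 0 < rr c by rewrite /rr; case: ifPn => // /asboolP[].
  have h := @vitali_bound nu K _ (fun c : 'rV[rat]_n * rat => map_mx ratr c.1) rr
    (ltW K0) rr0 s.
  have E : \big[setU/set0]_(i < j) F i =
      \big[setU/set0]_(c <- s) ball (map_mx ratr c.1 : 'rV[R]_n) (rr c).
    rewrite -bigcup_mkord -bigcup_seq; apply/seteqP; split=> [x [i /= ij]|x [c /=]].
      rewrite /F; case Ei : unpickle => [c|//]; case: ifPn => // gc xc.
      exists c; last by rewrite /rr gc.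
      rewrite /= mem_filter gc mem_pmap; apply/mapP; exists i => //.
      by rewrite mem_iota add0n.
    rewrite mem_filter mem_pmap => /andP[gc /mapP[i]]; rewrite mem_iota add0n => ij Ei.
    by rewrite /rr gc => xc; exists i => //; rewrite /F -Ei gc.
  rewrite E; apply: le_trans (h _) _.
    move=> c; rewrite mem_filter => /andP[gc _]; rewrite /rr gc.
    by move/asboolP : gc => [].
  rewrite -E; apply: le_trans (_ : K%:E * nu U <= _)%E.
    apply: lee_wpmul2l; first by rewrite lee_fin ltW.
    apply: le_measure; rewrite ?inE//; first exact: open_measurable_rV.
    by rewrite -bigcup_mkord => x [i _]; exact: FU.
  rewrite (_ : e = K * (e / K)); last by rewrite mulrC divfK// gt_eqF.
  by rewrite (EFinM K); apply: lee_wpmul2l => //; rewrite lee_fin ltW.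
exists (\bigcup_j F j); split; first exact: bigcupT_measurable.
  move=> x [Nx hx]; have [d/= d0 dU] : nbhs_ball x U.
    by apply/nbhs_ballP; apply: open_nbhs_nbhs; split=> //; exact: NU.
  (* The rational ball around [ball x r] is contained in [ball x (4 * r)], hence in U when r < d /
     4. *)
  have d40 : 0 < d / 4 by rewrite divr_gt0.
  have [r [/andP[r0 rd] hr]] := hx _ d40.
  have [c [xc cx /andP[c0 cr]]] := ratball_between x r0.
  exists (pickle c) => //; rewrite /F pickleK; case: ifPn => [_|/asboolPn []].
    by apply: xc; exact: ballxx.
  split=> //.
    apply: subset_trans dU; apply: subset_trans cx _; apply: le_ball; lra.
  apply: (@le_trans _ _ (K * (k * r ^+ n))%:E).
    rewrite lee_fin /K mulrA divfK ?gt_eqF// -exprMn.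
    have tr : 6 * (ratr c.2 : R) <= 18 * r by move: cr; clear; lra.
    by rewrite lerXn2r// nnegrE mulr_ge0// ltW.
  rewrite (EFinM K); apply: lee_wpmul2l; first by rewrite lee_fin ltW.
  apply: le_trans (ltW hr) _; apply: le_measure; rewrite ?inE//;
    exact: measurable_ball_rV.
rewrite -GE; suff : (lebesgue_rV (\bigcup_j \big[setU/set0]_(i < j) F i) <= e%:E)%E by [].
have : (@lebesgue_rV R n \o (fun j => \big[setU/set0]_(i < j) F i)) x
    @[x --> \oo] --> lebesgue_rV (\bigcup_j \big[setU/set0]_(i < j) F i).
  apply: nondecreasing_cvg_mu => //; first exact: bigcupT_measurable.
  move=> i j ij; apply/subsetPset => x; rewrite -!bigcup_mkord => -[l /= li Flx].
  by exists l => //=; exact: leq_trans ij.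
move=> /cvg_lim <- //; apply: lime_le; last by near=> j; exact: bound.
apply: ereal_nondecreasing_is_cvgn => i j ij /=.
apply: le_measure; rewrite ?inE; [exact: mG|exact: mG|].
move=> x; rewrite -!bigcup_mkord => -[l /= li Flx].
by exists l => //=; exact: leq_trans ij.
Unshelve. all: by end_near. Qed.

(** Countable union of the exceptional sets for the thresholds 1 / (j + 1). Below, [nu] is the
    restriction of a measure to a level set of a density (in a bounded window if need be) and N is
    the complementary level set. *)
Lemma small_ball_ae (nu : {finite_measure set 'rV[R]_n -> \bar R})
    (N : set 'rV[R]_n) : measurable N -> nu N = 0%E ->
  {ae @lebesgue_rV R n, forall x, N x -> forall k, 0 < k ->
    exists2 d, 0 < d & forall r, 0 < r < d -> (nu (ball x r) <= (k * r ^+ n)%:E)%E}.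
Proof.
move=> mN N0; pose B k := [set x | N x /\ forall d, 0 < d ->
     exists r, 0 < r < d /\ ((k.+1%:R^-1 * r ^+ n)%:E < nu (ball x r))%E].
have : (@lebesgue_rV R n).-negligible (\bigcup_k B k).
  by apply: negligible_bigcup => k; apply: vitali_negligible => //; rewrite invr_gt0.
apply: negligibleS => x /=; apply: contra_notP => nB Nx k k0.
apply: contrapT => hk; apply: nB; exists (Num.truncn k^-1) => //; split=> // d d0.
apply: contrapT => hd; apply: hk; exists d => // r r0d.
rewrite leNgt; apply/negP => hr; apply: hd; exists r; split=> //.
apply: le_lt_trans hr; rewrite lee_fin ler_wpM2r//.
  by rewrite exprn_ge0// ltW//; case/andP : r0d.
by rewrite -[leRHS]invrK lef_pV2 ?posrE ?invr_gt0// ltW// truncnS_gt.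
Qed.


Lemma mrestr_finite d (T : measurableType d) (mu : {measure set T -> \bar R})
    (D : set T) : measurable D -> (mu D < +oo)%E ->
  exists nu : {finite_measure set T -> \bar R},
    forall A, nu A = mu (A `&` D).
Proof. by move=> mD Doo; exists (mfrestr mD Doo). Qed.

Lemma ae_forall_countable d (T : measurableType d) (mu : {measure set T -> \bar R})
    (U : countType) (Q : U -> T -> Prop) :
  (forall u, {ae mu, forall x, Q u x}) -> {ae mu, forall x, forall u, Q u x}.
Proof.
move=> aeQ; have : mu.-negligible (\bigcup_j
    (if unpickle j is Some u then [set x | ~ Q u x] else set0)).
  apply: negligible_bigcup => j; case: unpickle => [u|]; first exact: aeQ.
  exact: negligible_set0.
apply: negligibleS => x /= /existsNP[u nQ]; exists (pickle u) => //.
by rewrite pickleK.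
Qed.

(** Let f be the Radon-Nikodym density. For a rational q > f(v), the nu-mass of {f > q} in balls
    about v is o(r ^ n); for p < f(v), so is the Lebesgue measure of {f < p}. Elsewhere nu lies
    between p and q times Lebesgue measure. Working with level sets rather than averages of f gives
    the estimate for all measurable D in the ball at once, as unions of ellipsoids require. *)
Lemma density_points (nu : {finite_measure set 'rV[R]_n -> \bar R}) :
  nu `<< @lebesgue_rV R n ->
  {ae nu, forall v, exists2 c : R, 0 < c & forall e, 0 < e -> exists2 d, 0 < d &
     forall r (D : set 'rV[R]_n), 0 < r < d -> measurable D -> D `<=` ball v r ->
       (nu D <= c%:E * lebesgue_rV D + (e * r ^+ n)%:E)%E /\
       (c%:E * lebesgue_rV D <= nu D + (e * r ^+ n)%:E)%E}.
Proof.
move=> nul; have [f0 [f0_ge0 f0_fin f0_int nuE]] := radon_nikodym_sigma_finite nul.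
pose f (x : 'rV[R]_n) : R := fine (f0 x).
pose fgt (q : R) : set 'rV[R]_n := [set x | q < f x].
pose flt (q : R) : set 'rV[R]_n := [set x | f x < q].
pose fle (q : R) : set 'rV[R]_n := [set x | f x <= q].
pose fge (q : R) : set 'rV[R]_n := [set x | q <= f x].
(* Bounded windows: Lebesgue measure is cut down to a finite measure before the small-ball statement
   is applied to it. *)
pose bN N : set 'rV[R]_n := ball 0 N.+1%:R.
have fE x : f0 x = (f x)%:E by rewrite fineK.
have f_ge0 x : 0 <= f x by exact: fine_ge0.
have mf0 : measurable_fun setT f0 by exact: measurable_int f0_int.
have mf : measurable_fun setT f by exact: measurableT_comp.
have mlt q : measurable (flt q).
  have := measurable_preimageT mf (measurable_itv `]-oo, q[).
  by congr measurable; apply/seteqP; split=> x /=; rewrite in_itv.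
have mle q : measurable (fle q).
  have := measurable_preimageT mf (measurable_itv `]-oo, q]).
  by congr measurable; apply/seteqP; split=> x /=; rewrite in_itv.
have mgt q : measurable (fgt q).
  have := measurable_preimageT mf (measurable_itv `]q, +oo[).
  by congr measurable; apply/seteqP; split=> x /=; rewrite in_itv/= andbT.
have mge q : measurable (fge q).
  have := measurable_preimageT mf (measurable_itv `[q, +oo[).
  by congr measurable; apply/seteqP; split=> x /=; rewrite in_itv/= andbT.
have nu_le q D : 0 <= q -> measurable D -> (forall x, D x -> f x <= q) ->
    (nu D <= q%:E * lebesgue_rV D)%E.
  move=> q0 mD Dq; rewrite nuE// -integral_cst//; apply: ge0_le_integral => //.
  - exact: measurable_funS mf0.
  - by move=> x Dx; rewrite fE lee_fin Dq.
have nu_ge q D : 0 <= q -> measurable D -> (forall x, D x -> q <= f x) ->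
    (q%:E * lebesgue_rV D <= nu D)%E.
  move=> q0 mD Dq; rewrite nuE// -integral_cst//; apply: ge0_le_integral => //.
  - exact: measurable_funS mf0.
  - by move=> x Dx; rewrite fE lee_fin Dq.
have up (q : rat) : {ae @lebesgue_rV R n, forall x, f x <= ratr q -> forall k, 0 < k ->
    exists2 d, 0 < d & forall r, 0 < r < d ->
      (nu (ball x r `&` fgt (ratr q)) <= (k * r ^+ n)%:E)%E}.
  have [|nuq nuqE] := @mrestr_finite _ _ nu _ (mgt (ratr q)).
    by rewrite ltey_eq fin_num_measure.
  have := @small_ball_ae nuq _ (mle (ratr q)).
  have -> : nuq (fle (ratr q)) = 0%E.
    rewrite nuqE (_ : _ `&` _ = set0) ?measure0//.
    by apply/seteqP; split=> // x []; rewrite /fle /fgt /= => h; rewrite ltNge h.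
  move=> /(_ erefl); apply: filterS => x h /h {}h k /h[d d0 hd].
  by exists d => // r /hd; rewrite nuqE.
have low (q : rat) (N : nat) : {ae @lebesgue_rV R n, forall x,
    ratr q <= f x -> forall k, 0 < k ->
    exists2 d, 0 < d & forall r, 0 < r < d ->
      (lebesgue_rV (ball x r `&` (flt (ratr q) `&` bN N)) <= (k * r ^+ n)%:E)%E}.
  have mD : measurable (flt (ratr q) `&` bN N).
    by apply: measurableI => //; exact: measurable_ball_rV.
  have [|nuq nuqE] := @mrestr_finite _ _ (@lebesgue_rV R n) _ mD.
    apply: (@le_lt_trans _ _ (lebesgue_rV (bN N))).
      by apply: le_measure; rewrite ?inE//; exact: measurable_ball_rV.
    by rewrite /bN lebesgue_rV_ball// ltry.
  have := @small_ball_ae nuq _ (mge (ratr q)).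
  have -> : nuq (fge (ratr q)) = 0%E.
    rewrite nuqE (_ : _ `&` _ = set0) ?measure0//.
    by apply/seteqP; split=> // x []; rewrite /fge /flt /= => h []; rewrite ltNge h.
  move=> /(_ erefl); apply: filterS => x h /h {}h k /h[d d0 hd].
  by exists d => // r /hd; rewrite nuqE.
have fpos : {ae nu, forall x, 0 < f x}.
  exists (fle 0); split; first exact: mle.
    apply/eqP; rewrite -measure_le0; apply: le_trans (nu_le 0 _ _ _ _) _ => //.
    by rewrite mul0e.
  by move=> x /= /negP; rewrite -leNgt.
have ae_nu (Q : 'rV[R]_n -> Prop) : {ae @lebesgue_rV R n, forall x, Q x} -> {ae nu, forall x, Q x}.
  move=> [Z [mZ Z0 QZ]]; exists Z; split=> //.
  by move/null_content_dominatesP : nul; apply.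
have Aup : {ae nu, forall x, forall q : rat, f x <= ratr q -> forall k, 0 < k ->
    exists2 d, 0 < d & forall r, 0 < r < d ->
      (nu (ball x r `&` fgt (ratr q)) <= (k * r ^+ n)%:E)%E}.
  by apply: ae_nu; apply: ae_forall_countable.
have Alow : {ae nu, forall x, forall (q : rat) (N : nat), ratr q <= f x ->
    forall k, 0 < k -> exists2 d, 0 < d & forall r, 0 < r < d ->
      (lebesgue_rV (ball x r `&` (flt (ratr q) `&` bN N)) <= (k * r ^+ n)%:E)%E}.
  by apply: ae_nu; apply: ae_forall_countable => q; apply: ae_forall_countable.
apply: filterS3 fpos Aup Alow => v fv hup hlow; exists (f v) => // e e0.
have p2 : 0 < 2 ^+ n :> R by exact: exprn_gt0.
(* [t] times the volume (2 r) ^ n of the ball is (e / 2) r ^ n. *)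
pose t := e / (2 * 2 ^+ n); have t0 : 0 < t by rewrite divr_gt0// mulr_gt0.
have [q] : exists q, ratr q \in `](f v), (f v + t)[ by apply: rat_in_itvoo; lra.
rewrite in_itv/= => /andP[q1 q2].
have [p] : exists q, ratr q \in `](Num.max 0 (f v - t)), (f v)[.
  by apply: rat_in_itvoo; rewrite gt_max fv; lra.
rewrite in_itv/= gt_max => /andP[/andP[p0 p1] p2'].
(* The window [bN N] contains every ball about v of radius at most 1. *)
pose N := Num.truncn (`|v| + 1).
have e2 : 0 < e / 2 by rewrite divr_gt0.
have [d1 d10 hd1] := hup q (ltW q1) _ e2.
have [d2 d20 hd2] := hlow p N (ltW p2') _ (divr_gt0 e2 p0).
exists (Num.min 1 (Num.min d1 d2)); first by rewrite !lt_min ltr01 d10 d20.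
move=> r D /andP[r0]; rewrite !lt_min => /andP[r1 /andP[rd1 rd2]] mD Dr.
have mb := measurable_ball_rV v r.
have lD : (lebesgue_rV D <= ((2 * r) ^+ n)%:E)%E.
  by rewrite -(lebesgue_rV_ball v r0); apply: le_measure; rewrite ?inE.
have lDfin : lebesgue_rV D \is a fin_num.
  by rewrite ge0_fin_numE//; exact: le_lt_trans lD (ltry _).
have /fineK lE := lDfin; set l := fine (lebesgue_rV D) in lE.
have l0 : 0 <= l by exact: fine_ge0.
have ll : l <= (2 * r) ^+ n by rewrite -lee_fin lE.
have tl : t * l <= e / 2 * r ^+ n.
  apply: le_trans (_ : t * (2 * r) ^+ n <= _); first by rewrite ler_wpM2l// ltW.
  by rewrite exprMn mulrA /t invfM mulrA divfK ?gt_eqF.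
have rn : 0 < r ^+ n by exact: exprn_gt0.
split.
  rewrite -(setUIDK D (fgt (ratr q))).
  apply: le_trans (measureU2 nu _ _) _; [exact: measurableI|exact: measurableD|].
  rewrite setUIDK addeC -lE; apply: le_trans (_ : (ratr q * l)%:E + (e / 2 * r ^+ n)%:E <= _)%E.
    apply: leeD.
      apply: le_trans (nu_le (ratr q) _ _ _ _) _.
      - exact: le_trans (f_ge0 v) (ltW q1).
      - exact: measurableD.
      - by move=> x [_ /negP]; rewrite -leNgt.
      rewrite (EFinM (ratr q) l) lE; apply: lee_wpmul2l; first by rewrite lee_fin (le_trans (f_ge0 v) (ltW q1)).
      by apply: le_measure; rewrite ?inE//; solve [exact: measurableI|exact: measurableD|exact: setSI|exact: subDsetl|exact: subIsetl].
    apply: le_trans (hd1 r _); last by rewrite r0.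
    by apply: le_measure; rewrite ?inE//; solve [exact: measurableI|exact: measurableD|exact: setSI|exact: subDsetl|exact: subIsetl].
  rewrite -EFinM -!EFinD lee_fin.
  have : ratr q * l <= (f v + t) * l by rewrite ler_wpM2r// ltW.
  by move: tl; lra.
apply: (@le_trans _ _ ((ratr p)%:E * lebesgue_rV D + (t * l)%:E)%E).
  rewrite -lE -!EFinM -EFinD lee_fin -mulrDl ler_wpM2r//.
  by move: p1; lra.
have -> : (e * r ^+ n = e / 2 * r ^+ n + e / 2 * r ^+ n) by lra.
rewrite EFinD addeA; apply: leeD; last by rewrite lee_fin.
apply: (@le_trans _ _ ((ratr p)%:E * lebesgue_rV (D `&` fge (ratr p)) +
    (ratr p)%:E * lebesgue_rV (ball v r `&` (flt (ratr p) `&` bN N)))%E).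
  rewrite -ge0_muleDr//; apply: lee_wpmul2l; first by rewrite lee_fin ltW.
  apply: (@le_trans _ _ (lebesgue_rV ((D `&` fge (ratr p)) `|`
    (ball v r `&` (flt (ratr p) `&` bN N))))).
    apply: le_measure; rewrite ?inE//.
      apply: measurableU; first exact: measurableI.
      by apply: measurableI => //; apply: measurableI => //; exact: measurable_ball_rV.
    move=> x Dx; have [h|h] := leP (ratr p) (f x); first by left.
    right; split; [exact: Dr|split=> //].
    have := Dr _ Dx; rewrite /bN -!ball_normE /= sub0r normrN => vx.
    have -> : x = v - (v - x) by rewrite opprB addrC subrK.
    apply: le_lt_trans (ler_normB _ _) _.
    apply: lt_trans (truncnS_gt (`|v| + 1)); lra.
  apply: measureU2; first exact: measurableI.
  by apply: measurableI => //; apply: measurableI => //; exact: measurable_ball_rV.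
apply: leeD.
  apply: le_trans (nu_ge _ _ _ _ _) _ => //; first exact: ltW.
  - exact: measurableI.
  - by move=> x [].
  - by apply: le_measure; rewrite ?inE//; solve [exact: measurableI|exact: measurableD|exact: setSI|exact: subDsetl|exact: subIsetl].
apply: (@le_trans _ _ ((ratr p)%:E * (e / 2 / ratr p * r ^+ n)%:E)%E).
  apply: lee_wpmul2l; first by rewrite lee_fin ltW.
  by apply: hd2; rewrite r0.
by rewrite -EFinM lee_fin mulrA (mulrC (ratr p)) divfK// gt_eqF.
Qed.

End vitali.

(** * Charts are almost affine *)

Section linear_algebra.
Context {R : realType}.

(** One row at a time: the first row loses its projection on the span of the others and is
    normalised; were the remainder b zero, A would kill a nonzero vector. As Q preserves norms, |u
    A| = |u T|, which replaces the rectangular derivative by a square matrix. *)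
Lemma gram_schmidt m d (A : 'M[R]_(m, d)) :
  (forall u : 'rV[R]_m, u *m A = 0 -> u = 0) ->
  exists T Q, [/\ T \in unitmx, Q *m Q^T = 1%:M & A = T *m Q :> 'M[R]_(m, d)].
Proof.
elim: m A => [|m IH] A injA.
  exists 1%:M, A; split; [exact: unitmx1|by apply/matrixP => -[]|by rewrite mul1mx].
rewrite -[m.+1]/(1 + m)%N in A injA *.
rewrite -(vsubmxK A) in injA *.
set a := usubmx A in injA *; set B := dsubmx A in injA *.
have [|T' [Q' [uT' QQ' BE]]] := IH B.
  move=> u uB; have := injA (row_mx 0 u); rewrite mul_row_col mul0mx uB addr0.
  move=> /(_ erefl) /(congr1 (@rsubmx _ 1 1 m)).
  by rewrite row_mxKr linear0.
pose b := a - a *m Q'^T *m Q'.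
have b0 : enorm b != 0.
  apply/eqP => /enorm_eq0 bE.
  have := injA (row_mx 1%:M (- (a *m Q'^T *m invmx T'))).
  rewrite mul_row_col mul1mx mulNmx {1}BE mulmxA mulmxKV//.
  rewrite -/b bE => /(_ erefl) /(congr1 (@lsubmx _ 1 1 m)).
  rewrite row_mxKl linear0 => /matrixP /(_ 0 0); rewrite !mxE eqxx => /eqP.
  by rewrite oner_eq0.
pose q := (enorm b)^-1 *: b.
have bQ : b *m Q'^T = 0 by rewrite mulmxBl -!mulmxA QQ' mulmx1 subrr.
have qQ : q *m Q'^T = 0 by rewrite -scalemxAl bQ scaler0.
have qq : q *m q^T = 1%:M.
  rewrite -enorm_sqrE enormZ ger0_norm ?invr_ge0 ?enorm_ge0// mulVf//.
  by rewrite expr1n.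
exists (block_mx (enorm b)%:M (a *m Q'^T) 0 T'), (col_mx q Q'); split.
- rewrite unitmxE det_ublock unitrM det_scalar expr1 unitfE b0/=.
  by rewrite -unitmxE.
- rewrite tr_col_mx mul_col_row qq qQ QQ' (_ : Q' *m q^T = 0) -?scalar_mx_block//.
  by rewrite -[RHS]trmx0 -qQ trmx_mul trmxK.
- rewrite mul_block_col mul0mx add0r BE mul_scalar_mx scalerA mulfV// scale1r.
  by rewrite subrK.
Qed.

Lemma enorm_mulmx_bound m d (A : 'M[R]_(m, d)) :
  exists2 K, 0 < K & forall u, enorm (u *m A) <= K * `|u|.
Proof.
pose S := \sum_i \sum_j `|A i j|.
have S0 : 0 <= S by apply: sumr_ge0 => i _; apply: sumr_ge0.
exists (d%:R * S + 1); first by rewrite ltr_wpDl ?mulr_ge0.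
move=> u; apply: le_trans (enorm_le_norm _) _.
apply: (@le_trans _ _ (d%:R * (S * `|u|))); last first.
  by rewrite mulrA ler_wpM2r// lerDl.
rewrite ler_wpM2l//; apply/norm_rV_leP => [|j]; first exact: mulr_ge0.
rewrite mxE mulr_suml; apply: le_trans (ler_norm_sum _ _ _) _.
apply: ler_sum => i _; rewrite normrM mulrC ler_pM// ?coord_le_norm//.
by rewrite (bigD1 j)//= lerDl sumr_ge0.
Qed.

Lemma enorm_unitmx_bound m (T : 'M[R]_m) : T \in unitmx ->
  exists2 K, 0 < K & forall u, `|u| <= K * enorm (u *m T).
Proof.
move=> uT; have [K K0 h] := enorm_mulmx_bound (invmx T).
exists K => // u; rewrite -[in leLHS](mulmxK uT u).
apply: le_trans (norm_le_enorm _) _; apply: le_trans (h _) _.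
by rewrite ler_wpM2l ?norm_le_enorm// ltW.
Qed.

End linear_algebra.

(** * Strict differentiability of C^1 maps *)

Section strict_differentiability.
Context {R : realType} {n p : nat}.

Lemma is_derive_coord (g : 'rV[R]_n -> 'rV[R]_p) (z e : 'rV[R]_n) (j : 'I_p) (t : R) :
  derivable g (z + t *: e) e ->
  is_derive t 1 (fun s : R => g (z + s *: e) 0 j) ('D_e g (z + t *: e) 0 j).
Proof.
move=> dg; have h : (fun h : R => h^-1 *: ((fun s : R => g (z + s *: e) 0 j) (h *: 1 + t)
    - g (z + t *: e) 0 j)) @ 0^' --> ('D_e g (z + t *: e) 0 j : R).
  have -> : (fun h : R => h^-1 *: ((fun s : R => g (z + s *: e) 0 j) (h *: 1 + t)
    - g (z + t *: e) 0 j)) = (fun M : 'rV[R]_p => M 0 j) \o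
      (fun h : R => h^-1 *: (g (h *: e + (z + t *: e)) - g (z + t *: e))).
    apply/funext => h /=; rewrite !mxE; congr (_ * (g _ _ _ - _)).
    by rewrite [h *: 1]mulr1 scalerDl addrCA.
  apply: continuous_cvg; first exact: coord_continuous.
  exact: dg.
by split; [exact: (cvgP _ h)|exact: (cvg_lim _ h)].
Qed.

(** Mean value theorem for one coordinate of g on a segment. The two conditions on t say that it
    lies between 0 and h; negative h is reduced to positive h by starting from the other end. *)
Lemma partial_increment (g : 'rV[R]_n -> 'rV[R]_p) (z e : 'rV[R]_n) (j : 'I_p)
    (l k h : R) :
  (forall t, `|t| <= `|h| -> 0 <= t * h -> derivable g (z + t *: e) e) ->
  (forall t, `|t| <= `|h| -> 0 <= t * h -> `|'D_e g (z + t *: e) 0 j - l| <= k) ->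
  `|g (z + h *: e) 0 j - g z 0 j - h * l| <= k * `|h|.
Proof.
wlog h0 : z h / 0 < h => [wlg|].
  have [h0|h0|->] := ltgtP h 0; last first.
  - by move=> _ _; rewrite scale0r addr0 subrr mul0r subrr normr0 mulr0.
  - exact: wlg.
  have range t : `|t| <= `|h| -> 0 <= t * - h -> `|h + t| <= `|h| /\ 0 <= (h + t) * h.
    rewrite pmulr_lge0 ?oppr_gt0// (ltr0_norm h0) => + t0.
    rewrite (ger0_norm t0) => th; have ht : h + t <= 0 by lra.
    rewrite (ler0_norm ht); split; first lra.
    by apply: mulr_le0 => //; exact: ltW.
  move=> dg Dg; have := wlg (z + h *: e) (- h).
  have E t : z + h *: e + t *: e = z + (h + t) *: e by rewrite scalerDl addrA.
  rewrite E subrr scale0r addr0 [`|- h|]normrN.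
  have -> : g z 0 j - g (z + h *: e) 0 j - - h * l =
    - (g (z + h *: e) 0 j - g z 0 j - h * l) by ring.
  rewrite normrN; apply; first lra.
  - move=> t th tp; rewrite E; apply: dg; have [] := range t th tp => //.
  - by move=> t th tp; rewrite E; apply: Dg; have [] := range t th tp.
move=> dg Dg; pose F (t : R) := g (z + t *: e) 0 j.
have dF t : 0 <= t <= h -> is_derive t 1 F ('D_e g (z + t *: e) 0 j).
  move=> /andP[t0 th]; apply: is_derive_coord; apply: dg.
    by rewrite !ger0_norm// ltW.
  by rewrite mulr_ge0// ltW.
have [| |c] := @MVT R F (fun t => 'D_e g (z + t *: e) 0 j) 0 h h0.
- move=> t; rewrite in_itv/= => /andP[t0 th]; apply: dF.
  by rewrite !ltW.
- apply: derivable_within_continuous => t; rewrite in_itv/= => t0h.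
  by have [] := dF _ t0h.
rewrite in_itv/= => /andP[c0 ch]; rewrite /F scale0r addr0 subr0 => ->.
rewrite (mulrC h) -mulrBl normrM ler_wpM2r// Dg// ?mulr_ge0 ?(ltW c0) ?(ltW h0)//.
by rewrite !ger0_norm ?ltW.
Qed.

(** One goes from w to u by changing one coordinate at a time, each change being controlled by a
    partial derivative continuous at v. Both points are free near v: differentiability at v alone
    would not compare distances between two nearby points. *)
Lemma strict_differentiable (W : set 'rV[R]_n) (g : 'rV[R]_n -> 'rV[R]_p)
    (v : 'rV[R]_n) : open W -> W v -> Ck 1 W g ->
  exists A : 'M[R]_(n, p), forall e, 0 < e -> exists2 d, 0 < d &
    forall u w, ball v d u -> ball v d w ->
      enorm (g u - g w - (u - w) *m A) <= e * `|u - w|.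
Proof.
move=> oW Wv [_ Cg].
pose A : 'M[R]_(n, p) := \matrix_(i, j) 'D_(delta_mx 0 i) g v 0 j.
(* There are n coordinate steps, and [enorm] is at most p times the sup norm; the successors keep
   the denominator nonzero. *)
exists A => e e0; pose k := e / (p.+1%:R * n.+1%:R).
have k0 : 0 < k by rewrite divr_gt0// mulr_gt0.
have [d d0 hd] : exists2 d, 0 < d & forall x, ball v d x -> W x /\
    forall i j, `|'D_(delta_mx 0 i) g x 0 j - 'D_(delta_mx 0 i) g v 0 j| <= k.
  have : \forall x \near v, W x /\ forall i : 'I_n, 
      `|'D_(delta_mx 0 i) g v - 'D_(delta_mx 0 i) g x| < k.
    apply: filterI; first exact: open_nbhs_nbhs.
    apply: (@filter_forall _ _ (fun (i : 'I_n) (x : 'rV[R]_n) =>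
      `|'D_(delta_mx 0 i) g v - 'D_(delta_mx 0 i) g x| < k) (nbhs v)) => i; have [_ [/(_ v Wv) c _]] := Cg i.
    by move/cvgrPdist_lt : c => /(_ _ k0).
  move=> /nbhs_ballP[d/= d0 hd]; exists d => // x /hd[Wx hx]; split=> // i j.
  rewrite distrC; apply: le_trans (ltW (hx i)).
  by have := coord_le_norm ('D_(delta_mx 0 i) g v - 'D_(delta_mx 0 i) g x) j; rewrite !mxE.
exists d => // u w /(ball_rVP _ _ d0) bu /(ball_rVP _ _ d0) bw.
(* [z i] takes its first i coordinates from u and the others from w. It stays in the sup-norm ball,
   which is a box. *)
pose z (i : nat) : 'rV[R]_n := \row_(l < n) if (l < i)%N then u 0 l else w 0 l.
have z0 : z 0%N = w by apply/rowP => l; rewrite mxE.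
have zn : z n = u by apply/rowP => l; rewrite mxE ltn_ord.
have zS (i : 'I_n) : z i.+1 = z i + (u 0 i - w 0 i) *: delta_mx 0 i.
  apply/rowP => l; rewrite !mxE eqxx /= ltnS leq_eqVlt.
  have [->|li] := eqVneq l i.
    by rewrite eqxx ltnn /= mulr1 addrC subrK.
  rewrite mulr0 addr0; case: ifP => [/orP[/eqP/val_inj/eqP|->//]|/norP[_ /negbTE ->]//].
  by rewrite (negbTE li).
have step (i : 'I_n) j :
    `|g (z i.+1) 0 j - g (z i) 0 j - (u 0 i - w 0 i) * A i j| <= k * `|u 0 i - w 0 i|.
  have zb t : `|t| <= `|u 0 i - w 0 i| -> 0 <= t * (u 0 i - w 0 i) ->
      ball v d (z i + t *: delta_mx 0 i).
    move=> t1 t2; apply/ball_rVP => // l; rewrite !mxE eqxx /=.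
    have [->|li] := eqVneq l i; last first.
      by rewrite mulr0 addr0; case: ifP => _; [exact: bu|exact: bw].
    rewrite ltnn mulr1; have := bu i; have := bw i.
    move: t1 t2; rewrite !ltr_norml.
    have [t0|t0] := leP 0 t; have [h0|h0] := leP 0 (u 0 i - w 0 i);
      rewrite ?(ger0_norm t0) ?(ltr0_norm t0) ?(ger0_norm h0) ?(ltr0_norm h0).
    - move=> *; apply/andP; split; lra.
    - move=> t1 t2; have -> : t = 0 by nra.
      move=> *; apply/andP; split; lra.
    - move=> t1 t2; have := nmulr_rge0 (u 0 i - w 0 i) t0; rewrite t2 => /esym h1.
      have -> : t = 0 by lra.
      move=> *; apply/andP; split; lra.
    - move=> *; apply/andP; split; lra.
  rewrite zS [A i j]mxE; apply: partial_increment => t t1 t2.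
    by have [/(_ (z i + t *: delta_mx 0 i)) + _] := Cg i; apply; exact: (hd _ (zb _ t1 t2)).1.
  exact: (hd _ (zb _ t1 t2)).2.
apply: le_trans (enorm_le_norm _) _.
apply: (@le_trans _ _ (p%:R * (n%:R * k * `|u - w|))); last first.
  have -> : e = p.+1%:R * n.+1%:R * k by rewrite mulrC divfK// gt_eqF// mulr_gt0.
  rewrite [leLHS]mulrA; apply: ler_wpM2r => //; rewrite (mulrA p%:R n%:R k).
  apply: ler_wpM2r; first exact: ltW.
  by rewrite -!natrM ler_nat leq_mul.
rewrite ler_wpM2l//; apply/norm_rV_leP => [|j]; first by rewrite !mulr_ge0// ltW.
have -> : (g u - g w - (u - w) *m A) 0 j =
    \sum_(i < n) (g (z i.+1) 0 j - g (z i) 0 j - (u 0 i - w 0 i) * A i j).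
  rewrite sumrB !mxE -(big_mkord xpredT (fun i => g (z i.+1) 0 j - g (z i) 0 j)).
  rewrite telescope_sumr// z0 zn; congr (_ - _).
  by apply: eq_bigr => i _; rewrite !mxE.
apply: le_trans (ler_norm_sum _ _ _) _.
apply: (@le_trans _ _ (\sum_(i < n) k * `|u - w|)).
  apply: ler_sum => i _; apply: le_trans (step i j) _; rewrite ler_wpM2l ?(ltW k0)//.
  by have := coord_le_norm (u - w) i; rewrite !mxE.
by rewrite sumr_const card_ord -[leLHS]mulr_natl mulrA.
Qed.

Lemma locally_lipschitz (W : set 'rV[R]_n) (g : 'rV[R]_n -> 'rV[R]_p)
    (v : 'rV[R]_n) : open W -> W v -> Ck 1 W g ->
  exists2 L, 0 < L & exists2 d, 0 < d &
    forall u w, ball v d u -> ball v d w -> enorm (g u - g w) <= L * `|u - w|.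
Proof.
move=> oW Wv Cg; have [A /(_ 1 ltr01)[d d0 hd]] := strict_differentiable oW Wv Cg.
have [K K0 hK] := enorm_mulmx_bound A.
exists (1 + K); first by rewrite addr_gt0.
exists d => // u w bu bw; rewrite -(subrK ((u - w) *m A) (g u - g w)) mulrDl.
by apply: le_trans (enormD _ _) _; apply: lerD => //; exact: hd.
Qed.

End strict_differentiability.

Section chart_geometry.
Context {R : realType} {d m : nat}.

Lemma CkS n p k (W : set 'rV[R]_n) (f : 'rV[R]_n -> 'rV[R]_p) :
  Ck k W f -> forall x, W x -> {for x, continuous f}.
Proof. by case: k => [|k] []. Qed.

(* psi, being locally Lipschitz, bounds |(u - w) A| from below by |u - w|, so
   that A is injective and A = T Q with T invertible and Q an isometry. *)
Lemma chart_almost_isometry (U : set 'rV[R]_d) psi (phi : 'rV[R]_m -> 'rV[R]_d) x :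
  open (psi @` U) -> smooth_on U psi ->
  (forall y, U y -> phi (psi y) = y) -> smooth_on (psi @` U) phi ->
  U x ->
  exists2 T : 'M[R]_m, T \in unitmx & forall e, 0 < e -> exists2 r, 0 < r &
    ball (psi x) r `<=` psi @` U /\
    forall u w, ball (psi x) r u -> ball (psi x) r w ->
      `|enorm (phi u - phi w) - enorm ((u - w) *m T)| <= e * enorm ((u - w) *m T).
Proof.
move=> oV spsi psiK sphi Ux; set v := psi x; set V := psi @` U.
have Vv : V v by exists x.
have phiK u : V u -> psi (phi u) = u by move=> [y Uy <-]; rewrite psiK.
have Vphi u : V u -> U (phi u) by move=> [y Uy <-]; rewrite psiK.
have [W [g [oW Wv Cg gE]]] := sphi v Vv.
have [W' [g' [oW' Wx Cg' gE']]] := spsi x Ux.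
have [A hA] := strict_differentiable oW Wv (Cg 1%N).
have [L L0 [d1 d10 hL]] := locally_lipschitz oW' Wx (Cg' 1%N).
have [d2 d20 hd2] : exists2 d2, 0 < d2 & forall u, ball v d2 u ->
    [/\ V u, W u, W' (g u) & ball x d1 (g u)].
  have cg := CkS (Cg 0%N) Wv.
  have gv : g v = x by rewrite gE// /v psiK.
  have : \forall u \near v, [/\ V u, W u, W' (g u) & ball x d1 (g u)].
    near=> u; split; near: u.
    - exact: open_nbhs_nbhs.
    - exact: open_nbhs_nbhs.
    - by apply: cg; rewrite gv; exact: open_nbhs_nbhs.
    - by apply: cg; rewrite gv; exact: nbhsx_ballx.
  by move=> /nbhs_ballP[r/= r0 hr]; exists r.
have phig u : ball v d2 u -> phi u = g u by move=> /hd2[Vu Wu _ _]; rewrite gE.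
have lip u w : ball v d2 u -> ball v d2 w -> `|u - w| <= L * enorm (g u - g w).
  move=> bu bw; have [Vu Wu W'u xu] := hd2 _ bu; have [Vw Ww W'w xw] := hd2 _ bw.
  have E t : ball v d2 t -> g' (g t) = t.
    by move=> bt; have [Vt Wt W't _] := hd2 _ bt; rewrite -(phig _ bt) in W't *; rewrite gE' ?phiK//; exact: Vphi.
  rewrite -{1}(E u)// -{1}(E w)//.
  apply: le_trans (norm_le_enorm _) _; apply: le_trans (hL _ _ xu xw) _.
  by rewrite ler_wpM2l ?(ltW L0)// norm_le_enorm.
have L20 : 0 < (2 * L)^-1 by rewrite invr_gt0 mulr_gt0.
have lowA u : `|u| <= 2 * L * enorm (u *m A).
  have [d3 d30 hd3] := hA _ L20.
  have [->|u0] := eqVneq u 0; first by rewrite normr0 mul0mx enorm0 mulr0.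
  have nu0 : 0 < `|u| by rewrite normr_gt0.
  (* Scaling puts v + t u where both the Lipschitz bound and the differential estimate hold; t then
     cancels by homogeneity. The error (2 L)^-1 costs half of |t u|. *)
  pose t := Num.min d2 d3 / (2 * `|u|).
  have md : 0 < Num.min d2 d3 by rewrite lt_min d20.
  have t0 : 0 < t by rewrite divr_gt0// mulr_gt0.
  have tu : t * `|u| = Num.min d2 d3 / 2 by rewrite /t invfM mulrA divfK ?gt_eqF.
  have b r : Num.min d2 d3 <= r -> ball v r (v + t *: u).
    move=> mr; rewrite -ball_normE /= opprD addrA subrr sub0r normrN normrZ (gtr0_norm t0) tu.
    lra.
  have b0 r : Num.min d2 d3 <= r -> ball v r v by move=> mr; apply: ballxx; lra.
  have m2 : Num.min d2 d3 <= d2 by rewrite ge_min lexx.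
  have m3 : Num.min d2 d3 <= d3 by rewrite ge_min lexx orbT.
  have h1 := lip _ _ (b _ m2) (b0 _ m2).
  have h2 := hd3 _ _ (b _ m3) (b0 _ m3).
  move: h1 h2; rewrite (addrC v) addrK -scalemxAl.
  set y := g _ - g v => h1 h2.
  have h3 : enorm y <= enorm (t *: (u *m A)) + (2 * L)^-1 * `|t *: u|.
    rewrite -{1}(subrK (t *: (u *m A)) y) addrC; apply: le_trans (enormD _ _) _.
    by rewrite lerD2l.
  have h4 : `|t *: u| <= L * (enorm (t *: (u *m A)) + (2 * L)^-1 * `|t *: u|).
    by apply: le_trans h1 _; rewrite ler_wpM2l// ltW.
  move: h4; rewrite mulrDr mulrA (_ : L / (2 * L) = 2^-1); last by field; rewrite gt_eqF.
  rewrite normrZ enormZ (gtr0_norm t0) => h4.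
  rewrite -(ler_pM2l t0); move: h4; lra.
have [|T [Q [uT QQ AE]]] := @gram_schmidt R m d A.
  by move=> u uA0; apply/eqP; rewrite -normr_le0; apply: le_trans (lowA u) _; rewrite uA0 enorm0 mulr0.
exists T => // e e0.
have AT u : enorm (u *m A) = enorm (u *m T) by rewrite AE mulmxA enorm_isometry.
(* With error e / (2 L), the lower bound on |(u - w) A| makes the error relative to that norm. *)
have eL0 : 0 < e / (2 * L) by rewrite divr_gt0// mulr_gt0.
have [d3 d30 hd3] := hA _ eL0.
exists (Num.min d2 d3); first by rewrite lt_min d20.
have m2 : Num.min d2 d3 <= d2 by rewrite ge_min lexx.
have m3 : Num.min d2 d3 <= d3 by rewrite ge_min lexx orbT.
split=> [u /(le_ball m2) /hd2[]//|u w bu bw].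
have bu2 := le_ball m2 bu; have bw2 := le_ball m2 bw.
rewrite !phig// -AT.
have h := hd3 _ _ (le_ball m3 bu) (le_ball m3 bw).
have h' : e / (2 * L) * `|u - w| <= e * enorm ((u - w) *m A).
  rewrite -mulrA ler_wpM2l ?(ltW e0)// ler_pdivrMl ?mulr_gt0//.
set y := g u - g w in h *; set z := _ *m A in h h' *.
have h1 : enorm y <= enorm z + enorm (y - z).
  by rewrite -{1}(subrK z y) addrC; exact: enormD.
have h2 : enorm z <= enorm y + enorm (y - z).
  by have := enormD y (- (y - z)); rewrite subKr enormN.
rewrite ler_norml; apply/andP; split; lra.
Unshelve. all: by end_near. Qed.

End chart_geometry.

(** * Local volume on the manifold *)

Section local_limit.
Context {R : realType} {d m : nat}.

Lemma smooth_onS n p (S S' : set 'rV[R]_n) (f : 'rV[R]_n -> 'rV[R]_p) :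
  S' `<=` S -> smooth_on S f -> smooth_on S' f.
Proof.
move=> SS sf x /SS /sf [W [g [oW Wx Cg gE]]]; exists W, g; split=> // y Wy /SS.
exact: gE.
Qed.

Lemma smooth_on_near n p (S : set 'rV[R]_n) (f : 'rV[R]_n -> 'rV[R]_p) x
    (O : set 'rV[R]_p) : smooth_on S f -> S x -> open O -> O (f x) ->
  \forall y \near x, S y -> O (f y).
Proof.
move=> sf Sx oO Of; have [W [g [oW Wx Cg gE]]] := sf x Sx.
have cg := CkS (Cg 0%N) Wx.
have gO : \forall y \near x, O (g y).
  by apply: cg; rewrite gE//; exact: open_nbhs_nbhs.
have nW : \forall y \near x, W y by exact: open_nbhs_nbhs.
by near=> y => Sy; rewrite -gE//; [near: y|near: y].
Unshelve. all: by end_near. Qed.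

Lemma smooth_on_open_preimage n p (S : set 'rV[R]_n) (f : 'rV[R]_n -> 'rV[R]_p)
    (O : set 'rV[R]_p) : open S -> smooth_on S f -> open O ->
  open [set x | S x /\ O (f x)].
Proof.
move=> oS sf oO; rewrite openE => x [Sx Ox].
have := smooth_on_near sf Sx oO Ox.
have : \forall y \near x, S y by exact: open_nbhs_nbhs.
by apply: filterS2 => y Sy /(_ Sy).
Qed.

Lemma smooth_on_measurable n p (S : set 'rV[R]_n) (f : 'rV[R]_n -> 'rV[R]_p) :
  measurable S -> smooth_on S f -> measurable_fun S f.
Proof.
move=> mS sf; apply: measurable_fun_open => O oO.
pose G := \bigcup_(W in [set W : set 'rV[R]_n | open W /\ forall y, W y -> S y -> O (f y)]) W.
rewrite (_ : S `&` f @^-1` O = S `&` G).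
  by apply: measurableI => //; apply: open_measurable_rV; apply: bigcup_open => W [].
apply/seteqP; split=> x [Sx].
  move=> Ofx; split=> //.
  have /nbhs_ballP[r/= r0 hr] : nbhs x (fun y => S y -> O (f y)).
    exact: smooth_on_near.
  by exists (ball x r); [split=> //; exact: ball_open|exact: ballxx].
by move=> [W [_ hW] Wx]; split=> //; exact: hW.
Qed.

(** M is not yet known to be Borel. With g the ambient extension of psi, the shrunk domain is the
    set of y in the open set [O2] with phi (g y) = y, that is [O2] minus the open subset [O3] where
    these differ. Measurability of M will follow by countable covering. *)
Lemma measurable_chart (M : set 'rV[R]_d) (hM : smooth_submanifold m M) x : M x ->
  exists U W (psi : 'rV[R]_d -> 'rV[R]_m),
    [/\ chart M U psi, U x, open W, U = M `&` W & measurable U].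
Proof.
move=> /hM[U0 [psi [[[W0 oW0 U0E] oV spsi [phi [psiK sphi]]] U0x]]].
have [W' [g [oW' W'x Cg gE]]] := spsi x U0x.
set V := psi @` U0 in oV sphi.
pose U := U0 `&` W'.
have UE : U = M `&` (W0 `&` W') by rewrite /U U0E setIA.
have subU : U `<=` U0 by exact: subIsetl.
have oWW : open (W0 `&` W') by exact: openI.
have cg y : W' y -> {for y, continuous g} by move=> W'y; exact: (CkS (Cg 0%N) W'y).
pose O2 := [set y | (W0 `&` W') y /\ V (g y)].
have oO2 : open O2.
  rewrite openE => y [Wy Vy].
  have : \forall z \near y, (W0 `&` W') z by exact: open_nbhs_nbhs.
  have : \forall z \near y, V (g z).
    by apply: (cg y Wy.2); exact: open_nbhs_nbhs.
  by apply: filterS2 => z Vz Wz.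
pose O3 := [set y | O2 y /\ phi (g y) - y != 0].
have oO3 : open O3.
  rewrite openE => y [yO2 nz].
  have e0 : 0 < `|phi (g y) - y| by rewrite normr_gt0.
  have e2 : 0 < `|phi (g y) - y| / 2 by rewrite divr_gt0.
  have h1 : \forall z \near y, O2 z by exact: open_nbhs_nbhs.
  have h2 : \forall z \near y, V (g z) -> ball (phi (g y)) (`|phi (g y) - y| / 2) (phi (g z)).
    have : nbhs (g y) (fun w => V w -> ball (phi (g y)) (`|phi (g y) - y| / 2) (phi w)).
      by apply: (smooth_on_near sphi yO2.2); [exact: ball_open|exact: ballxx].
    by move=> /(cg y yO2.1.2).
  have h3 : \forall z \near y, ball y (`|phi (g y) - y| / 2) z by exact: nbhsx_ballx.
  near=> z; have O2z : O2 z by near: z.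
  split=> //; apply/eqP => /subr0_eq E.
  have /(_ O2z.2) : V (g z) -> ball (phi (g y)) (`|phi (g y) - y| / 2) (phi (g z)) by near: z.
  have : ball y (`|phi (g y) - y| / 2) z by near: z.
  rewrite E -!ball_normE /= => b1 b2.
  have := ler_normD (phi (g y) - z) (z - y); rewrite addrA subrK (distrC z); lra.
have UO : U = O2 `\` O3.
  apply/seteqP; split=> y.
    move=> [U0y W'y]; have gy : g y = psi y by rewrite gE.
    have O2y : O2 y.
      by split; [split=> //; move: U0y; rewrite U0E => -[]|rewrite gy; exists y].
    by split=> // -[_]; rewrite gy psiK// subrr eqxx.
  move=> [yO2 nO3]; have E : phi (g y) = y.
    by apply/eqP; rewrite -subr_eq0; apply/negPn/negP => h; apply: nO3.
  split; last exact: yO2.1.2.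
  by have [z U0z gz] := yO2.2; rewrite -E -gz psiK.
have mU : measurable U.
  by rewrite UO; apply: measurableD; exact: open_measurable_rV.
have imU : psi @` U = [set w | V w /\ W' (phi w)].
  apply/seteqP; split=> w.
    by move=> [y [U0y W'y] <-]; split; [exists y|rewrite psiK].
  by move=> [[y U0y <-]]; rewrite psiK// => W'y; exists y.
exists U, (W0 `&` W'), psi; split=> //; split.
- by exists (W0 `&` W').
- by rewrite imU; exact: smooth_on_open_preimage.
- exact: smooth_onS spsi.
- exists phi; split; first by move=> y /subU; exact: psiK.
  by apply: smooth_onS sphi; exact: image_subset.
Unshelve. all: by end_near. Qed.

Definition eball n (x : 'rV[R]_n) r : set 'rV[R]_n := [set y | enorm (y - x) < r].
Definition ceball n (x : 'rV[R]_n) r : set 'rV[R]_n := [set y | enorm (y - x) <= r].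

(** Meant for r = |y - x| and rho the distance of the images in the chart, measured through T: rho
    then lies between the radii of the inner and outer ellipsoids. *)
Lemma sandwich_radii (t r rho : R) : 0 < t < 2^-1 -> 0 < r ->
  (1 - t) * rho <= r <= (1 + t) * rho ->
  [/\ 0 < rho, 0 < (1 - t) * r, (1 - t) * r <= rho & rho <= (1 + 2 * t) * r].
Proof.
move=> /andP[t0 t2] r0 /andP[h1 h2].
have rho0 : 0 < rho by have : 0 < (1 + t) * rho; [lra|rewrite pmulr_rgt0//; lra].
split=> //; first by rewrite mulr_gt0//; lra.
  have : (1 - t) * r <= (1 - t) * ((1 + t) * rho) by rewrite ler_pM2l//; lra.
  have : 0 <= t * t * rho by rewrite !mulr_ge0// ltW.
  lra.
have : (1 + 2 * t) * ((1 - t) * rho) <= (1 + 2 * t) * r by rewrite ler_pM2l//; lra.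
have : 0 <= t * (1 - 2 * t) * rho by rewrite !mulr_ge0//; lra.
lra.
Qed.

(** Algebra of the two-ball estimate, with p = (1 + 2 t) ^ m, q = (1 - t) ^ m, g = rho ^ m, k = r ^
    m and V2 the volume of the union of two unit balls. The volume is exact at radius rho; shells
    account for the passage to the radii (1 - t) r and (1 + 2 t) r. *)
Lemma sandwich_error (c C V V2 p q g k e : R) :
  c * C * (V2 * p + 2 * (V * (p - q))) <= c * C * V2 + e / 2 ->
  c * C * V2 - e / 2 <= c * C * (V2 * q - 2 * (V * (p - q))) ->
  0 < c -> 0 < C -> 0 < V -> 0 < V2 -> 0 < k -> q * k <= g -> g <= p * k ->
  (c * C * V2 - e) * k <=
    c * (C * V2 * g - 2 * (C * V * (g - q * k))) - e / 2 * k /\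
  c * (C * V2 * g + 2 * (C * V * (p * k - g))) + e / 2 * k <= (c * C * V2 + e) * k.
Proof.
move=> A1 A2 c0 C0 V0 V20 k0 qg gp.
have B1 := ler_wpM2r (ltW k0) A1; have B2 := ler_wpM2r (ltW k0) A2.
have cCV : 0 < c * C * V by rewrite !mulr_gt0.
have cCV2 : 0 < c * C * V2 by rewrite !mulr_gt0.
have I1 : 0 <= c * C * V * (p * k - g) by rewrite mulr_ge0 ?(ltW cCV)// subr_ge0.
have I2 : 0 <= c * C * V * (g - q * k) by rewrite mulr_ge0 ?(ltW cCV)// subr_ge0.
have I3 : 0 <= c * C * V2 * (p * k - g) by rewrite mulr_ge0 ?(ltW cCV2)// subr_ge0.
have I4 : 0 <= c * C * V2 * (g - q * k) by rewrite mulr_ge0 ?(ltW cCV2)// subr_ge0.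
move: B1 B2 I1 I2 I3 I4; clear; split; lra.
Qed.

Section at_point.
Variables (M U W : set 'rV[R]_d) (psi : 'rV[R]_d -> 'rV[R]_m).
Hypotheses (oW : open W) (UE : U = M `&` W) (cU : chart M U psi) (mU : measurable U).
Variable mu : {finite_measure set 'rV[R]_d -> \bar R}.
Hypothesis muM : forall A, measurable A -> A `<=` ~` M -> mu A = 0%E.
Variable nu : {finite_measure set 'rV[R]_m -> \bar R}.
Hypothesis nuE : forall A, measurable A -> nu A = mu (psi @^-1` A `&` U).
Variable x : 'rV[R]_d.
Hypothesis Ux : U x.

Let mpsi A : measurable A -> measurable (psi @^-1` A `&` U).
Proof.
move=> mA; have [_ _ spsi _] := cU; rewrite setIC.
exact: (smooth_on_measurable mU spsi).
Qed.

(** The inverse chart is nearly isometric for the norm |u T|, so Euclidean balls of R^d are caught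
    between ellipsoids of radii (1 - e) r and (1 + 2 e) r. The part of S outside the chart domain
    lies off M and has no mass. The condition |y - x| <= r admits y = x, which gives the single
    ball. *)
Lemma chart_sandwich : exists2 T : 'M[R]_m, T \in unitmx &
  exists2 K, 0 < K & forall e, 0 < e < 2^-1 -> exists2 r0, 0 < r0 &
  forall r y S, 0 < r < r0 -> M y -> enorm (y - x) <= r -> measurable S ->
    eball x r `|` eball y r `<=` S -> S `<=` ceball x r `|` ceball y r ->
  let D s := lball T (psi x) s `|` lball T (psi y) s in
  let rho := enorm ((psi y - psi x) *m T) in
  [/\ (nu (D ((1 - e) * r)%R) <= mu S)%E, (mu S <= nu (D ((1 + 2 * e) * r)%R))%E,
      D ((1 + 2 * e) * r) `<=` ball (psi x) (K * r) &
      (1 - e) * rho <= enorm (y - x) <= (1 + e) * rho].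
Proof.
have [_ oV spsi [phi [psiK sphi]]] := cU.
have [T uT hT] := chart_almost_isometry oV spsi psiK sphi Ux.
have [K K0 hK] := enorm_unitmx_bound uT.
(* The ellipsoids have radius at most 2 r and rho <= 2 r, so they stay within 4 K r of psi x; the
   factor 5 makes room for an open ball. *)
exists T => //; exists (5 * K); first by rewrite mulr_gt0.
move=> e /andP[e0 e2]; have [r1 r10 [r1V iso]] := hT e e0.
have isoP u w : ball (psi x) r1 u -> ball (psi x) r1 w ->
    (1 - e) * enorm ((u - w) *m T) <= enorm (phi u - phi w) <=
    (1 + e) * enorm ((u - w) *m T).
  by move=> bu bw; have := iso _ _ bu bw; rewrite ler_distl => /andP[h1 h2];
    apply/andP; split; lra.
have [r2 r20 hr2] : exists2 r2, 0 < r2 & forall z, enorm (z - x) < r2 ->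
    W z /\ (U z -> ball (psi x) r1 (psi z)).
  have h1 : \forall z \near x, W z.
    by apply: open_nbhs_nbhs; split=> //; move: Ux; rewrite UE => -[].
  have h2 : \forall z \near x, U z -> ball (psi x) r1 (psi z).
    by apply: (smooth_on_near spsi Ux); [exact: ball_open|exact: ballxx].
  have /nbhs_ballP[r/= rp hr] : nbhs x (fun z => W z /\ (U z -> ball (psi x) r1 (psi z))).
    exact: filterI.
  exists r => // z zr; apply: hr; rewrite -ball_normE /= distrC.
  exact: le_lt_trans (norm_le_enorm _) zr.
exists (Num.min (r2 / 2) (r1 / (5 * K))).
  by rewrite lt_min !divr_gt0// mulr_gt0.
move=> r y S /andP[r0]; rewrite lt_min => /andP[rr2 rr1] My yx mS BS SB D rho.
have Kr : 5 * K * r < r1 by rewrite mulrC -ltr_pdivlMr// mulr_gt0.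
have Wy : W y by apply: (hr2 y _).1; apply: le_lt_trans yx _; lra.
have Uy : U y by rewrite UE.
have bx : ball (psi x) r1 (psi x) by exact: ballxx.
have by1 : ball (psi x) r1 (psi y) by apply: (hr2 y _).2 => //; apply: le_lt_trans yx _; lra.
have rhoP : (1 - e) * rho <= enorm (y - x) <= (1 + e) * rho.
  by have := isoP _ _ by1 bx; rewrite !psiK.
have rho2 : rho <= 2 * r.
  have : 0 <= rho by exact: enorm_ge0.
  case/andP : rhoP; nra.
have mD s : measurable (D s) by apply: measurableU; exact: measurable_lball.
have Db s : s <= 2 * r -> D s `<=` ball (psi x) (5 * K * r).
  move=> s2 u Du; rewrite -ball_normE /= distrC.
  apply: (@le_lt_trans _ _ (4 * K * r)); last by rewrite -!mulrA ltr_pM2r ?mulr_gt0//; lra.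
  case: Du; rewrite /lball /= => us.
    apply: le_trans (hK _) _; rewrite -mulrA (mulrCA 4) ler_pM2l//; lra.
  rewrite -(subrK (psi y) u) -addrA; apply: le_trans (ler_normD _ _) _.
  apply: le_trans (lerD (hK _) (hK _)) _; rewrite -mulrDr -mulrA (mulrCA 4) ler_pM2l//.
  by move: rho2; rewrite /rho; lra.
have s1 : (1 - e) * r <= 2 * r by nra.
have s2 : (1 + 2 * e) * r <= 2 * r by nra.
(* Two inequalities fix the radii: (1 + e) (1 - e) <= 1 and, as e < 1 / 2, (1 - e) (1 + 2 e) >=
   1. *)
have small q p : (1 + e) * p >= q -> p < (1 - e) * r -> q < r.
  move=> qp pr; apply: le_lt_trans qp _.
  apply: (@lt_le_trans _ _ ((1 + e) * ((1 - e) * r))); first by rewrite ltr_pM2l//; lra.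
  by nra.
have large p q : (1 - e) * p <= q -> q <= r -> p < (1 + 2 * e) * r.
  move=> pq qr; rewrite ltNge; apply/negP => pr.
  have : (1 - e) * ((1 + 2 * e) * r) <= r.
    by apply: le_trans (le_trans pq qr); rewrite ler_pM2l//; lra.
  have : 0 < e * (1 - 2 * e) * r by rewrite !mulr_gt0//; lra.
  lra.
split=> //; last exact: Db.
  rewrite nuE//; apply: le_measure; rewrite ?inE//; first exact: mpsi.
  move=> z [Dz Uz]; apply: BS.
  have bz : ball (psi x) r1 (psi z) by apply: le_ball (Db _ s1 _ Dz); exact: ltW.
  case: Dz; rewrite /lball /= => zs; [left|right].
    have /andP[_] := isoP _ _ bz bx; rewrite !psiK// => h.
    exact: small h zs.
  have /andP[_] := isoP _ _ bz by1; rewrite !psiK// => h.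
  exact: small h zs.
have Sr z : S z -> enorm (z - x) <= 2 * r.
  move=> /SB[]; rewrite /ceball /= => h; first lra.
  rewrite -(subrK y z) -addrA; apply: le_trans (enormD _ _) _; lra.
have mSU : measurable (S `&` U) by exact: measurableI.
have SU0 : mu (S `\` U) = 0%E.
  apply: muM; first exact: measurableD.
  move=> z [Sz nUz] Mz; apply: nUz; rewrite UE; split=> //.
  by apply: (hr2 z _).1; apply: le_lt_trans (Sr _ Sz) _; lra.
rewrite nuE//; apply: (@le_trans _ _ (mu (S `&` U) + mu (S `\` U))%E).
  rewrite -{1}(setUIDK S U); apply: measureU2 => //; exact: measurableD.
rewrite SU0 adde0; apply: le_measure; rewrite ?inE//; first exact: mpsi.
move=> z [Sz Uz]; split=> //.
have bz : ball (psi x) r1 (psi z).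
  by apply: (hr2 z _).2 => //; apply: le_lt_trans (Sr _ Sz) _; lra.
case: (SB _ Sz); rewrite /ceball /= => zs; [left|right].
  have /andP[h _] := isoP _ _ bz bx; rewrite !psiK// in h.
  exact: large h zs.
have /andP[h _] := isoP _ _ bz by1; rewrite !psiK// in h.
exact: large h zs.
Qed.

Variable c : R.
Hypothesis c0 : 0 < c.
Hypothesis dens : forall e, 0 < e -> exists2 r0, 0 < r0 &
  forall r (D : set 'rV[R]_m), 0 < r < r0 -> measurable D -> D `<=` ball (psi x) r ->
    (nu D <= c%:E * lebesgue_rV D + (e * r ^+ m)%:E)%E /\
    (c%:E * lebesgue_rV D <= nu D + (e * r ^+ m)%:E)%E.

Let V := ball_volume R m.
Let V2 := two_balls_volume R m.

Lemma poly_close (f : R -> R) (e : R) : continuous f -> 0 < e ->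
  exists2 t, 0 < t < 2^-1 & `|f t - f 0| <= e.
Proof.
move=> cf e0; have /cvgrPdist_le /(_ _ e0) := cf 0.
move=> /nbhs_ballP[r/= r0 hr].
have mr : 0 < Num.min r (1/2) by rewrite lt_min r0; lra.
have m1 : Num.min r (1/2) <= r by rewrite ge_min lexx.
have m2 : Num.min r (1/2) <= 1/2 by rewrite ge_min lexx orbT.
exists (Num.min r (1/2) / 2); first by apply/andP; split; lra.
rewrite distrC; apply: hr; rewrite -ball_normE /= sub0r normrN gtr0_norm; lra.
Qed.

(** The common constant a is c C: the density c of the chart measure at psi x, times the ratio C
    between the volume of an ellipsoid and that of the ball of the same radius. *)
Lemma local_measure_limit : (0 < m)%N -> exists2 a, 0 < a &
  (forall e, 0 < e -> exists2 r0, 0 < r0 & forall r S, 0 < r < r0 -> measurable S ->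
    eball x r `<=` S -> S `<=` ceball x r ->
    (((a * V - e) * r ^+ m)%:E <= mu S <= ((a * V + e) * r ^+ m)%:E)%E) /\
  (forall e, 0 < e -> exists2 r0, 0 < r0 & forall y S, M y -> 0 < enorm (y - x) < r0 ->
    measurable S ->
    eball x (enorm (y - x)) `|` eball y (enorm (y - x)) `<=` S ->
    S `<=` ceball x (enorm (y - x)) `|` ceball y (enorm (y - x)) ->
    (((a * V2 - e) * enorm (y - x) ^+ m)%:E <= mu S <=
     ((a * V2 + e) * enorm (y - x) ^+ m)%:E)%E).
Proof.
move=> m0; have [T uT [K K0 sand]] := chart_sandwich.
have [C C0 hC] := lebesgue_rV_linear uT.
exists (c * C); first exact: mulr_gt0.
have Vp : 0 < V by exact: ball_volume_gt0.
have V2p : 0 < V2 by exact: two_balls_volume_gt0.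
have Km : 0 < K ^+ m by exact: exprn_gt0.
(* The errors of the sandwich are polynomials in t vanishing at 0. *)
have approx e : 0 < e -> exists t, [/\ 0 < t < 2^-1,
    c * C * (V * (1 + 2 * t) ^+ m) <= c * C * V + e / 2,
    c * C * V - e / 2 <= c * C * (V * (1 - t) ^+ m),
    c * C * (V2 * (1 + 2 * t) ^+ m + 2 * (V * ((1 + 2 * t) ^+ m - (1 - t) ^+ m))) <= c * C * V2 + e / 2 &
    c * C * V2 - e / 2 <= c * C * (V2 * (1 - t) ^+ m - 2 * (V * ((1 + 2 * t) ^+ m - (1 - t) ^+ m)))].
  move=> e0.
  (* [h] bounds all the deviations, since (1 - t) ^ m <= 1 <= (1 + 2 t) ^ m. *)
  pose h (t : R) := (1 + 2 * t) ^+ m - (1 - t) ^+ m.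
  pose E := e / (4 * (c * C) * (V + V2)).
  have cC : 0 < c * C by exact: mulr_gt0.
  have VV : 0 < V + V2 by exact: addr_gt0.
  have E0 : 0 < E by rewrite divr_gt0// !mulr_gt0.
  have ch : continuous h.
    move=> t; apply: cvgB.
      apply: (@continuous_comp _ _ _ (fun t : R => 1 + 2 * t) (fun s => s ^+ m)); last exact: exprn_continuous.
      by apply: cvgD; [exact: cvg_cst|apply: cvgM; [exact: cvg_cst|exact: cvg_id]].
    apply: (@continuous_comp _ _ _ (fun t : R => 1 - t) (fun s => s ^+ m)); last exact: exprn_continuous.
    by apply: cvgB; [exact: cvg_cst|exact: cvg_id].
  have [t /andP[t0 t2]] := poly_close ch E0.
  rewrite /h mulr0 addr0 subr0 expr1n subrr subr0 => hE.
  have up : 1 <= (1 + 2 * t) ^+ m by rewrite exprn_ege1//; lra.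
  have lo : (1 - t) ^+ m <= 1 by rewrite exprn_ile1//; lra.
  have {}hE : (1 + 2 * t) ^+ m - (1 - t) ^+ m <= E by exact: le_trans (ler_norm _) hE.
  have EE : c * C * (E * (V + V2)) = e / 4.
    by rewrite /E; field; rewrite !gt_eqF.
  set p := (1 + 2 * t) ^+ m in up hE *; set q := (1 - t) ^+ m in lo hE *.
  have E1 : c * C * (E * V) <= e / 4 by rewrite -EE !ler_pM2l//; lra.
  have E2 : c * C * (E * V2) <= e / 4 by rewrite -EE !ler_pM2l//; lra.
  have mono X Y : X <= Y -> c * C * X <= c * C * Y by rewrite ler_pM2l.
  have P1 : c * C * (V * p) <= c * C * (V + E * V).
    by apply: mono; rewrite -{2}(mulr1 V) (mulrC E) -mulrDr ler_pM2l//; lra.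
  have P2 : c * C * (V - E * V) <= c * C * (V * q).
    by apply: mono; rewrite -{1}(mulr1 V) (mulrC E) -mulrBr ler_pM2l//; lra.
  have P3 : c * C * (V2 * p) <= c * C * (V2 + E * V2).
    by apply: mono; rewrite -{2}(mulr1 V2) (mulrC E) -mulrDr ler_pM2l//; lra.
  have P4 : c * C * (V2 - E * V2) <= c * C * (V2 * q).
    by apply: mono; rewrite -{1}(mulr1 V2) (mulrC E) -mulrBr ler_pM2l//; lra.
  have P5 : c * C * (V * (p - q)) <= c * C * (E * V).
    by apply: mono; rewrite mulrC ler_pM2r.
  have EE' : c * C * (E * V) + c * C * (E * V2) = e / 4 by rewrite -EE; ring.
  have n1 : 0 <= c * C * (E * V) by apply: mulr_ge0; [exact: ltW|apply: mulr_ge0; exact: ltW].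
  have n2 : 0 <= c * C * (E * V2) by apply: mulr_ge0; [exact: ltW|apply: mulr_ge0; exact: ltW].
  rewrite mulrDr in P1 *; rewrite mulrBr in P2; rewrite mulrDr in P3; rewrite mulrBr in P4.
  exists t; rewrite -/p -/q; split; [by apply/andP| | | |].
  - lra.
  - lra.
  - rewrite mulrDr; have -> : c * C * (2 * (V * (p - q))) = 2 * (c * C * (V * (p - q))) by ring.
    lra.
  - have -> : c * C * (V2 * q - 2 * (V * (p - q))) = c * C * (V2 * q) - 2 * (c * C * (V * (p - q))) by ring.
    lra.
have core e t : 0 < e -> 0 < t < 2^-1 -> exists2 r0, 0 < r0 &
    forall r y S, 0 < r < r0 -> M y -> enorm (y - x) <= r -> measurable S ->
    eball x r `|` eball y r `<=` S -> S `<=` ceball x r `|` ceball y r ->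
    let D s := lball T (psi x) s `|` lball T (psi y) s in
    let rho := enorm ((psi y - psi x) *m T) in
    [/\ forall b, (b%:E <= lebesgue_rV (D ((1 - t) * r)%R))%E ->
          ((c * b - e / 2 * r ^+ m)%:E <= mu S)%E,
        forall b, (lebesgue_rV (D ((1 + 2 * t) * r)%R) <= b%:E)%E ->
          (mu S <= (c * b + e / 2 * r ^+ m)%:E)%E &
        (1 - t) * rho <= enorm (y - x) <= (1 + t) * rho].
  move=> e0 t0; have [r1 r10 h1] := sand _ t0.
  (* The density estimate is used in a ball of radius K r, where this error amounts to (e / 2) r ^
     m. *)
  have e20 : 0 < e / (2 * K ^+ m) by rewrite divr_gt0// mulr_gt0.
  have [r2 r20 h2] := dens e20.
  exists (Num.min r1 (r2 / K)); first by rewrite lt_min r10 divr_gt0.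
  move=> r y S /andP[r0]; rewrite lt_min => /andP[rr1 rr2] My yx mS BS SB D rho.
  have r01 : 0 < r < r1 by rewrite r0.
  have [k1 k2 k3 k4] := h1 _ _ _ r01 My yx mS BS SB.
  have mD s : measurable (D s) by apply: measurableU; exact: measurable_lball.
  have Kr : 0 < K * r < r2 by rewrite mulr_gt0//= mulrC -ltr_pdivlMr.
  have EK : e / (2 * K ^+ m) * (K * r) ^+ m = e / 2 * r ^+ m.
    by rewrite exprMn invfM !mulrA divfK// gt_eqF.
  have t1 : (1 - t) * r <= (1 + 2 * t) * r.
    by rewrite ler_pM2r//; case/andP : t0; lra.
  split=> // b hb.
    have Db : D ((1 - t) * r) `<=` ball (psi x) (K * r).
      apply: subset_trans k3; apply: setUSS; exact: subset_lball.
    have [_] := h2 _ _ Kr (mD ((1 - t) * r)) Db; rewrite EK => h.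
    apply: le_trans k1; rewrite EFinB leeBlDr//; apply: le_trans h.
    by rewrite EFinM; apply: lee_wpmul2l => //; rewrite lee_fin ltW.
  have [+ _] := h2 _ _ Kr (mD ((1 + 2 * t) * r)) k3; rewrite EK => h.
  apply: le_trans k2 _; apply: le_trans h _; rewrite EFinD; apply: leeD => //.
  by rewrite EFinM; apply: lee_wpmul2l => //; rewrite lee_fin ltW.
have Mx : M x by move: Ux; rewrite UE => -[].
split=> e e0.
  have [t [t0 A1 A2 _ _]] := approx _ e0; have [r0 r00 hr] := core _ _ e0 t0.
  exists r0 => // r S r0r mS BS SB.
  have xx : enorm (x - x) <= r by rewrite subrr enorm0 ltW//; case/andP : r0r.
  have rp : 0 < r by case/andP : r0r.
  have rm : 0 < r ^+ m by exact: exprn_gt0.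
  case/andP : (t0) => tp t2.
  have [] := hr _ _ _ r0r Mx xx mS; rewrite ?setUid// => h1 h2 _.
  apply/andP; split.
    apply: le_trans (h1 (C * V * ((1 - t) * r) ^+ m) _); last first.
      by rewrite (lebesgue_rV_lball uT hC)// mulr_gt0//; lra.
    rewrite lee_fin exprMn.
    have := ler_wpM2r (ltW rm) A2; set q := (1 - t) ^+ m; lra.
  apply: le_trans (h2 (C * V * ((1 + 2 * t) * r) ^+ m) _) _.
    by rewrite (lebesgue_rV_lball uT hC)// mulr_gt0//; lra.
  rewrite lee_fin exprMn.
  have := ler_wpM2r (ltW rm) A1; set q := (1 + 2 * t) ^+ m; lra.
have [t [t0 _ _ A1 A2]] := approx _ e0; have [r0 r00 hr] := core _ _ e0 t0.
exists r0 => // y S My r0r mS BS SB.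
set r := enorm (y - x) in r0r BS SB *.
have rp : 0 < r by case/andP : r0r.
have rm : 0 < r ^+ m by exact: exprn_gt0.
case/andP : (t0) => tp t2.
have [h1 h2 /andP[]] := hr _ _ _ r0r My (lexx _) mS BS SB.
set rho := enorm (_ *m T) => h3 h4; rewrite -/r in h3 h4.
have [rhop lop rlo rhi] := sandwich_radii t0 rp (introT andP (conj h3 h4)).
(* rho is the distance of the two centres through T, so the volume of the union is exact at this
   radius. *)
have EU : lebesgue_rV (lball T (psi x) rho `|` lball T (psi y) rho) = (C * V2 * rho ^+ m)%:E.
  exact: (lebesgue_rV_lballU m0 uT hC).
have qr : (1 - t) ^+ m * r ^+ m <= rho ^+ m.
  by rewrite -exprMn lerXn2r// nnegrE ltW.
have pr : rho ^+ m <= (1 + 2 * t) ^+ m * r ^+ m.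
  have q0 := le_trans (ltW rhop) rhi.
  by rewrite -exprMn; apply: lerXn2r => //; rewrite nnegrE ltW.
set p := (1 + 2 * t) ^+ m in A1 A2 pr *; set q := (1 - t) ^+ m in A1 A2 qr *.
set g := rho ^+ m in qr pr EU; set k := r ^+ m in rm qr pr *.
have [E1 E2] := sandwich_error A1 A2 c0 C0 Vp V2p rm qr pr.
apply/andP; split.
  apply: le_trans (h1 (C * V2 * g - 2 * (C * V * (g - q * k))) _).
    by rewrite lee_fin -/k; exact: E1.
  rewrite EFinB leeBlDr// -EU /g /q /k -exprMn.
  exact: (lebesgue_rV_lballU_le uT hC).
apply: le_trans (h2 (C * V2 * g + 2 * (C * V * (p * k - g))) _) _.
  rewrite EFinD -EU /g /p /k -exprMn.
  exact: (lebesgue_rV_lballU_le uT hC).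
by rewrite lee_fin -/k; exact: E2.
Qed.

End at_point.
End local_limit.

(** * Local asymptotics at almost every point of the manifold *)

Section manifold_ae.
Context {R : realType} {d m : nat}.

(* S ranges over all measurable sets between the open and the closed balls, so
   that the asymptotics do not depend on the treatment of the boundaries. *)
Definition local_measure (mu : set 'rV[R]_d -> \bar R) (M : set 'rV[R]_d)
    (a b : R) (x : 'rV[R]_d) : Prop :=
  (forall e, 0 < e -> exists2 r0, 0 < r0 & forall r S, 0 < r < r0 -> measurable S ->
    eball x r `<=` S -> S `<=` ceball x r ->
    (((a - e) * r ^+ m)%:E <= mu S <= ((a + e) * r ^+ m)%:E)%E) /\
  (forall e, 0 < e -> exists2 r0, 0 < r0 & forall y S, M y -> 0 < enorm (y - x) < r0 ->
    measurable S ->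
    eball x (enorm (y - x)) `|` eball y (enorm (y - x)) `<=` S ->
    S `<=` ceball x (enorm (y - x)) `|` ceball y (enorm (y - x)) ->
    (((b - e) * enorm (y - x) ^+ m)%:E <= mu S <=
     ((b + e) * enorm (y - x) ^+ m)%:E)%E).

(** The density theorem is applied to the image measure on R^m and pulled back: the chart preimage
    of a null set of that measure is null for mu restricted to U. *)
Lemma chart_ae_local_measure (M U W : set 'rV[R]_d) (psi : 'rV[R]_d -> 'rV[R]_m)
    (mu : {finite_measure set 'rV[R]_d -> \bar R}) :
  (0 < m)%N -> open W -> U = M `&` W -> chart M U psi -> measurable U ->
  (forall A, measurable A -> A `<=` ~` M -> mu A = 0%E) ->
  chart_abs_continuous mu U psi ->
  mu.-negligible [set x | U x /\ ~ exists2 a, 0 < a &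
    local_measure mu M (a * ball_volume R m) (a * two_balls_volume R m) x].
Proof.
move=> m0 oW UE cU mU muM hac.
have [_ oV spsi _] := cU.
(* psi is controlled on U only; this extension is measurable everywhere, so that the image measure
   can be formed as a pushforward. *)
pose psi' y := if y \in U then psi y else 0.
have mpsiU : measurable_fun U psi by exact: smooth_on_measurable.
have mpsi' : measurable_fun setT psi'.
  apply: measurable_fun_open => O oO; rewrite setTI.
  have mO := open_measurable_rV oO.
  rewrite (_ : _ @^-1` _ = (U `&` psi @^-1` O) `|` (if `[< O 0 >] then ~` U else set0)).
    apply: measurableU; first exact: mpsiU.
    by case: ifP => _ //; exact: measurableC.
  apply/seteqP; split=> y; rewrite /psi' /=.
    case: ifPn => [/set_mem Uy|Uy] Oy; first by left.
    by right; rewrite asboolT//= => /mem_set; exact/negP.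
  move=> [[Uy Oy]|]; first by rewrite mem_set.
  by case: ifPn => // /asboolP O0 /= nUy; rewrite memNset.
have muUoo : (mu U < +oo)%E by rewrite ltey_eq fin_num_measure.
pose nu0 : {finite_measure set 'rV[R]_d -> \bar R} := mfrestr mU muUoo.
pose nu1 : {measure set 'rV[R]_m -> \bar R} :=
  @measure_function_pushforward__canonical__measure_function_Measure _ _ _ _ _
    nu0 _ mpsi'.
have [nu nuE] : exists nu : {finite_measure set 'rV[R]_m -> \bar R},
    forall A, nu A = mu (psi @^-1` A `&` U).
  have nu1oo : (nu1 setT < +oo)%E.
    apply: (@le_lt_trans _ _ (mu U)); last exact: muUoo.
    rewrite /nu1 /= /pushforward /mfrestr /mrestr preimage_setT setTI.
    exact: lexx.
  have [nu hnu] := @mrestr_finite _ _ _ nu1 _ measurableT nu1oo.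
  exists nu => A; rewrite hnu setIT /nu1 /= /pushforward /nu0 /= /mfrestr /mrestr.
  congr (mu _); apply/seteqP; split=> y [h Uy]; split=> //; move: h;
    by rewrite /psi' /= mem_set.
have nul : nu `<< @lebesgue_rV R m.
  apply/null_content_dominatesP => A mA A0; rewrite nuE.
  apply: (hac A) => // B mB BA.
  apply/eqP; rewrite -measure_le0 -A0; apply: le_measure; rewrite ?inE//.
    by apply: measurableI => //; exact: open_measurable_rV.
  by move=> y [/BA].
have [Z [mZ Z0 hZ]] := density_points nul.
exists (psi' @^-1` Z `&` U); split.
- by apply: measurableI => //; exact: measurable_preimageT.
- rewrite -Z0 nuE; congr (mu _); apply/seteqP; split=> y [h Uy]; split=> //; move: h;
    by rewrite /psi' /= mem_set.
- move=> x [Ux nx]; split=> //; rewrite /psi' /= mem_set//; apply: hZ => -[c c0 dens].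
  apply: nx.
  have [a a0 [h1 h2]] := local_measure_limit oW UE cU mU muM (fun A _ => nuE A) Ux c0 dens m0.
  by exists a.
Qed.

(** Lindelöf selection among the measurable charts. An empty [U k] can come from a default point
    outside M and then carries no chart, hence the guard. *)
Lemma manifold_measurable (M : set 'rV[R]_d) : smooth_submanifold m M ->
  exists (U W : nat -> set 'rV[R]_d) (psi : nat -> 'rV[R]_d -> 'rV[R]_m),
    M = \bigcup_k U k /\ forall k, U k !=set0 ->
    [/\ chart M (U k) (psi k), open (W k), U k = M `&` W k & measurable (U k)].
Proof.
move=> hM.
have /choice[U /choice[W /choice[psi h]]] : forall x, exists U W (psi : 'rV[R]_d -> 'rV[R]_m),
    open W /\ U = M `&` W /\ (M x -> [/\ chart M U psi, U x & measurable U]).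
  move=> x; have [Mx|nMx] := pselect (M x); last first.
    exists set0, set0, (fun=> 0); split; first exact: open0.
    by split; rewrite ?setI0.
  have [U [W [psi [cU Ux oW UE mU]]]] := measurable_chart hM Mx.
  by exists U, W, psi.
pose W' x := if `[< M x >] then W x else set0.
have oW' x : open (W' x) by rewrite /W'; case: ifP => _; [exact: (h x).1|exact: open0].
have [|s hs] := @countable_cover_rV R d M _ W' 0 oW'.
  move=> x Mx; exists x => //; rewrite /W' asboolT//.
  have [_ [UE /(_ Mx)[_ Ux _]]] := h x.
  by move: Ux; rewrite UE => -[].
exists (fun k => M `&` W' (s k)), (fun k => W' (s k)), (fun k => psi (s k)).
split.
  apply/seteqP; split=> [x Mx|x [k _ []]//].
  by have [k _ Wx] := hs x Mx; exists k.
move=> k [y [My]]; rewrite /W'; case: ifPn => // /asboolP Ms Wy.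
have [oW [UE /(_ Ms)[cU Us mU]]] := h (s k).
by rewrite -UE.
Qed.

Lemma ae_local_measure (M : set 'rV[R]_d) (mu : {finite_measure set 'rV[R]_d -> \bar R}) :
  (0 < m)%N -> smooth_submanifold m M -> mu.-negligible (~` M) ->
  (forall x, M x -> forall U (psi : 'rV[R]_d -> 'rV[R]_m), chart M U psi -> U x ->
    chart_abs_continuous mu U psi) ->
  {ae mu, forall x, M x /\ exists2 a, 0 < a &
    local_measure mu M (a * ball_volume R m) (a * two_balls_volume R m) x}.
Proof.
move=> m0 hM muM hac; have [U [W [psi [ME h]]]] := manifold_measurable hM.
have muM0 A : measurable A -> A `<=` ~` M -> mu A = 0%E.
  move=> mA AM; have [Z [mZ Z0 MZ]] := muM.
  apply/eqP; rewrite -measure_le0 -Z0; apply: le_measure; rewrite ?inE//.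
  exact: subset_trans MZ.
have h2 : mu.-negligible (\bigcup_k [set x | U k x /\ ~ exists2 a, 0 < a &
    local_measure mu M (a * ball_volume R m) (a * two_balls_volume R m) x]).
  apply: negligible_bigcup => k; have [->|/set0P Uk] := eqVneq (U k) set0.
    by rewrite (_ : [set _ | _] = set0); [exact: negligible_set0|apply/seteqP; split=> x []].
  have [cU oW UE mU] := h k Uk; have [y Uy] := Uk.
  apply: chart_ae_local_measure (oW) (UE) (cU) (mU) (muM0) _ => //.
  have My : M y by rewrite ME; exists k.
  exact: hac My _ _ cU Uy.
have := negligibleU muM h2; apply: negligibleS => x /= nx.
have [Mx|nMx] := pselect (M x); last by left.
right; move: (Mx); rewrite {1}ME => -[k _ Ux]; exists k => //; split=> // ha.
exact: nx.
Qed.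

End manifold_ae.

(** * Beta integrals *)

Section beta_integrals.
Context {R : realType}.
Let leb := @lebesgue_measure R.

(** Density on [0, 1] of the least of k + 1 independent uniform variables; its tail beyond w is (1 -
    w) ^ (k + 1). *)
Definition bpow (k : nat) (s : R) : R := k.+1%:R * (1 - s) ^+ k.

Lemma bpow_ge0 k s : s <= 1 -> 0 <= bpow k s.
Proof. by move=> s1; rewrite mulr_ge0// exprn_ge0// subr_ge0. Qed.

Lemma continuous_bpow k : continuous (bpow k).
Proof.
move=> s; apply: cvgM; first exact: cvg_cst.
apply: (@continuous_comp _ _ _ (fun t : R => 1 - t) (fun t => t ^+ k)); last exact: exprn_continuous.
by apply: cvgB; [exact: cvg_cst|exact: cvg_id].
Qed.

Lemma measurable_bpow k : measurable_fun setT (bpow k).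
Proof. exact: continuous_measurable_fun (@continuous_bpow k). Qed.

Lemma integral_bpow k (w : R) : 0 <= w <= 1 ->
  (\int[leb]_(s in `[w, 1%R]) (bpow k s)%:E = ((1 - w) ^+ k.+1)%:E)%E.
Proof.
move=> /andP[w0]; rewrite le_eqVlt => /orP[/eqP ->|w1].
  by rewrite set_itv1 integral_set1 subrr expr0n.
have dF (s : R) : is_derive s 1 (fun t : R => - (1 - t) ^+ k.+1) (bpow k s).
  have -> : (fun t : R => - (1 - t) ^+ k.+1) = - ((cst 1 - id) ^+ k.+1) :> (R -> R).
    by apply/funext => t; rewrite /= !fctE.
  apply: is_derive_eq; rewrite /bpow /= !fctE -[LHS]/(- (_ *: (0 - 1))) sub0r scalerN opprK.
  exact: mulr1.
have cF : continuous (fun t : R => - (1 - t) ^+ k.+1).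
  move=> s; apply: cvgN.
  apply: (@continuous_comp _ _ _ (fun t : R => 1 - t) (fun t => t ^+ k.+1)); last exact: exprn_continuous.
  by apply: cvgB; [exact: cvg_cst|exact: cvg_id].
rewrite (@continuous_FTC2 _ (bpow k) (fun t => - (1 - t) ^+ k.+1) w 1)//.
- by rewrite subrr expr0n oppr0 -EFinB sub0r opprK.
- by apply: continuous_subspaceT => s; exact: continuous_bpow.
- split.
  + by move=> s _; have [] := dF s.
  + by apply: cvg_at_right_filter; exact: cF.
  + by apply: cvg_at_left_filter; exact: cF.
- by move=> s _; rewrite derive1E; have [_ ->] := dF s.
Qed.

(** From s [bpow k] s = [bpow k] s - (k + 1) / (k + 2) [bpow k.+1] s, both terms on the right having
    known integrals. *)
Lemma integral_mul_bpow k :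
  (\int[leb]_(s in `[0%R, 1%R]) (s * bpow k s)%:E = (k.+2%:R^-1)%:E)%E.
Proof.
have E : (\int[leb]_(s in `[0%R, 1%R]) (bpow k s)%:E =
    \int[leb]_(s in `[0%R, 1%R]) (s * bpow k s)%:E +
    \int[leb]_(s in `[0%R, 1%R]) (k.+1%:R / k.+2%:R * bpow k.+1 s)%:E)%E.
  rewrite -ge0_integralD//=.
  - apply: eq_integral => s _; rewrite -EFinD; congr EFin.
    rewrite /bpow exprS; field.
    by rewrite gt_eqF// ltr_pwDl.
  - by move=> s; rewrite in_itv/= => /andP[s0 s1]; rewrite lee_fin mulr_ge0// bpow_ge0.
  - apply/measurable_EFinP; apply: measurable_funM => //.
    exact: measurable_funTS (@measurable_bpow k).
  - by move=> s; rewrite in_itv/= => /andP[s0 s1]; rewrite lee_fin mulr_ge0// bpow_ge0.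
  - apply/measurable_EFinP; apply: measurable_funM => //.
    exact: measurable_funTS (@measurable_bpow k.+1).
have Z : (\int[leb]_(s in `[0%R, 1%R]) ((k.+1%:R / k.+2%:R)%:E * (bpow k.+1 s)%:E) =
    (k.+1%:R / k.+2%:R)%:E * \int[leb]_(s in `[0%R, 1%R]) (bpow k.+1 s)%:E)%E.
  apply: ge0_integralZl => //; solve [
    by apply/measurable_EFinP; exact: measurable_funTS (@measurable_bpow k.+1)
  | by move=> s; rewrite /= in_itv/= => /andP[s0 s1]; rewrite lee_fin bpow_ge0
  | by rewrite lee_fin].
move: E; under [in X in (_ = _ + X)%E]eq_integral do rewrite EFinM.
rewrite Z.
rewrite !integral_bpow ?lexx ?ler01// !subr0 !expr1n mule1.
case: integral => [r| |]//; rewrite -EFinD => -[E]; congr EFin.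
have := E; rewrite -[k.+2%:R]natr1 => {}E.
have k2 : k.+1%:R + 1 != 0 :> R by rewrite natr1 pnatr_eq0.
rewrite -natr1; have -> : r = 1 - k.+1%:R / (k.+1%:R + 1) by rewrite {1}E addrK.
by field.
Qed.

Lemma bernoulli_inv (x : R) k : 0 <= x -> 1 + k%:R * x <= (1 + x) ^+ k.
Proof.
move=> x0; elim: k => [|k IH]; first by rewrite mul0r addr0 expr0.
rewrite exprS -natr1; apply: (@le_trans _ _ ((1 + x) * (1 + k%:R * x))).
  have : 0 <= k%:R * (x * x) by rewrite !mulr_ge0.
  lra.
by rewrite ler_wpM2l// addr_ge0.
Qed.

(* From (1 - s) (1 + s/2)^2 <= 1 and Bernoulli's inequality. *)
Lemma geometric_decay (s : R) k : 0 <= s <= 1 ->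
  (1 - s) ^+ k * (1 + k%:R * (s / 2)) ^+ 2 <= 1.
Proof.
move=> /andP[s0 s1]; have s20 : 0 <= s / 2 by lra.
apply: (@le_trans _ _ ((1 - s) ^+ k * ((1 + s / 2) ^+ k) ^+ 2)).
  rewrite ler_wpM2l ?exprn_ge0 ?subr_ge0// lerXn2r ?nnegrE ?exprn_ge0 ?addr_ge0 ?mulr_ge0//.
  exact: bernoulli_inv.
rewrite -exprM mulnC exprM -exprMn exprn_ile1//.
  by rewrite mulr_ge0 ?sqr_ge0 ?subr_ge0.
have : 0 <= s * s * s by rewrite !mulr_ge0.
have : 0 <= s * s by rewrite !mulr_ge0.
rewrite expr2; lra.
Qed.

Lemma cvg_linear_geometric (s : R) : 0 < s <= 1 ->
  (k.+2%:R * (1 - s) ^+ k.+1 @[k --> \oo] --> (0 : R)).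
Proof.
move=> /andP[s0 s1]; apply/cvgrPdist_le => e e0.
(* With K = k + 1 and p = (1 - s) ^ K, the decay bound gives p K^2 s^2 <= 4, hence (K + 1) p <= 2 K
   p <= 8 / (K s^2). *)
pose N := Num.truncn (8 / (e * (s * s))).
exists N => // k /= Nk.
have k0 : 0 < k.+1%:R :> R by rewrite ltr0n.
rewrite sub0r normrN ger0_norm ?mulr_ge0 ?exprn_ge0 ?subr_ge0//.
have h := @geometric_decay s k.+1; rewrite (ltW s0) s1 in h; have {}h := h isT.
have kN : 8 / (e * (s * s)) <= k.+1%:R.
  apply: le_trans (ltW (truncnS_gt _)) _; by rewrite ler_nat ltnS.
have p0 : 0 <= (1 - s) ^+ k.+1 by rewrite exprn_ge0// subr_ge0.
move: h p0; set p := (1 - s) ^+ k.+1 => h p0.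
have ess : 0 < e * (s * s) by rewrite !mulr_gt0.
move: kN; rewrite ler_pdivrMr// => kN.
rewrite -[k.+2%:R]natr1; move: kN k0 h; set K := k.+1%:R : R => kN k0 h.
have K1 : 1 <= K by rewrite /K ler1n.
have h2 : p * (K * (s / 2)) ^+ 2 <= 1.
  apply: le_trans h; rewrite ler_wpM2l// lerXn2r ?nnegrE ?addr_ge0 ?mulr_ge0//; lra.
have h3 : p * (K * K) * (s * s) <= 4 by move: h2; rewrite !expr2; lra.
have ss : 0 < s * s by exact: mulr_gt0.
have h4 : p * (K * K) * (s * s) * e <= 4 * e by rewrite ler_wpM2r// ltW.
have h5 : 8 * (p * K) <= K * (e * (s * s)) * (p * K).
  by rewrite ler_wpM2r// mulr_ge0// ltW.
have h6 : p <= p * K by rewrite ler_peMr.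
lra.
Qed.

End beta_integrals.

(** * Layer-cake formula and limits of integrals of high powers *)

Section integral_power.
Context d (T : measurableType d) {R : realType}.
Variable mu : probability T R.
Variable W : T -> R.
Hypothesis mW : measurable_fun setT W.
Hypothesis W01 : forall y, 0 <= W y <= 1.
Let leb := @lebesgue_measure R.

(** Tonelli on {W y <= s}, since (1 - w) ^ (k + 1) is the integral of [bpow k] over [w, 1]. The left
    side thus depends only on the distribution function of W. *)
Lemma integral_power_layer k :
  (\int[mu]_y ((1 - W y) ^+ k.+1)%:E =
   \int[leb]_(s in `[0%R, 1%R]) ((bpow k s)%:E * mu [set y | (W y <= s)%R]))%E.
Proof.
pose f (z : T * R) : \bar R := ((bpow k z.2)%:E * (\1_[set z : T * R | (W z.1 <= z.2 /\ 0 <= z.2 <= 1)%R] z)%:E)%E.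
pose D := [set z : T * R | (W z.1 <= z.2 /\ 0 <= z.2 <= 1)%R].
have mW1 : measurable_fun setT (fun z : T * R => W z.1) by exact: measurableT_comp.
have mD : measurable D.
  rewrite (_ : D = (fun z : T * R => z.2 - W z.1) @^-1` `[0, +oo[ `&` (snd @^-1` `[0, 1])).
    apply: measurableI; last exact: measurable_preimageT.
    by apply: measurable_preimageT => //; exact: measurable_funB.
  by apply/seteqP; split=> z; rewrite /D /= !in_itv/= andbT subr_ge0.
have mf : measurable_fun setT f.
  apply: emeasurable_funM; apply/measurable_EFinP.
    exact: (measurableT_comp (@measurable_bpow R k)).
  exact: measurable_indic.
have f0 z : (0 <= f z)%E.
  rewrite /f indicE; have [zD|zD] := boolP (z \in D); last by rewrite mule0.
  rewrite mule1 lee_fin bpow_ge0//; move/set_mem : zD => -[_ /andP[]//].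
have := @fubini_tonelli _ _ _ _ _ mu leb f mf f0.
rewrite (eq_integral (fun y => ((1 - W y) ^+ k.+1)%:E)); last first.
  move=> y _; rewrite -(integral_bpow k (W01 y)) [RHS]integral_mkcond.
  apply: eq_integral => s _; rewrite /f indicE patchE /=.
  have /andP[w0 w1] := W01 y.
  have -> : ((y, s) \in D) = (s \in `[W y, 1]%classic).
    apply/idP/idP => [/set_mem[/= h1 /andP[h2 h3]]|/set_mem/=].
      by apply/mem_set; rewrite /= in_itv/= h1.
    rewrite in_itv/= => /andP[h1 h2]; apply/mem_set; split=> //=.
    by rewrite h2 (le_trans w0).
  by case: ifPn => _; rewrite ?mule1 ?mule0.
move=> ->; rewrite [RHS]integral_mkcond; apply: eq_integral => s _; rewrite patchE.
have [/set_mem sI|sI] := boolP (s \in `[0, 1]%classic); last first.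
  rewrite integral0_eq// => y _; rewrite /f indicE memNset ?mule0// => -[_ /= s01].
  by move/negP : sI; apply; apply/mem_set; rewrite /= in_itv.
have /= := sI; rewrite in_itv/= => s01; have /andP[s0 s1] := s01.
have mWs : measurable [set y | W y <= s].
  have := measurable_preimageT mW (measurable_itv `]-oo, s]).
  by congr measurable; apply/seteqP; split=> y; rewrite /= in_itv.
rewrite (eq_integral (fun y => (bpow k s)%:E * (\1_[set y | (W y <= s)%R] y)%:E)%E).
  rewrite ge0_integralZl//=.
  - by rewrite integral_indic// setIT.
  - exact/measurable_EFinP.
  - by rewrite lee_fin bpow_ge0.
move=> y _; rewrite /f !indicE; congr (_ * ((nat_of_bool _)%:R)%:E)%E.
by apply/idP/idP => /set_mem /= h; apply/mem_set => /=; [case: h|split].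
Qed.

(** A distribution function equal to al s would give al / (k + 2) exactly. The remaining error comes
    from s >= t, where [bpow k] has mass (1 - t) ^ (k + 1), negligible even after multiplication by
    k + 2. *)
Lemma integral_power_limit (al : R) : 0 < al ->
  (forall e, 0 < e -> exists2 s0, 0 < s0 & forall s, 0 < s < s0 ->
    (((al - e) * s)%:E <= mu [set y | (W y <= s)%R] <= ((al + e) * s)%:E)%E) ->
  ((k.+2%:R)%:E * \int[mu]_y ((1 - W y) ^+ k.+1)%:E)%E @[k --> \oo] --> al%:E.
Proof.
move=> al0 hal.
have mWs s : measurable [set y | W y <= s].
  have := measurable_preimageT mW (measurable_itv `]-oo, s]).
  by congr measurable; apply/seteqP; split=> y; rewrite /= in_itv.
pose J k := (\int[mu]_y ((1 - W y) ^+ k.+1)%:E)%E.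
have mF : measurable_fun setT (fun s : R => mu [set y | (W y <= s)%R]).
  pose F s := fine (mu [set y | (W y <= s)%R]).
  have FE : (fun s : R => mu [set y | (W y <= s)%R]) = EFin \o F.
    by apply/funext => s; rewrite /F /= fineK// fin_num_measure.
  rewrite FE; apply/measurable_EFinP; apply: nondecreasing_measurable => //.
  move=> s t st; rewrite /F fine_le ?fin_num_measure//.
  apply: le_measure; rewrite ?inE//= => y /= h; exact: le_trans h st.
have mh k : measurable_fun (`[0%R, 1%R]%classic : set R) (EFin \o bpow k).
  by apply/measurable_EFinP; exact: measurable_funTS (@measurable_bpow R k).
have msh k : measurable_fun (`[0%R, 1%R]%classic : set R) (fun s : R => (s * bpow k s)%:E).
  apply/measurable_EFinP; apply: measurable_funM => //.
  exact: measurable_funTS (@measurable_bpow R k).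
have F1 t : (mu [set y | (W y <= t)%R] <= 1)%E by exact: probability_le1.
have F_ge0 t : (0 <= mu [set y | (W y <= t)%R])%E by exact: measure_ge0.
have mg k (t : R) : measurable_fun (`[0%R, 1%R]%classic : set R)
    (fun s : R => (if t <= s then bpow k s else 0)%:E).
  apply/measurable_EFinP; apply: measurable_funTS; apply: measurable_fun_ifT => //.
    by apply: measurable_fun_ler.
  exact: measurable_bpow.
have bp k (s : R) : `[0, 1]%classic s -> 0 <= s /\ 0 <= bpow k s.
  by rewrite /= in_itv/= => /andP[s0 s1]; split=> //; exact: bpow_ge0.
have tail k t : 0 <= t <= 1 ->
    (\int[leb]_(s in `[0%R, 1%R]) (if t <= s then bpow k s else 0)%:E =
     ((1 - t) ^+ k.+1)%:E)%E.
  move=> t01; rewrite -(integral_bpow k t01) [LHS]integral_mkcond [RHS]integral_mkcond.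
  apply: eq_integral => s _; rewrite !patchE !mem_setE !in_itv/=.
  have /andP[t0 t1] := t01; have [ts|st] := leP t s; last by case: ifP.
  by rewrite (le_trans t0 ts).
have tail_ge0 k (t s : R) : `[0, 1]%classic s -> 0 <= (if t <= s then bpow k s else 0).
  by move=> /(bp k)[]; case: ifP.
have linear k c : 0 <= c ->
    (\int[leb]_(s in `[0%R, 1%R]) (c%:E * (s * bpow k s)%:E) = (c / k.+2%:R)%:E)%E.
  move=> c0; rewrite EFinM -integral_mul_bpow.
  apply: ge0_integralZl => //; first [exact: msh
    | by move=> s /(bp k)[s0 b0]; rewrite lee_fin mulr_ge0].
have mhF k : measurable_fun (`[0%R, 1%R]%classic : set R)
    (fun s : R => ((bpow k s)%:E * mu [set y | (W y <= s)%R])%E).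
  by apply: emeasurable_funM; [exact: mh|exact: measurable_funTS].
have A1 k c : 0 <= c -> forall s : R, `[0, 1]%classic s -> (0 <= c%:E * (s * bpow k s)%:E)%E.
  by move=> c0 s /(bp k)[s0 b0]; rewrite -EFinM lee_fin; apply: mulr_ge0 => //; apply: mulr_ge0.
have A2 k c : measurable_fun (`[0%R, 1%R]%classic : set R)
    (fun s : R => (c%:E * (s * bpow k s)%:E)%E).
  by apply: emeasurable_funM => //; exact: msh.
have A3 k t (s : R) : `[0, 1]%classic s -> (0 <= (if (t <= s)%R then bpow k s else 0%R)%:E)%E.
  by move=> sI; rewrite lee_fin tail_ge0.
have A4 k (s : R) : `[0, 1]%classic s -> (0 <= (bpow k s)%:E * mu [set y | (W y <= s)%R])%E.
  by move=> /(bp k)[s0 b0]; rewrite mule_ge0.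
have A5 k t c : 0 <= c -> forall s : R, `[0, 1]%classic s ->
    (0 <= c%:E * (if (t <= s)%R then bpow k s else 0%R)%:E)%E.
  by move=> c0 s sI; rewrite -EFinM lee_fin mulr_ge0 ?tail_ge0.
have A6 k t c : measurable_fun (`[0%R, 1%R]%classic : set R)
    (fun s : R => (c%:E * (if (t <= s)%R then bpow k s else 0%R)%:E)%E).
  by apply: emeasurable_funM => //; exact: mg.
have A7 k t c : 0 <= c -> (\int[leb]_(s in `[0%R, 1%R]) (c%:E * (if (t <= s)%R then bpow k s else 0%R)%:E) =
    c%:E * \int[leb]_(s in `[0%R, 1%R]) (if (t <= s)%R then bpow k s else 0%R)%:E)%E.
  by move=> c0; apply: ge0_integralZl => //; first [exact: mg | exact: A3].
have up e : 0 < e -> exists2 t, 0 < t <= 1 & forall k,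
    (J k <= ((al + e) / k.+2%:R + (1 - t) ^+ k.+1)%:E)%E.
  move=> e0; have [s0 s00 hs] := hal _ e0.
  have ale : 0 < al + e by exact: addr_gt0.
  pose t := Num.min (s0 / 2) 1; have t0 : 0 < t by rewrite lt_min ltr01 divr_gt0.
  have ts0 : t < s0 by rewrite /t; rewrite gt_min; apply/orP; left; lra.
  have t1 : t <= 1 by rewrite ge_min lexx orbT.
  (* The hypothesis speaks of s > 0 only; at s = 0 the bound follows by monotonicity. *)
  have hs' s : 0 <= s < s0 -> (mu [set y | (W y <= s)%R] <= ((al + e) * s)%:E)%E.
    move=> /andP[]; rewrite le_eqVlt => /orP[/eqP <- _|sp ss0]; last first.
      by have /andP[] := hs s (introT andP (conj sp ss0)).
    rewrite mulr0; apply/lee_addgt0Pr => q q0; rewrite add0e.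
    pose p := Num.min t (q / (al + e)).
    have p0 : 0 < p by rewrite lt_min t0 divr_gt0.
    have pt : p <= t by rewrite ge_min lexx.
    have pq : p <= q / (al + e) by rewrite ge_min lexx orbT.
    apply: (@le_trans _ _ (mu [set y | (W y <= p)%R])).
      by apply: le_measure; rewrite ?inE//= => y /= h; exact: le_trans h (ltW p0).
    have /hs/andP[_ h] : 0 < p < s0 by rewrite p0 (le_lt_trans pt).
    by apply: le_trans h _; rewrite lee_fin mulrC -ler_pdivlMr.
  exists t; first by rewrite t0.
  move=> k; rewrite /J integral_power_layer.
  rewrite EFinD -(linear k _ (ltW ale)) -(tail k t) ?(ltW t0)//.
  rewrite (_ : (_ + _)%E = (\int[leb]_(s in `[0%R, 1%R]) ((al + e)%:E * (s * bpow k s)%:E +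
      (if (t <= s)%R then bpow k s else 0%R)%:E))%E); last first.
    apply/esym; apply: ge0_integralD => //; first
      [exact: A1 (ltW ale) | exact: A2 | exact: A3 | exact: mg].
  apply: ge0_le_integral => //=; try first [exact: A4 | exact: mhF |
    by apply: emeasurable_funD; [exact: A2|exact: mg] |
    by move=> s sI; apply: adde_ge0; [exact: (A1 _ _ (ltW ale))|exact: A3]].
  move=> s sI; have [sp b0] := bp k s sI; have [ts|st] := leP t s.
    rewrite -[leLHS]add0e; apply: leeD.
      exact: (A1 k _ (ltW ale) s sI).
    by rewrite -[leRHS]mule1; apply: lee_wpmul2l; rewrite ?lee_fin.
  have -> : ((al + e)%:E * (s * bpow k s)%:E + 0%:E = (bpow k s)%:E * ((al + e) * s)%:E)%E.
    by rewrite adde0 -[LHS]EFinM -[RHS]EFinM; congr EFin; ring.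
  apply: lee_wpmul2l; first by rewrite lee_fin.
  by apply: hs'; rewrite sp (lt_trans st).
(* Beyond t the distribution function is only known to be non-negative; since (al - e) s <= al, the
   added tail term compensates for the linear part there. *)
have low e : 0 < e < al -> exists2 t, 0 < t <= 1 & forall k,
    (((al - e) / k.+2%:R)%:E <= J k + (al * (1 - t) ^+ k.+1)%:E)%E.
  move=> /andP[e0 eal]; have [s0 s00 hs] := hal _ e0.
  have ale : 0 <= al - e by rewrite subr_ge0 ltW.
  pose t := Num.min (s0 / 2) 1; have t0 : 0 < t by rewrite lt_min ltr01 divr_gt0.
  have ts0 : t < s0 by rewrite /t; rewrite gt_min; apply/orP; left; lra.
  have t1 : t <= 1 by rewrite ge_min lexx orbT.
  exists t; first by rewrite t0.
  move=> k; rewrite /J integral_power_layer.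
  rewrite -(linear k _ ale) EFinM -(tail k t) ?(ltW t0)// -A7 ?(ltW al0)//.
  rewrite (_ : (_ + _)%E = (\int[leb]_(s in `[0%R, 1%R]) ((bpow k s)%:E * mu [set y | (W y <= s)%R] +
      al%:E * (if (t <= s)%R then bpow k s else 0%R)%:E))%E); last first.
    apply/esym; apply: ge0_integralD => //; first
      [exact: A4 | exact: mhF | exact: A5 (ltW al0) | exact: A6].
  apply: ge0_le_integral => //=; try first [exact: A1 ale | exact: A2 |
    by apply: emeasurable_funD; [exact: mhF|exact: A6] |
    by move=> s sI; apply: adde_ge0; [exact: A4|exact: (A5 _ _ _ (ltW al0))]].
  move=> s sI; have [sp b0] := bp k s sI; have [ts|st] := leP t s.
    rewrite -[leLHS]add0e; apply: leeD; first by rewrite mule_ge0.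
    rewrite -!EFinM lee_fin mulrA ler_wpM2r//.
    have s1 : s <= 1 by move: sI; rewrite /= in_itv/= => /andP[].
    apply: (@le_trans _ _ (al * s)); first by rewrite ler_wpM2r// lerBlDr lerDl ltW.
    by rewrite ler_piMr// ltW.
  have -> : ((al - e)%:E * (s * bpow k s)%:E = (bpow k s)%:E * ((al - e) * s)%:E)%E.
    by rewrite -[LHS]EFinM -[RHS]EFinM; congr EFin; ring.
  rewrite mule0 adde0; apply: lee_wpmul2l; first by rewrite lee_fin.
  move: sp; rewrite le_eqVlt => /orP[/eqP <-|sp]; first by rewrite mulr0.
  by have /hs/andP[] : 0 < s < s0 by rewrite sp (lt_trans st).
have Jfin k : J k \is a fin_num.
  have J0 : (0 <= J k)%E.
    apply: integral_ge0 => y _; rewrite lee_fin exprn_ge0// subr_ge0.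
    by case/andP : (W01 y).
  have [t _ /(_ k) h] := up _ ltr01.
  by rewrite ge0_fin_numE//; apply: le_lt_trans h _; rewrite ltry.
pose j k := fine (J k); have JE k : J k = (j k)%:E by rewrite /j fineK.
have -> : (fun k => (k.+2%:R)%:E * J k)%E = (fun k => (k.+2%:R * j k)%:E).
  by apply/funext => k; rewrite JE.
apply: cvg_EFin; first by near=> k.
apply/cvgrPdist_le => e e0 /=.
pose e' := Num.min (e / 2) (al / 2).
have e'0 : 0 < e' by rewrite lt_min !divr_gt0.
have e'e : e' <= e / 2 by rewrite ge_min lexx.
have e'al : e' <= al / 2 by rewrite ge_min lexx orbT.
have [t1 t1P h1] := up _ e'0.
have [|t2 t2P h2] := low e'; first by apply/andP; split=> //; lra.
have q1 : 0 < e / 2 by lra.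
have q2 : 0 < e / 2 / al by rewrite divr_gt0.
have /cvgrPdist_le/(_ _ q1) c1 := cvg_linear_geometric t1P.
have /cvgrPdist_le/(_ _ q2) c2 := cvg_linear_geometric t2P.
near=> k.
have k20 : 0 < k.+2%:R :> R by rewrite ltr0n.
have b1 : k.+2%:R * (1 - t1) ^+ k.+1 <= e / 2.
  apply: le_trans (ler_norm _) _; rewrite -normrN -sub0r; near: k; exact: c1.
have b2 : k.+2%:R * (1 - t2) ^+ k.+1 <= e / 2 / al.
  apply: le_trans (ler_norm _) _; rewrite -normrN -sub0r; near: k; exact: c2.
have := h1 k; have := h2 k; rewrite JE -EFinD !lee_fin => g2 g1.
have {}g1 : k.+2%:R * j k <= al + e' + k.+2%:R * (1 - t1) ^+ k.+1.
  by have := ler_wpM2l (ltW k20) g1; rewrite mulrDr mulrCA divff ?mulr1.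
have {}g2 : al - e' <= k.+2%:R * j k + al * (k.+2%:R * (1 - t2) ^+ k.+1).
  by have := ler_wpM2l (ltW k20) g2; rewrite mulrDr mulrCA divff ?mulr1// (mulrCA al).
have b3 : al * (k.+2%:R * (1 - t2) ^+ k.+1) <= e / 2.
  by rewrite mulrC -ler_pdivlMr.
rewrite ler_norml; apply/andP; split; lra.
Unshelve. all: by end_near. Qed.

End integral_power.

Lemma measurable_ceball (R : realType) d (x : 'rV[R]_d) r : measurable (ceball x r).
Proof.
have := measurable_preimageT (@measurable_fun_edist R _ _ d id (cst x) (@measurable_id _ _ setT)
  (measurable_cst _)) (measurable_itv `]-oo, r]).
by congr measurable; apply/seteqP; split=> y; rewrite /ceball /= in_itv/= edistE.
Qed.

Lemma ceball0 (R : realType) d (x : 'rV[R]_d) : ceball x 0 = [set x].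
Proof.
apply/seteqP; split=> [y|_ ->]; rewrite /ceball /= ?subrr ?enorm0// => h.
by apply/subr0_eq/enorm_eq0/eqP; rewrite eq_le h enorm_ge0.
Qed.

(** * From small-radius asymptotics to the limit of the inner integral *)

Section power_limit.
Context {R : realType} {d : nat}.
Variables (mu : probability 'rV[R]_d R) (m : nat) (M : set 'rV[R]_d) (x : 'rV[R]_d).
Variables (A B : R) (C : 'rV[R]_d -> set 'rV[R]_d).
Hypothesis m0 : (0 < m)%N.
Hypothesis mM : measurable M.
Hypothesis muM : mu (~` M) = 0%E.
Hypothesis A0 : 0 < A.
Hypothesis B0 : 0 < B.
Hypothesis hA : forall e, 0 < e -> exists2 r0, 0 < r0 & forall r, 0 < r < r0 ->
  (((A - e) * r ^+ m)%:E <= mu (ceball x r) <= ((A + e) * r ^+ m)%:E)%E.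
Hypothesis hB : forall e, 0 < e -> exists2 r0, 0 < r0 & forall y, M y -> 0 < enorm (y - x) < r0 ->
  (((B - e) * enorm (y - x) ^+ m)%:E <= mu (C y) <= ((B + e) * enorm (y - x) ^+ m)%:E)%E.
Hypothesis mC : forall y, measurable (C y).
Hypothesis CceB : forall y, ceball x (enorm (y - x)) `<=` C y.
Hypothesis mW : measurable_fun setT (fun y => fine (mu (C y))).

Let root (s : R) : R := s `^ (m%:R^-1).

Let rootK s : 0 <= s -> root s ^+ m = s.
Proof.
move=> s0; rewrite -powR_mulrn ?powR_ge0// /root -powRrM mulVf ?powRr1//.
by rewrite pnatr_eq0 -lt0n.
Qed.

Let root_gt0 s : 0 < s -> 0 < root s.
Proof. exact: powR_gt0. Qed.

Let pow_le (s t : R) : 0 <= s -> 0 <= t -> (s ^+ m <= t ^+ m) = (s <= t).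
Proof. by move=> s0 t0; rewrite ler_pXn2r ?nnegrE. Qed.

Let pow_lt (s t : R) : 0 <= s -> 0 <= t -> (s ^+ m < t ^+ m) = (s < t).
Proof. by move=> s0 t0; rewrite ltr_pXn2r ?nnegrE. Qed.

Let mceb r : measurable (ceball x r).
Proof. exact: measurable_ceball. Qed.

Let m1 : measurable [set x].
Proof. by rewrite -ceball0. Qed.

Let muIM S : measurable S -> mu S = mu (S `&` M).
Proof.
move=> mS; rewrite (measureDI mu mS mM) [X in (X + _)%E](@subset_measure0 _ _ _ mu _ (~` M)) ?add0e//.
- exact: measurableD.
- exact: measurableC.
Qed.

Let mu_point : mu [set x] = 0%E.
Proof.
apply/eqP; rewrite eq_le measure_ge0 andbT; apply/lee_addgt0Pr => e e0; rewrite add0e.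
have [r0 r00 hr] := hA A0.
pose r := Num.min (r0 / 2) (root (e / (A + A))).
have AA : 0 < A + A by exact: addr_gt0.
have r_gt0 : 0 < r by rewrite lt_min divr_gt0//= root_gt0// divr_gt0.
have r1 : r < r0 by rewrite /r gt_min; apply/orP; left; lra.
have r2 : r <= root (e / (A + A)) by rewrite ge_min lexx orbT.
have /hr/andP[_ h] : 0 < r < r0 by rewrite r_gt0.
apply: (@le_trans _ _ (mu (ceball x r))).
  apply: le_measure; rewrite ?inE//.
  by move=> y ->; rewrite /ceball/= subrr enorm0 ltW.
apply: le_trans h _; rewrite lee_fin mulrC -ler_pdivlMr//.
by rewrite -(rootK (_ : 0 <= e / (A + A))) ?pow_le ?powR_ge0// ?ltW// divr_gt0.
Qed.

(** The local estimate on C y concerns points y of M near x and distinct from x. The complement of M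
    and {x} are null, and distant points are excluded because C y then contains a fixed ball about
    x, of positive mass. For small s the event mu (C y) <= s is thus nearly a ball of radius (s / B)
    ^ (1 / m), of mass nearly A s / B. *)
Lemma power_limit :
  ((k.+2%:R)%:E * \int[mu]_y ((1 - fine (mu (C y))) ^+ k.+1)%:E)%E @[k --> \oo] --> (A / B)%:E.
Proof.
have fC y : mu (C y) \is a fin_num by exact: fin_num_measure.
apply: integral_power_limit => //.
- by move=> y; rewrite fine_ge0//= -lee_fin fineK//; exact: probability_le1.
- exact: divr_gt0.
move=> e e0.
(* Chosen so that (A - e') / (B + e') and (A + e') / (B - e') are both within e of A / B. *)
pose e' := Num.min (Num.min (A / 2) (B / 2)) (e * B * B / (A + B + e * B)).
have den : 0 < A + B + e * B by rewrite !addr_gt0// mulr_gt0.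
have e'0 : 0 < e' by rewrite !lt_min !divr_gt0// !mulr_gt0.
have e'A : e' <= A / 2 by rewrite !ge_min lexx.
have e'B : e' <= B / 2 by rewrite !ge_min lexx orbT.
have e'e : e' * (A + B + e * B) <= e * B * B.
  by rewrite -ler_pdivlMr// !ge_min lexx !orbT.
have [rA rA0 kA] := hA e'0.
have [rB rB0 kB] := hB e'0.
pose r0 := Num.min rA rB; have r00 : 0 < r0 by rewrite lt_min rA0.
have r0A : r0 <= rA by rewrite ge_min lexx.
have r0B : r0 <= rB by rewrite ge_min lexx orbT.
have Be : 0 < B + e' by lra.
have Be' : 0 < B - e' by lra.
have Ae' : 0 < A - e' by lra.
have qe : e' * (A / B + 1 + e) <= e * B.
  rewrite -(ler_pM2r B0); have -> : e' * (A / B + 1 + e) * B = e' * (A + B + e * B).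
    by field; rewrite gt_eqF.
  exact: e'e.
have qB : A / B * B = A by rewrite divfK// gt_eqF.
have kl : A / B - e <= (A - e') / (B + e').
  rewrite ler_pdivlMr//; move: qe qB; set q := A / B => qe qB.
  have : 0 < e' * e by exact: mulr_gt0.
  lra.
have ku : (A + e') / (B - e') <= A / B + e.
  rewrite ler_pdivrMr//; move: qe qB; set q := A / B => qe qB; lra.
pose r1 := r0 / 2; have r10 : 0 < r1 by rewrite divr_gt0.
have r11 : r1 < r0 by rewrite /r1; lra.
(* The first bound excludes points at distance at least r0 > r1; the other two keep both radii (s /
   (B + e')) ^ (1 / m) and (s / (B - e')) ^ (1 / m) below r0. *)
pose s0 := Num.min ((A - e') * r1 ^+ m) (Num.min ((B + e') * r0 ^+ m) ((B - e') * r0 ^+ m)).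
have s00 : 0 < s0 by rewrite !lt_min !mulr_gt0// exprn_gt0.
exists s0 => // s /andP[sp]; rewrite !lt_min => /and3P[s1 s2 s3].
have mWs : measurable [set y | fine (mu (C y)) <= s].
  have := measurable_preimageT mW (measurable_itv `]-oo, s]).
  by congr measurable; apply/seteqP; split=> y; rewrite /= in_itv.
have small t : 0 < t -> s < t * r0 ^+ m -> 0 < root (s / t) < r0.
  move=> t0 st; rewrite root_gt0 ?divr_gt0//= -pow_lt ?powR_ge0 ?(ltW r00)//.
  rewrite rootK; first by rewrite ltr_pdivrMr// mulrC.
  by apply: divr_ge0; exact: ltW.
apply/andP; split.
- pose r := root (s / (B + e')).
  have /andP[rp rr0] : 0 < r < r0 by exact: small.
  have rm : r ^+ m = s / (B + e') by rewrite rootK// ltW// divr_gt0.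
  have /kA/andP[h _] : 0 < r < rA by rewrite rp (lt_le_trans rr0).
  apply: (@le_trans _ _ (mu (ceball x r))).
    by apply: le_trans h; rewrite lee_fin rm (mulrC s) mulrA ler_wpM2r// ltW.
  have -> : mu (ceball x r) = mu ((ceball x r `\` [set x]) `&` M).
    have mD : measurable (ceball x r `\` [set x]) by exact: measurableD.
    rewrite -muIM// (measureDI mu (mceb r) m1) [X in (_ + X)%E](@subset_measure0 _ _ _ mu _ [set x]) ?adde0//.
    exact: measurableI.
  apply: le_measure; rewrite ?inE//.
    by apply: measurableI => //; exact: measurableD.
  move=> y [[yr yx] My] /=.
  have y0 : 0 < enorm (y - x).
    by rewrite lt_def enorm_ge0 andbT; apply: contra_notN yx => /eqP/enorm_eq0/subr0_eq.
  have /kB-/(_ My)/andP[_ hy] : 0 < enorm (y - x) < rB.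
    by rewrite y0 (le_lt_trans yr)// (lt_le_trans rr0).
  rewrite -lee_fin fineK//; apply: le_trans hy _.
  by rewrite lee_fin mulrC -ler_pdivlMr// -rm pow_le ?enorm_ge0// ltW.
- pose r := root (s / (B - e')).
  have /andP[rp rr0] : 0 < r < r0 by exact: small.
  have rm : r ^+ m = s / (B - e') by rewrite rootK// ltW// divr_gt0.
  have /kA/andP[_ h] : 0 < r < rA by rewrite rp (lt_le_trans rr0).
  apply: (@le_trans _ _ (mu (ceball x r))); last first.
    by apply: le_trans h _; rewrite lee_fin rm (mulrC s) mulrA ler_wpM2r// ltW.
  have -> : mu [set y | (fine (mu (C y)) <= s)%R] = mu ([set y | (fine (mu (C y)) <= s)%R] `&` M).
    exact: muIM.
  apply: le_measure; rewrite ?inE//; first exact: measurableI.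
  move=> y [/= ys My].
  have [->|/eqP yx] := eqVneq y x; first by rewrite /ceball/= subrr enorm0 ltW.
  have y0 : 0 < enorm (y - x).
    by rewrite lt_def enorm_ge0 andbT; apply: contra_notN yx => /eqP/enorm_eq0/subr0_eq.
  have [yr0|r0y] := ltP (enorm (y - x)) r0.
    have /kB-/(_ My)/andP[hy _] : 0 < enorm (y - x) < rB by rewrite y0 (lt_le_trans yr0).
    rewrite /ceball/= -pow_le ?enorm_ge0 ?(ltW rp)// rm ler_pdivlMr// mulrC -lee_fin.
    by apply: le_trans hy _; rewrite -(fineK (fC y)) lee_fin.
  have /kA/andP[h1 _] : 0 < r1 < rA by rewrite r10 (lt_le_trans r11).
  have : (((A - e') * r1 ^+ m)%:E <= mu (C y))%E.
    apply: le_trans h1 _; apply: le_measure; rewrite ?inE//.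
    by move=> z zr; apply: CceB; apply: (le_trans zr); exact: le_trans (ltW r11) r0y.
  rewrite -(fineK (fC y)) lee_fin => hh; lra.
Qed.

End power_limit.

(** * Independence *)

Section independence.
Context {R : realType} (disp : measure_display) (Omega : measurableType disp).
Variable P : probability Omega R.

Let fP A : measurable A -> P A \is a fin_num.
Proof. by move=> mA; rewrite fin_num_measure. Qed.

(** Pi-lambda argument for one factor, the event E being fixed. Independence of two blocks follows
    by applying it to each block in turn. *)
Lemma independent_pi_system d (T : measurableType d) (Y : Omega -> T) (E : set Omega)
    (G : set (set T)) :
  measurable_fun setT Y -> measurable E -> @measurable _ T = <<s G >> -> setI_closed G ->
  (forall A, G A -> P (E `&` Y @^-1` A) = (P E * P (Y @^-1` A))%E) ->
  forall A, measurable A -> P (E `&` Y @^-1` A) = (P E * P (Y @^-1` A))%E.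
Proof.
move=> mY mE mG IG hG; rewrite mG.
have mYA A : measurable A -> measurable (Y @^-1` A) by move=> mA; exact: measurable_preimageT.
apply: (@dynkin_induction _ T G (fun A => P (E `&` Y @^-1` A) = (P E * P (Y @^-1` A))%E)) => //.
- by rewrite preimage_setT setIT probability_setT mule1.
- move=> S mS IH.
  have e1 : P E = (P (E `\` Y @^-1` S) + P (E `&` Y @^-1` S))%E.
    by apply: measureDI => //; exact: mYA.
  have e2 : P (~` (Y @^-1` S)) = (1 - P (Y @^-1` S))%E.
    by apply: probability_setC; exact: mYA.
  have -> : Y @^-1` (~` S) = ~` (Y @^-1` S) by [].
  rewrite -setDE e2; move: e1; rewrite IH.
  have [[a ->] [b ->] [p ->]] : [/\ exists a, P E = a%:E,
      exists b, P (E `\` Y @^-1` S) = b%:E & exists p, P (Y @^-1` S) = p%:E].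
    have mS' := mYA _ mS; have mD := measurableD mE mS'.
    by split; [exists (fine (P E))|exists (fine (P (E `\` Y @^-1` S)))
      |exists (fine (P (Y @^-1` S)))]; rewrite fineK// fP.
  rewrite -EFinB -!EFinM -!EFinD => -[e1]; congr EFin; lra.
- move=> F mF tF IH.
  rewrite preimage_bigcup setI_bigcupr.
  have t1 : trivIset setT (fun k => Y @^-1` F k).
    apply/trivIsetP => i j _ _ ij; rewrite -preimage_setI.
    by move/trivIsetP : tF => /(_ _ _ I I ij) ->; rewrite preimage_set0.
  rewrite !measure_bigcup//.
  + rewrite -(fineK (fP mE)) -nneseriesZl; last by move=> *; exact: measure_ge0.
    by apply: eq_eseriesr => k _; rewrite (fineK (fP mE)); exact: IH.
  + by move=> k _; exact: mYA.
  + by move=> k _; apply: measurableI => //; exact: mYA.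
  + apply/trivIsetP => i j _ _ ij; rewrite setIACA setIid.
    by move/trivIsetP : t1 => /(_ _ _ I I ij) ->; rewrite setI0.
Qed.

End independence.

Section cylinders.
Context d (T : measurableType d) (n : nat).

Definition cylinder : set (set (n.-tuple T)) :=
  [set B | exists2 A : 'I_n -> set T, (forall l, measurable (A l)) &
     B = [set t | forall l, A l (tnth t l)]].

Lemma cylinder_setI : setI_closed cylinder.
Proof.
move=> _ _ [A mA ->] [B mB ->]; exists (fun l => A l `&` B l).
  by move=> l; exact: measurableI.
apply/seteqP; split=> t /= => [[tA tB] l|h]; first by split.
by split=> l; have [] := h l.
Qed.

Lemma measurable_cylinder B : cylinder B -> measurable B.
Proof.
move=> [A mA ->].
rewrite (_ : [set t | _] = \bigcap_(l in [set: 'I_n]) ((@tnth n T ^~ l) @^-1` A l)).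
  apply: fin_bigcap_measurable => // l _.
  by apply: measurable_preimageT => //; exact: measurable_tnth.
by apply/seteqP; split=> t /= h l => [_|]; exact: h.
Qed.

Lemma measurable_tupleE : @measurable _ (n.-tuple T) = <<s cylinder >>.
Proof.
apply/seteqP; split; last first.
  apply: smallest_sub; first exact: sigma_algebra_measurable.
  by move=> B; exact: measurable_cylinder.
apply: smallest_sub; first exact: smallest_sigma_algebra.
move=> B; rewrite -bigcup_seq/= => -[l _ [A mA <-]].
apply: sub_sigma_algebra; rewrite setTI.
exists (fun k => if k == l then A else setT); first by move=> k; case: ifP.
apply/seteqP; split=> t /= h; last by have := h l; rewrite eqxx.
by move=> k; case: eqP => [->|].
Qed.

End cylinders.

Section tuples.
Context {R : realType} (disp : measure_display) (Omega : measurableType disp).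
Variable P : probability Omega R.
Context d (T : measurableType d) (n : nat) (x0 : T).
Variable X : 'I_n -> Omega -> T.
Hypothesis mX : forall i, measurable_fun setT (X i).
Hypothesis indep : mutually_independent P X.

(* The entries outside S are frozen to x0, so that all subtuples take their
   values in the same measurable space. *)
Definition subtuple (S : {set 'I_n}) (w : Omega) : n.-tuple T :=
  [tuple if l \in S then X l w else x0 | l < n].

Lemma measurable_subtuple S : measurable_fun setT (subtuple S).
Proof.
apply/measurable_fun_tnthP => l.
rewrite (_ : _ \o _ = fun w => if l \in S then X l w else x0); last first.
  by apply/funext => w; rewrite /= tnth_mktuple.
by case: (l \in S) => //; exact: mX.
Qed.

Lemma subtuple_cylinder (S : {set 'I_n}) (A : 'I_n -> set T) (mA : forall l, measurable (A l)) :
  (forall l, l \notin S -> A l x0) ->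
  P ((subtuple S) @^-1` [set t | forall l, A l (tnth t l)]) =
  (\prod_(l in S) P (X l @^-1` A l))%E.
Proof.
move=> h; rewrite -(indep S mA); congr (P _).
apply/seteqP; split=> w /= hw l.
  by move=> /= lS; have := hw l; rewrite tnth_mktuple lS.
by rewrite tnth_mktuple; case: ifPn => [lS|/h//]; exact: hw.
Qed.

(** On cylinders the formula is mutual independence over S :|: S'; it is then extended to all
    events, one block at a time. *)
Lemma independent_subtuples (S S' : {set 'I_n}) B B' : (forall l, l \in S -> l \notin S') ->
  measurable B -> measurable B' ->
  P ((subtuple S) @^-1` B `&` (subtuple S') @^-1` B') =
  (P ((subtuple S) @^-1` B) * P ((subtuple S') @^-1` B'))%E.
Proof.
move=> dS mB mB'.
have mS C : measurable C -> measurable ((subtuple S) @^-1` C).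
  by apply: measurable_preimageT; exact: measurable_subtuple.
have mS' C : measurable C -> measurable ((subtuple S') @^-1` C).
  by apply: measurable_preimageT; exact: measurable_subtuple.
apply: (independent_pi_system (measurable_subtuple S') (mS _ mB)
  (measurable_tupleE T n) (@cylinder_setI _ T n)) => // C cC.
have mC := measurable_cylinder cC.
rewrite setIC muleC.
apply: (independent_pi_system (measurable_subtuple S) (mS' _ mC)
  (measurable_tupleE T n) (@cylinder_setI _ T n)) => // D cD.
have mD := measurable_cylinder cD.
case: cC mC => A mA -> mC; case: cD mD => A' mA' -> mD.
(* A condition violated by [x0] at a frozen entry makes the event empty, and both sides vanish. *)
have [hA|hA] := pselect (forall l, l \notin S' -> A l x0); last first.
  rewrite (_ : (subtuple S') @^-1` _ = set0) ?set0I ?measure0 ?mul0e//.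
  rewrite -subset0 => w /= hw; apply: hA => l lS.
  by have := hw l; rewrite tnth_mktuple (negbTE lS).
have [hA'|hA'] := pselect (forall l, l \notin S -> A' l x0); last first.
  rewrite (_ : (subtuple S) @^-1` _ = set0) ?setI0 ?measure0 ?mule0//.
  rewrite -subset0 => w /= hw; apply: hA' => l lS.
  by have := hw l; rewrite tnth_mktuple (negbTE lS).
rewrite !subtuple_cylinder//.
pose AA l := if l \in S' then A l else A' l.
have mAA l : measurable (AA l) by rewrite /AA; case: ifP.
have dS' l : l \in S' -> l \notin S by move=> lS'; apply: contraL lS' => /dS.
rewrite (_ : _ `&` _ = \bigcap_(l in [set` S' :|: S]) X l @^-1` AA l).
  rewrite (indep (S' :|: S) mAA) (eq_bigl [predU S' & S]); last by move=> l; rewrite !inE.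
  rewrite bigU/=; last first.
    by rewrite disjoint_subset; apply/fintype.subsetP => l /dS'.
  congr (_ * _)%E; apply: eq_bigr => l lS; rewrite /AA ?lS//.
  by rewrite (negbTE (dS _ lS)).
apply/seteqP; split=> w /=.
  move=> [h1 h2] l /=; rewrite !inE /AA; case: ifPn => [lS _|lS /= lS2].
    by have := h1 l; rewrite tnth_mktuple lS.
  by have := h2 l; rewrite tnth_mktuple lS2.
move=> h; split=> l; rewrite tnth_mktuple; case: ifPn => lS; try exact: hA; try exact: hA'.
  by have := h l; rewrite /= !inE lS /AA lS => /(_ isT).
by have := h l; rewrite /= !inE lS orbT /AA (negbTE (dS _ lS)) => /(_ isT).
Qed.

End tuples.

(** * Probability that a region attached to two sample points is empty *)

Section empty_region.
Context {R : realType} (disp : measure_display) (Omega : measurableType disp).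
Variable P : probability Omega R.
Context d (T : measurableType d) (n : nat) (x0 : T).
Variables (X : 'I_n -> Omega -> T) (mu : probability T R).
Hypothesis mX : forall i, measurable_fun setT (X i).
Hypothesis indep : mutually_independent P X.
Hypothesis law : forall i A, measurable A -> P (X i @^-1` A) = mu A.
Variables (i j : 'I_n) (D : set ((T * T) * T)).
Hypothesis ij : i != j.
Hypothesis mD : measurable D.

Lemma measurable_region_fun (k : nat) :
  measurable_fun setT (fun z : T * T => ((1 - fine (mu (xsection D z))) ^+ k)%:E).
Proof.
apply/measurable_EFinP; apply: measurable_funX; apply: measurable_funB => //.
apply: measurableT_comp => //; exact: measurable_fun_xsection.
Qed.

Lemma region_fun_ge0 k z : (0 <= ((1 - fine (mu (xsection D z))) ^+ k)%:E)%E.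
Proof.
have mz : measurable (xsection D z) by exact: measurable_xsection.
by rewrite lee_fin exprn_ge0// subr_ge0 -lee_fin fineK ?fin_num_measure// probability_le1.
Qed.

Let S := [set i; j]%SET.

Lemma measurable_pair : measurable_fun setT (fun w => (X i w, X j w)).
Proof. by apply/measurable_fun_pairP; split; exact: mX. Qed.

Lemma pair_law B : measurable B -> P ((fun w => (X i w, X j w)) @^-1` B) = (mu \x mu)%E B.
Proof.
move=> mB.
pose Z : {mfun Omega >-> (T * T)%type} :=
  HB.pack (fun w => (X i w, X j w)) (isMeasurableFun.Build _ _ _ _ _ measurable_pair).
suff h A A' : measurable A -> measurable A' -> distribution P Z (A `*` A') = (mu A * mu A')%E.
  by have := product_measure_unique (m1 := mu) (m2 := mu) (m' := distribution P Z) h mB => /esym.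
move=> mA mA'; rewrite -(law i mA) -(law j mA').
pose AA l := if l == i then A else A'.
have mAA l : measurable (AA l) by rewrite /AA; case: ifP.
have AAi : AA i = A by rewrite /AA eqxx.
have AAj : AA j = A' by rewrite /AA eq_sym (negbTE ij).
have := indep S mAA; rewrite big_setU1/= ?inE// big_set1 AAi AAj => <-.
congr (P _); apply/seteqP; split=> w /=.
  by move=> [h1 h2] l /=; rewrite !inE => /orP[/eqP ->|/eqP ->]; rewrite ?AAi ?AAj.
move=> h; split.
  by have := h i; rewrite /= !inE eqxx AAi => /(_ isT).
by have := h j; rewrite /= !inE eqxx orbT AAj => /(_ isT).
Qed.

(** Given the two points z, the others are independent of them and of each other, and each avoids
    the section of D with probability 1 - mu (xsection D z). As i and j differ, n - 2 points
    remain. *)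
Lemma empty_region_probability :
  P [set w | forall l, l != i -> l != j -> ~ D ((X i w, X j w), X l w)] =
  (\int[mu]_x \int[mu]_y ((1 - fine (mu (xsection D (x, y)))) ^+ (n - 2))%:E)%E.
Proof.
pose Z : {mfun Omega >-> (T * T)%type} :=
  HB.pack (fun w => (X i w, X j w)) (isMeasurableFun.Build _ _ _ _ _ measurable_pair).
pose V : {mfun Omega >-> n.-tuple T} := HB.pack (subtuple x0 X (~: S))
  (isMeasurableFun.Build _ _ _ _ _ (measurable_subtuple x0 mX (~: S))).
have mZV : measurable_fun setT (fun w => (Z w, V w)).
  by apply/measurable_fun_pairP; split; exact: measurable_funP.
pose ZV : {mfun Omega >-> ((T * T) * n.-tuple T)%type} :=
  HB.pack (fun w => (Z w, V w)) (isMeasurableFun.Build _ _ _ _ _ mZV).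
have inSC l : (l \in ~: S) = (l != i) && (l != j) by rewrite !inE negb_or.
pose F := [set z : (T * T) * n.-tuple T | forall l, l \in ~: S -> ~ D (z.1, tnth z.2 l)].
have mF : measurable F.
  rewrite (_ : F = \bigcap_(l in [set` ~: S]) (fun z : (T * T) * n.-tuple T => (z.1, tnth z.2 l)) @^-1` (~` D)).
    apply: fin_bigcap_measurable => // l _.
    apply: measurable_preimageT; last exact: measurableC.
    apply/measurable_fun_pairP; split; first exact: measurable_fst.
    apply: (@measurableT_comp _ _ _ _ _ _ (fun t : n.-tuple T => tnth t l)) => //.
    exact: measurable_tnth.
  by apply/seteqP; split=> z /= h l lS; exact: h.
have -> : [set w | forall l, l != i -> l != j -> ~ D ((X i w, X j w), X l w)] = ZV @^-1` F.
  apply/seteqP; split=> w /= h l.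
    by rewrite inSC => /andP[li lj]; rewrite tnth_mktuple inSC li lj; exact: h.
  by move=> li lj; have := h l; rewrite inSC li lj tnth_mktuple inSC li lj; exact.
(* The joint law is a product: [Z] depends only on the entries in S, [V] only on those outside S. *)
have -> : P (ZV @^-1` F) = (distribution P Z \x distribution P V)%E F.
  suff h A B : measurable A -> measurable B -> distribution P ZV (A `*` B) =
      (distribution P Z A * distribution P V B)%E.
    by have := product_measure_unique (m1 := distribution P Z) (m2 := distribution P V)
      (m' := distribution P ZV) h mF => /esym.
  move=> mA mB; have mA' : measurable [set t : n.-tuple T | A (tnth t i, tnth t j)].
    apply: (@measurable_preimageT _ _ _ _ (fun t : n.-tuple T => (tnth t i, tnth t j))) => //.
    by apply/measurable_fun_pairP; split; exact: measurable_tnth.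
  have ZE : Z @^-1` A = (subtuple x0 X S) @^-1` [set t : n.-tuple T | A (tnth t i, tnth t j)].
    by apply/seteqP; split=> w /=; rewrite !tnth_mktuple !inE !eqxx orbT.
  rewrite /distribution /pushforward.
  have -> : ZV @^-1` (A `*` B) = Z @^-1` A `&` V @^-1` B by [].
  rewrite ZE; apply: (independent_subtuples x0 mX indep _ mA' mB) => l.
  by rewrite inSC !inE negb_and !negbK.
rewrite /product_measure1.
have secE z : (distribution P V) (xsection F z) = ((1 - fine (mu (xsection D z))) ^+ (n - 2))%:E.
  have mDz : measurable (xsection D z) by exact: measurable_xsection.
  pose A l := if l \in ~: S then ~` xsection D z else setT.
  have mA l : measurable (A l) by rewrite /A; case: ifP => // _; exact: measurableC.
  have -> : xsection F z = [set t | forall l, A l (tnth t l)].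
    apply/seteqP; split=> t /=; rewrite /xsection /= inE /F /A /=.
      by move=> h l; case: ifPn => // /h hl /set_mem.
    by move=> h l lS Dl; have := h l; rewrite lS /=; apply; exact: mem_set.
  have := subtuple_cylinder (x0 := x0) indep (S := ~: S) mA.
  rewrite /distribution /pushforward => ->; last by move=> l lS; rewrite /A (negbTE lS).
  rewrite (eq_bigr (fun=> (1 - fine (mu (xsection D z)))%:E)); last first.
    move=> l lS; rewrite law// /A lS.
    have -> : mu (~` xsection D z) = (1 - mu (xsection D z))%E by exact: probability_setC.
    by rewrite EFinB fineK// fin_num_measure.
  have -> : (n - 2)%N = #|~: S| by rewrite cardsCs finset.setCK card_ord cards2 ij.
  by rewrite big_const; elim: #|_| => // k /= ->; rewrite exprS EFinM.
transitivity (\int[distribution P Z]_z ((1 - fine (mu (xsection D z))) ^+ (n - 2))%:E)%E.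
  by apply: eq_integral => z _; exact: secE.
transitivity (\int[(mu \x mu)%E]_z ((1 - fine (mu (xsection D z))) ^+ (n - 2))%:E)%E.
  by apply: eq_measure_integral => A mA _; exact: pair_law.
apply: fubini_tonelli1; [exact: measurable_region_fun|exact: region_fun_ge0].
Qed.

End empty_region.

(** * Counting mutual pairs *)

Section regions.
Context {R : realType} {d : nat}.
Local Notation T3 := (('rV[R]_d * 'rV[R]_d) * 'rV[R]_d)%type.

(* If closed_region contains no third sample point, the pair is mutual
   whatever the rule for ties. If first_ball contains none but half_closed_region
   contains one, the second point is the nearest neighbor of the first one and
   not conversely. *)
Definition first_ball := [set z : T3 | enorm (z.2 - z.1.1) <= enorm (z.1.2 - z.1.1)].
Definition closed_region :=
  first_ball `|` [set z : T3 | enorm (z.2 - z.1.2) <= enorm (z.1.2 - z.1.1)].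
Definition half_closed_region :=
  first_ball `|` [set z : T3 | enorm (z.2 - z.1.2) < enorm (z.1.2 - z.1.1)].

Lemma measurable_regions :
  [/\ measurable first_ball, measurable closed_region & measurable half_closed_region].
Proof.
have mp1 : measurable_fun setT (fun z : T3 => z.1.1) by exact: (measurableT_comp measurable_fst measurable_fst).
have mp2 : measurable_fun setT (fun z : T3 => z.1.2) by exact: (measurableT_comp measurable_snd measurable_fst).
have mp3 : measurable_fun setT (fun z : T3 => z.2) by exact: measurable_snd.
have m21 := measurable_fun_edist mp2 mp1.
have m31 := measurable_fun_edist mp3 mp1.
have m32 := measurable_fun_edist mp3 mp2.
have m1 : measurable first_ball.
  have := measurable_preimageT (measurable_funB m21 m31) (measurable_itv `[0, +oo[).
  by congr measurable; apply/seteqP; split=> z; rewrite /first_ball /= in_itv/= andbT subr_ge0 !edistE.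
split=> //; apply: measurableU => //.
  have := measurable_preimageT (measurable_funB m21 m32) (measurable_itv `[0, +oo[).
  by congr measurable; apply/seteqP; split=> z; rewrite /= in_itv/= andbT subr_ge0 !edistE.
have := measurable_preimageT (measurable_funB m21 m32) (measurable_itv `]0, +oo[).
by congr measurable; apply/seteqP; split=> z; rewrite /= in_itv/= andbT subr_gt0 !edistE.
Qed.

Variables (n : nat) (nn : n.-tuple 'rV[R]_d -> 'I_n -> 'I_n).
Hypothesis hnn : nn_rule nn.
Hypothesis n1 : (1 < n)%N.
Variable x : n.-tuple 'rV[R]_d.

Definition empty_region (D : set T3) (i j : 'I_n) :=
  forall l, l != i -> l != j -> ~ D ((tnth x i, tnth x j), tnth x l).

Lemma nn_first_ball i j : i != j -> empty_region first_ball i j -> nn x i = j.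
Proof.
move=> ij h; apply/eqP/negPn/negP => nj.
have [ni] := hnn.2 n1 x i; rewrite eq_sym in ij => /(_ _ ij).
rewrite !edistE => hle; apply: (h _ ni nj).
by rewrite /first_ball /= enorm_distC (enorm_distC (tnth x j)).
Qed.

Lemma mutual_closed_region i j : i != j -> empty_region closed_region i j ->
  (i, j) \in mutual_pairs nn x.
Proof.
move=> ij h; have ji : j != i by rewrite eq_sym.
have nij : nn x i = j by apply: nn_first_ball => // l li lj hl; apply: (h l) => //; left.
have nji : nn x j = i.
  apply: nn_first_ball => // l lj li hl; apply: (h l) => //; right.
  by move: hl; rewrite /first_ball /= (enorm_distC (tnth x j)).
by rewrite inE /nn_edge /= ij ji nij nji !eqxx.
Qed.

Lemma mutual_half_closed_region i j : i != j -> empty_region first_ball i j ->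
  (i, j) \in mutual_pairs nn x -> empty_region half_closed_region i j.
Proof.
move=> ij h; rewrite inE /nn_edge /= => /and3P[_ _ /andP[_ /eqP nji]] l li lj.
move=> [|hl]; first exact: h.
have [_ /(_ l lj)] := hnn.2 n1 x j; rewrite nji !edistE (enorm_distC _ (tnth x l)) => hl2.
by move: (lt_le_trans hl hl2); rewrite ltxx.
Qed.

Lemma mutual_pairs_lower :
  (\sum_(p : 'I_n * 'I_n | p.1 != p.2) `[< empty_region closed_region p.1 p.2 >] <=
   #|mutual_pairs nn x|)%N.
Proof.
rewrite -sum1_card big_mkcond [X in (_ <= X)%N]big_mkcond; apply: leq_sum => -[i j] _ /=.
case: ifPn => // ij; case: asboolP => //= h.
by rewrite (mutual_closed_region ij h).
Qed.

(** The inequality holds pair by pair, with [p.2 == nn x p.1] as the term that sums to n: if the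
    first ball is empty, j is the neighbor of i, and mutuality moreover forces the half-closed
    region to be empty; otherwise mutuality alone gives j = nn x i. *)
Lemma mutual_pairs_upper :
  (#|mutual_pairs nn x| +
   \sum_(p : 'I_n * 'I_n | p.1 != p.2) `[< empty_region first_ball p.1 p.2 >] <=
   n + \sum_(p : 'I_n * 'I_n | p.1 != p.2) `[< empty_region half_closed_region p.1 p.2 >])%N.
Proof.
have -> : #|mutual_pairs nn x| =
    (\sum_(p : 'I_n * 'I_n | p.1 != p.2) (p \in mutual_pairs nn x))%N.
  rewrite -sum1_card big_mkcond [RHS]big_mkcond; apply: eq_bigr => -[i j] _.
  by rewrite inE /=; case: (i != j) => //=; case: (_ && _).
apply: (@leq_trans (\sum_(p : 'I_n * 'I_n | p.1 != p.2) (p.2 == nn x p.1) +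
    \sum_(p : 'I_n * 'I_n | p.1 != p.2) `[< empty_region half_closed_region p.1 p.2 >])).
  rewrite -!big_split; apply: leq_sum => -[i j] /= ij.
  case: asboolP => [h|_].
    rewrite (nn_first_ball ij h) eqxx.
    have [/(mutual_half_closed_region ij h) h2|_] := boolP ((i, j) \in _).
      by rewrite asboolT.
    by rewrite add0n leq_addr.
  rewrite addn0; have [|//] := boolP ((i, j) \in _).
  by rewrite inE /nn_edge /= => /and3P[_ /andP[_ /eqP ->] _]; rewrite eqxx leq_addr.
rewrite leq_add2r big_mkcond /=.
apply: (@leq_trans (\sum_(p : 'I_n * 'I_n) (p.2 == nn x p.1))).
  by apply: leq_sum => p _; case: ifP.
rewrite -(pair_bigA _ (fun i j : 'I_n => nat_of_bool (j == nn x i)))/=.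
rewrite (eq_bigr (fun=> 1%N)) ?sum1_card ?card_ord// => i _.
by rewrite (bigD1 (nn x i))//= eqxx big1// => j /negbTE ->.
Qed.

End regions.

(** * Expected numbers of empty regions and of mutual pairs *)

Section expected_pairs.
Context {R : realType} {d : nat} (disp : measure_display) (Omega : measurableType disp).
Variables (P : probability Omega R) (n : nat).
Variables (X : 'I_n -> Omega -> 'rV[R]_d) (mu : probability 'rV[R]_d R).
Hypothesis mX : forall i, measurable_fun setT (X i).
Hypothesis indep : mutually_independent P X.
Hypothesis law : forall i A, measurable A -> P (X i @^-1` A) = mu A.
Hypothesis n1 : (1 < n)%N.
Local Notation T3 := (('rV[R]_d * 'rV[R]_d) * 'rV[R]_d)%type.

Definition sample (w : Omega) : n.-tuple 'rV[R]_d := [tuple X i w | i < n].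

Definition region_integral (D : set T3) : \bar R :=
  (\int[mu]_x \int[mu]_y ((1 - fine (mu (xsection D (x, y)))) ^+ (n - 2))%:E)%E.

Lemma measurable_sample : measurable_fun setT sample.
Proof.
apply/measurable_fun_tnthP => l.
rewrite (_ : _ \o _ = X l); first exact: mX.
by apply/funext => w; rewrite /= tnth_mktuple.
Qed.

Section region.
Variable D : set T3.
Hypothesis mD : measurable D.

Lemma empty_region_sample i j :
  [set w | empty_region (sample w) D i j] =
  [set w | forall l, l != i -> l != j -> ~ D ((X i w, X j w), X l w)].
Proof.
by apply/seteqP; split=> w /= h l li lj; have := h l li lj; rewrite /sample !tnth_mktuple.
Qed.

Lemma measurable_empty_region i j : measurable [set w | empty_region (sample w) D i j].
Proof.
rewrite empty_region_sample.
rewrite (_ : [set w | _] = \bigcap_(l in [set l | l != i /\ l != j])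
    (fun w => ((X i w, X j w), X l w)) @^-1` (~` D)).
  apply: fin_bigcap_measurable => [|l _]; first exact: finite_finset.
  apply: measurable_preimageT; last exact: measurableC.
  apply/measurable_fun_pairP; split; last exact: mX.
  by apply/measurable_fun_pairP; split; exact: mX.
apply/seteqP; split=> w /= h l; first by move=> [li lj]; exact: h.
by move=> li lj; exact: h.
Qed.

Lemma region_integral_ge0 : (0 <= region_integral D)%E.
Proof.
apply: integral_ge0 => x _; apply: integral_ge0 => y _.
exact: region_fun_ge0.
Qed.

Let cnt w := (\sum_(p : 'I_n * 'I_n | p.1 != p.2) `[< empty_region (sample w) D p.1 p.2 >])%N.

Let cntE w : ((cnt w)%:R%:E =
  \sum_(p <- [seq p <- index_enum {: 'I_n * 'I_n} | p.1 != p.2])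
     (\1_[set w | empty_region (sample w) D p.1 p.2] w)%:E :> \bar R)%E.
Proof.
by rewrite big_filter sumEFin natr_sum; congr EFin; apply: eq_bigr.
Qed.

Lemma expected_empty_regions :
  (\int[P]_w ((\sum_(p : 'I_n * 'I_n | p.1 != p.2)
       `[< empty_region (sample w) D p.1 p.2 >])%N%:R)%:E =
   (n * n.-1)%:R%:E * region_integral D)%E.
Proof.
rewrite (eq_integral _ _ (fun w _ => cntE w)) ge0_integral_sum//.
  rewrite big_filter (eq_bigr (fun=> region_integral D)); last first.
    move=> [i j] /= ij; rewrite integral_indic//; last exact: measurable_empty_region.
    rewrite setIT empty_region_sample.
    have h := empty_region_probability (0 : 'rV[R]_d) mX indep law ij mD.
    exact: h.
  rewrite mule_natl big_mkcond -big_mkcond sumr_const; congr (_ *+ _)%E.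
  rewrite -sum1_card.
  rewrite -(pair_big_dep xpredT (fun i j : 'I_n => i != j) (fun _ _ => 1%N))/=.
  rewrite (eq_bigr (fun=> n.-1)) ?sum_nat_const ?card_ord// => i _.
  rewrite sum1_card -[n in RHS]card_ord -(cardC1 i).
  by apply: eq_card => j; rewrite !inE eq_sym.
- move=> p; apply/measurable_EFinP; apply: measurable_indic.
  exact: measurable_empty_region.
Qed.

Lemma measurable_count_empty_regions :
  measurable_fun setT (fun w => (\sum_(p : 'I_n * 'I_n | p.1 != p.2)
    `[< empty_region (sample w) D p.1 p.2 >])%N%:R : R).
Proof.
apply/measurable_EFinP; rewrite (_ : _ \o _ = fun w => \sum_(p <- [seq p <- index_enum {: 'I_n * 'I_n} | p.1 != p.2])
     (\1_[set w | empty_region (sample w) D p.1 p.2] w)%:E)%E; last first.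
  by apply/funext => w; exact: cntE.
apply: emeasurable_sum => p; apply/measurable_EFinP; apply: measurable_indic.
exact: measurable_empty_region.
Qed.

End region.

Variable nn : n.-tuple 'rV[R]_d -> 'I_n -> 'I_n.
Hypothesis hnn : nn_rule nn.

Lemma measurable_mutual_pairs :
  measurable_fun setT (fun w => #|mutual_pairs nn (sample w)|%:R : R).
Proof.
have mE i j : measurable [set w | nn (sample w) i = j].
  exact: (measurable_preimageT measurable_sample (hnn.1 i j)).
have E w : (#|mutual_pairs nn (sample w)|%:R = \sum_(p : 'I_n * 'I_n)
    \1_[set w | p.1 != p.2 /\ (nn (sample w) p.1 = p.2 /\ nn (sample w) p.2 = p.1)] w :> R).
  rewrite -sum1_card big_mkcond natr_sum; apply: eq_bigr => -[i j] _ /=.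
  rewrite indicE; congr (_%:R).
  transitivity (nat_of_bool ((i, j) \in mutual_pairs nn (sample w))); first by case: ifP.
  congr nat_of_bool; rewrite inE /nn_edge /=; apply/idP/idP.
    by move=> /and3P[ij /andP[_ /eqP h1] /andP[_ /eqP h2]]; apply/mem_set.
  by move/set_mem => /= [ij [-> ->]]; rewrite ij eq_sym ij !eqxx.
rewrite (_ : (fun w => _) = fun w => \sum_(p : 'I_n * 'I_n)
    \1_[set w | p.1 != p.2 /\ (nn (sample w) p.1 = p.2 /\ nn (sample w) p.2 = p.1)] w); last first.
  by apply/funext => w; exact: E.
apply: measurable_sum => -[i j]; apply: measurable_indic => /=.
have [ij|/negP ij] := boolP (i != j).
  rewrite (_ : [set w | _] = [set w | nn (sample w) i = j] `&` [set w | nn (sample w) j = i]).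
    exact: measurableI.
  by apply/seteqP; split=> w /= => [[]|].
by rewrite (_ : [set w | _] = set0)// -subset0 => w /= [].
Qed.

Let EN := (\int[P]_w (#|mutual_pairs nn (sample w)|%:R)%:E)%E.

Lemma expected_pairs_lower :
  ((n * n.-1)%:R%:E * region_integral closed_region <= EN)%E.
Proof.
have [_ m2 _] := @measurable_regions R d.
rewrite -expected_empty_regions//; apply: ge0_le_integral => //.
- by apply/measurable_EFinP; exact: measurable_count_empty_regions.
- by apply/measurable_EFinP; exact: measurable_mutual_pairs.
- by move=> w _; rewrite lee_fin ler_nat; exact: mutual_pairs_lower.
Qed.

Lemma expected_pairs_upper :
  (EN + (n * n.-1)%:R%:E * region_integral first_ball <=
   n%:R%:E + (n * n.-1)%:R%:E * region_integral half_closed_region)%E.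
Proof.
have [m1 _ m3] := @measurable_regions R d.
have nE : (n%:R%:E = \int[P]_w n%:R%:E :> \bar R)%E.
  have -> : (\int[P]_w n%:R%:E = n%:R%:E * P setT :> \bar R)%E by exact: integral_cst.
  by rewrite probability_setT mule1.
have mN : measurable_fun setT (fun w => (#|mutual_pairs nn (sample w)|%:R : R)%:E).
  by apply/measurable_EFinP; exact: measurable_mutual_pairs.
have mc1 := measurable_count_empty_regions m1.
have mc3 := measurable_count_empty_regions m3.
rewrite -[X in (_ + X <= _)%E](expected_empty_regions m1).
rewrite -[X in (_ <= _ + X)%E](expected_empty_regions m3) nE.
rewrite -!ge0_integralD//; try by apply/measurable_EFinP.
apply: ge0_le_integral => //.
- by move=> w _; rewrite -EFinD lee_fin -natrD.
- by apply: emeasurable_funD => //; apply/measurable_EFinP.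
- by apply: emeasurable_funD => //; apply/measurable_EFinP.
- move=> w _; rewrite -!EFinD lee_fin -!natrD ler_nat; exact: mutual_pairs_upper.
Qed.

End expected_pairs.

(** * Passage to the limit *)

Lemma measurable_manifold (R : realType) d m (M : set 'rV[R]_d) :
  smooth_submanifold m M -> measurable M.
Proof.
move=> /manifold_measurable[U [W [psi [-> h]]]]; apply: bigcup_measurable => k _.
by have [->|/set0P/h[]] := eqVneq (U k) set0.
Qed.

(** The truncations min (f k) c still tend to c and are dominated by the constant c, so dominated
    convergence applies to them; f k is only bounded from below by its truncation. *)
Lemma integral_near_lower d (T : measurableType d) (R : realType) (mu : probability T R)
    (f : nat -> T -> R) (c : R) : 0 <= c ->
  (forall k, measurable_fun setT (f k)) -> (forall k x, 0 <= f k x) ->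
  {ae mu, forall x, f k x @[k --> \oo] --> c} ->
  forall e, 0 < e -> \forall k \near \oo, ((c - e)%:E <= \int[mu]_x (f k x)%:E)%E.
Proof.
move=> c0 mf f0 fc e e0.
have mm k : measurable_fun setT (fun x => Num.min (f k x) c).
  exact: measurable_minr.
have mf' k : measurable_fun setT (fun x => (Num.min (f k x) c)%:E).
  exact/measurable_EFinP.
have ic : mu.-integrable setT (cst c%:E : T -> \bar R).
  exact: finite_measure_integrable_cst.
have hc : {ae mu, forall x, setT x -> (Num.min (f k x) c)%:E @[k --> \oo] --> (cst c%:E : T -> \bar R) x}.
  apply: filterS fc => x fx _; apply: cvg_EFin; first by near=> k.
  apply/cvgrPdist_le => q q0; near=> k.
  have h : `|c - f k x| <= q by near: k; move/cvgrPdist_le : fx; exact.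
  apply: le_trans h => /=; case: (leP (f k x) c) => // _.
  by rewrite subrr normr0.
have hd : {ae mu, forall x, forall k, setT x -> (`|(Num.min (f k x) c)%:E| <= cst c%:E x)%E}.
  apply: aeW => x k _; rewrite lee_fin ger0_norm; first by rewrite ge_min lexx orbT.
  by rewrite le_min f0.
have [_ _] := dominated_convergence measurableT mf' (measurable_cst _) hc ic hd.
rewrite integral_cst// [X in _ --> X](_ : _ = c%:E); last first.
  by rewrite -[RHS]mule1; congr (_ * _)%E; exact: probability_setT.
move=> /fine_cvgP[fin /cvgrPdist_le/(_ _ e0) near_c].
near=> k; apply: (@le_trans _ _ (\int[mu]_x (Num.min (f k x) c)%:E)%E).
  have finI : (\int[mu]_x (Num.min (f k x) c)%:E)%E \is a fin_num by near: k.
  have : `|c - fine (\int[mu]_x (Num.min (f k x) c)%:E)%E| <= e by near: k.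
  rewrite -(fineK finI) lee_fin ler_norml => /andP[_]; lra.
apply: ge0_le_integral => //.
- by move=> x _; rewrite lee_fin le_min f0.
- exact/measurable_EFinP.
- by move=> x _; rewrite lee_fin ge_min lexx.
Unshelve. all: by end_near. Qed.

Section pair_limits.
Context {R : realType} {d m : nat}.
Variables (mu : probability 'rV[R]_d R) (M : set 'rV[R]_d).
Hypothesis m0 : (0 < m)%N.
Hypothesis mM : measurable M.
Hypothesis muM : mu (~` M) = 0%E.
Local Notation T3 := (('rV[R]_d * 'rV[R]_d) * 'rV[R]_d)%type.

(* The number of sample points is k + 3: the factor k + 2 counts the second
   point of the pair, and the k + 1 remaining points must avoid D. *)
Definition scaled_integral (D : set T3) (k : nat) (x : 'rV[R]_d) : R :=
  k.+2%:R * fine (\int[mu]_y ((1 - fine (mu (xsection D (x, y)))) ^+ k.+1)%:E)%E.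

Lemma inner_integral_le1 (D : set T3) k x : measurable D ->
  (0 <= \int[mu]_y ((1 - fine (mu (xsection D (x, y)))) ^+ k)%:E <= 1)%E.
Proof.
move=> mD; have D01 y : 0 <= fine (mu (xsection D (x, y))) <= 1.
  have mz : measurable (xsection D (x, y)) by exact: measurable_xsection.
  by rewrite fine_ge0//= -lee_fin fineK ?fin_num_measure// probability_le1.
have f01 y : 0 <= (1 - fine (mu (xsection D (x, y)))) ^+ k <= 1.
  have /andP[h0 h1] := D01 y; rewrite exprn_ge0 ?subr_ge0//= exprn_ile1//; lra.
apply/andP; split.
  by apply: integral_ge0 => y _; rewrite lee_fin; case/andP : (f01 y).
have <- : (\int[mu]_y (cst 1%:E : _ -> \bar R) y = 1)%E.
  by rewrite integral_cst// mul1e; exact: probability_setT.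
apply: ge0_le_integral => //.
- by move=> y _; rewrite lee_fin; case/andP : (f01 y).
- apply: (measurableT_comp (@measurable_region_fun R _ _ mu D mD k) (pair1_measurable x)).
- by move=> y _; rewrite lee_fin; case/andP : (f01 y).
Qed.

Lemma inner_integral_fin (D : set T3) k x : measurable D ->
  (\int[mu]_y ((1 - fine (mu (xsection D (x, y)))) ^+ k)%:E)%E \is a fin_num.
Proof.
move=> mD; have /andP[h0 h1] := inner_integral_le1 k x mD.
by rewrite ge0_fin_numE// (le_lt_trans h1) ?ltry.
Qed.

Lemma region_limit (D : set T3) (A B : R) x : measurable D -> 0 < A -> 0 < B ->
  (forall e, 0 < e -> exists2 r0, 0 < r0 & forall r, 0 < r < r0 ->
    (((A - e) * r ^+ m)%:E <= mu (ceball x r) <= ((A + e) * r ^+ m)%:E)%E) ->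
  (forall y, ceball x (enorm (y - x)) `<=` xsection D (x, y)) ->
  (forall e, 0 < e -> exists2 r0, 0 < r0 & forall y, M y -> 0 < enorm (y - x) < r0 ->
    (((B - e) * enorm (y - x) ^+ m)%:E <= mu (xsection D (x, y)) <=
     ((B + e) * enorm (y - x) ^+ m)%:E)%E) ->
  scaled_integral D k x @[k --> \oo] --> A / B.
Proof.
move=> mD A0 B0 hA DS hB.
have mW : measurable_fun setT (fun y => fine (mu (xsection D (x, y)))).
  have mf : measurable_fun setT (fun z => fine (mu (xsection D z))).
    by apply: measurableT_comp => //; exact: measurable_fun_xsection.
  exact: (measurableT_comp mf (pair1_measurable x)).
have := power_limit m0 mM muM A0 B0 hA hB (fun y => measurable_xsection (x, y) mD) DS mW.
move=> /fine_cvgP[_]; apply: cvg_trans; apply: near_eq_cvg; near=> k => /=.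
by rewrite /scaled_integral fineM// inner_integral_fin.
Unshelve. all: by end_near. Qed.

(** For the first ball, C(x, y) is the ball itself and the ratio is 1. For the other two regions it
    is a V_m / (a U_m), from which a disappears. *)
Lemma local_measure_limits x a : M x -> 0 < a ->
  local_measure (m := m) mu M (a * ball_volume R m) (a * two_balls_volume R m) x ->
  [/\ scaled_integral first_ball k x @[k --> \oo] --> (1 : R),
      scaled_integral closed_region k x @[k --> \oo] --> qconst R m &
      scaled_integral half_closed_region k x @[k --> \oo] --> qconst R m].
Proof.
move=> Mx a0 [lA lB].
have V0 := @ball_volume_gt0 R m; have V20 := @two_balls_volume_gt0 R m m0.
have aV : 0 < a * ball_volume R m by exact: mulr_gt0.
have aV2 : 0 < a * two_balls_volume R m by exact: mulr_gt0.
have sub r y : eball y r `<=` ceball y r by move=> z; exact: ltW.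
have hA e : 0 < e -> exists2 r0, 0 < r0 & forall r, 0 < r < r0 ->
    (((a * ball_volume R m - e) * r ^+ m)%:E <= mu (ceball x r) <=
     ((a * ball_volume R m + e) * r ^+ m)%:E)%E.
  move=> /lA[r0 r00 h]; exists r0 => // r rr0; apply: h => //.
  exact: measurable_ceball.
have qE : qconst R m = (a * ball_volume R m) / (a * two_balls_volume R m).
  by rewrite /qconst -mulf_div divff ?mul1r// gt_eqF.
have E1 y : xsection (@first_ball R d) (x, y) = ceball x (enorm (y - x)).
  by rewrite xsectionE.
have E2 y : xsection (@closed_region R d) (x, y) =
    ceball x (enorm (y - x)) `|` ceball y (enorm (y - x)).
  by rewrite xsectionE.
have E3 y : xsection (@half_closed_region R d) (x, y) =
    ceball x (enorm (y - x)) `|` eball y (enorm (y - x)).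
  by rewrite xsectionE.
have [m1 m2 m3] := @measurable_regions R d.
split.
- rewrite -(divff (lt0r_neq0 aV)).
  apply: region_limit => //; first by move=> y; rewrite E1.
  by move=> e /hA[r0 r00 h]; exists r0 => // y My yr; rewrite E1; exact: h.
- rewrite qE; apply: region_limit => //; first by move=> y; rewrite E2.
  move=> e /lB[r0 r00 h]; exists r0 => // y My yr; apply: h => //.
  + exact: measurable_xsection.
  + by rewrite E2; apply: setUSS.
  + by rewrite E2.
- rewrite qE; apply: region_limit => //; first by move=> y; rewrite E3.
  move=> e /lB[r0 r00 h]; exists r0 => // y My yr; apply: h => //.
  + exact: measurable_xsection.
  + by rewrite E3; apply: setUSS.
  + by rewrite E3; apply: setUSS; [exact: subset_refl|exact: sub].
Qed.

End pair_limits.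

(** Lower bounds alone suffice because the limits q and 1 - q add up to the ceiling 1 of u + w: the
    bound on w acts as an upper bound on u. *)
Lemma squeeze_near (R : realType) (u v w : nat -> \bar R) (q : R) :
  (forall e, 0 < e -> \forall k \near \oo, ((q - e)%:E <= v k)%E) ->
  (forall e, 0 < e -> \forall k \near \oo, (((1 - q) - e)%:E <= w k)%E) ->
  (forall k, (v k <= u k)%E) -> (forall k, (u k + w k <= 1)%E) -> (forall k, (0 <= u k)%E) ->
  (forall k, (0 <= w k)%E) ->
  u k @[k --> \oo] --> q%:E.
Proof.
move=> hv hw vu uw u0 w0.
have ufin k : u k \is a fin_num.
  rewrite ge0_fin_numE//; apply: (@le_lt_trans _ _ 1%E); last exact: ltry.
  by apply: le_trans (uw k); rewrite leeDl.
apply/fine_cvgP; split; first by near=> k.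
apply/cvgrPdist_le => e e0; near=> k.
have h1 : ((q - e)%:E <= u k)%E by apply: le_trans (vu k); near: k; exact: hv.
have h2 : ((1 - q - e)%:E <= w k)%E by near: k; exact: hw.
have h3 := le_trans (leeD2l (u k) h2) (uw k).
move: h1 h3; rewrite /= -(fineK (ufin k)) -EFinD !lee_fin /= => h1 h3.
rewrite ler_norml; apply/andP; split; lra.
Unshelve. all: by end_near. Qed.

Section outer.
Context {R : realType} {d : nat}.
Variable mu : probability 'rV[R]_d R.
Local Notation T3 := (('rV[R]_d * 'rV[R]_d) * 'rV[R]_d)%type.
Variable D : set T3.
Hypothesis mD : measurable D.

Lemma measurable_scaled_integral k : measurable_fun setT (scaled_integral mu D k).
Proof.
apply: measurable_funM => //; apply: measurableT_comp => //.
apply: (@measurable_fun_fubini_tonelli_F _ _ _ _ _ mu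
  (fun z => ((1 - fine (mu (xsection D z))) ^+ k.+1)%:E)).
  exact: measurable_region_fun.
exact: region_fun_ge0.
Qed.

Lemma scaled_integral_ge0 k x : 0 <= scaled_integral mu D k x.
Proof.
by rewrite /scaled_integral mulr_ge0// fine_ge0//; have /andP[] := inner_integral_le1 mu k.+1 x mD.
Qed.

Lemma integral_scaled_integral k :
  (\int[mu]_x (scaled_integral mu D k x)%:E = k.+2%:R%:E * region_integral k.+3 mu D)%E.
Proof.
rewrite /region_integral subn2/=.
have E x : ((scaled_integral mu D k x)%:E = k.+2%:R%:E *
    \int[mu]_y ((1 - fine (mu (xsection D (x, y)))) ^+ k.+1)%:E)%E.
  by rewrite /scaled_integral EFinM fineK// inner_integral_fin.
under eq_integral do rewrite E.
apply: ge0_integralZl => //.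
- apply: (@measurable_fun_fubini_tonelli_F _ _ _ _ _ mu
    (fun z => ((1 - fine (mu (xsection D z))) ^+ k.+1)%:E)).
    exact: measurable_region_fun.
  exact: region_fun_ge0.
- by move=> x _; have /andP[] := inner_integral_le1 mu k.+1 x mD.
Qed.

Lemma region_integral_fin n : region_integral n mu D \is a fin_num.
Proof.
have h x := inner_integral_le1 mu (n - 2) x mD.
rewrite ge0_fin_numE; last by apply: integral_ge0 => x _; case/andP : (h x).
apply: (@le_lt_trans _ _ 1%E); last exact: ltry.
have <- : (\int[mu]_y (cst 1%:E : _ -> \bar R) y = 1)%E.
  by rewrite integral_cst// mul1e; exact: probability_setT.
apply: ge0_le_integral => //.
- by move=> x _; case/andP : (h x).
- apply: (@measurable_fun_fubini_tonelli_F _ _ _ _ _ mu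
    (fun z => ((1 - fine (mu (xsection D z))) ^+ (n - 2))%:E)).
    exact: measurable_region_fun.
  exact: region_fun_ge0.
- by move=> x _; case/andP : (h x).
Qed.

End outer.

Lemma scaled_integral_le (R : realType) d (mu : probability 'rV[R]_d R)
    (D D' : set (('rV[R]_d * 'rV[R]_d) * 'rV[R]_d)) k x :
  measurable D -> measurable D' -> D `<=` D' ->
  scaled_integral mu D' k x <= scaled_integral mu D k x.
Proof.
move=> mD mD' DD'; rewrite /scaled_integral ler_wpM2l// fine_le ?inner_integral_fin//.
have mxs (A : set (('rV[R]_d * 'rV[R]_d) * 'rV[R]_d)) y : measurable A -> measurable (xsection A (x, y)).
  exact: (measurable_xsection (x, y)).
apply: ge0_le_integral => //.
- by move=> y _; exact: region_fun_ge0.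
- exact: (measurableT_comp (measurable_region_fun mu mD' k.+1) (pair1_measurable x)).
- exact: (measurableT_comp (measurable_region_fun mu mD k.+1) (pair1_measurable x)).
- have b1 (A : set (('rV[R]_d * 'rV[R]_d) * 'rV[R]_d)) y : measurable A ->
      0 <= 1 - fine (mu (xsection A (x, y))).
    move=> mA; have mAy := mxs _ y mA.
    by rewrite subr_ge0 -lee_fin fineK ?fin_num_measure// probability_le1.
  move=> y _; have mDy := mxs _ y mD; have mDy' := mxs _ y mD'.
  rewrite lee_fin; apply: lerXn2r; rewrite ?nnegrE; [exact: b1|exact: b1|].
  rewrite lerB// fine_le ?fin_num_measure//.
  by apply: le_measure; rewrite ?inE//; exact: le_xsection.
Qed.

(** Here a = n and b = n - 1, N is the expected number of mutual pairs, F and H are the integrals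
    for the first ball and for the half-closed region, and W is b times their difference, given by
    an additive identity. *)
Lemma upper_bound_normalize (R : realType) (a b : R) (N F H W : \bar R) : 0 < a ->
  N \is a fin_num -> F \is a fin_num -> H \is a fin_num -> (0 <= W)%E ->
  (N + (a * b)%:E * F <= a%:E + (a * b)%:E * H)%E -> (W + b%:E * H = b%:E * F)%E ->
  (a^-1%:E * N + W <= 1)%E.
Proof.
move=> a0 /fineK <- /fineK <- /fineK <-; case: W => [W| |]// _.
rewrite -!EFinM -!EFinD !lee_fin => up [WE].
rewrite -(ler_pM2l a0) mulrDr mulrA divff ?lt0r_neq0// mul1r mulr1.
by move: up; rewrite -!mulrA -WE mulrDr; lra.
Qed.

(** The two bounds in the form used for the squeeze. The difference of scaled integrals is kept
    under one integral sign: it is non-negative, as [first_ball] is contained in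
    [half_closed_region], and one-sided convergence applies to it as a single function. *)
Lemma expectation_mutual_pairs (R : realType) d disp (Omega : measurableType disp)
    (P : probability Omega R) (mu : probability 'rV[R]_d R) k
    (X : 'I_k.+3 -> Omega -> 'rV[R]_d) nn :
  (forall i, measurable_fun setT (X i)) -> mutually_independent P X ->
  (forall i A, measurable A -> P (X i @^-1` A) = mu A) -> nn_rule nn ->
  let E := (\int[P]_w (k.+3%:R^-1 * #|mutual_pairs nn (sample X w)|%:R)%:E)%E in
  [/\ (0 <= E)%E, (\int[mu]_x (scaled_integral mu closed_region k x)%:E <= E)%E &
   (E + \int[mu]_x (scaled_integral mu first_ball k x -
                   scaled_integral mu half_closed_region k x)%:E <= 1)%E].
Proof.
move=> mX ind law hnn E.
have [m1 m2 m3] := @measurable_regions R d.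
have n0 : 0 < k.+3%:R :> R by rewrite ltr0n.
pose N := (\int[P]_w (#|mutual_pairs nn (sample X w)|%:R)%:E)%E.
have EE : E = (k.+3%:R^-1%:E * N)%E.
  rewrite /E; under eq_integral do rewrite EFinM.
  apply: ge0_integralZl => //; first [by apply/measurable_EFinP; exact: measurable_mutual_pairs
    | by move=> w _; rewrite lee_fin].
have N0 : (0 <= N)%E by apply: integral_ge0 => w _; rewrite lee_fin.
have low := expected_pairs_lower mX ind law isT hnn.
have up := expected_pairs_upper mX ind law isT hnn.
have fF := region_integral_fin mu m1 k.+3.
have fC := region_integral_fin mu m2 k.+3.
have fH := region_integral_fin mu m3 k.+3.
rewrite -/N in low up.
have fN : N \is a fin_num.
  rewrite ge0_fin_numE//.
  apply: (@le_lt_trans _ _ (k.+3%:R%:E + (k.+3 * k.+2)%:R%:E * region_integral k.+3 mu half_closed_region)%E).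
    by apply: le_trans up; rewrite leeDl// mule_ge0 ?lee_fin// region_integral_ge0.
  by rewrite -(fineK fH) -EFinM -EFinD ltry.
pose g x := scaled_integral mu first_ball k x - scaled_integral mu half_closed_region k x.
have g0 x : 0 <= g x.
  rewrite subr_ge0; apply: scaled_integral_le => //; exact: subsetUl.
have mg : measurable_fun setT g.
  by apply: measurable_funB; exact: measurable_scaled_integral.
have WE : (\int[mu]_x (g x)%:E + k.+2%:R%:E * region_integral k.+3 mu half_closed_region =
    k.+2%:R%:E * region_integral k.+3 mu first_ball)%E.
  rewrite -[RHS](integral_scaled_integral mu m1 k).
  transitivity (\int[mu]_x (g x)%:E + \int[mu]_x (scaled_integral mu half_closed_region k x)%:E)%E.
    by congr (_ + _)%E; exact/esym/integral_scaled_integral.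
  transitivity (\int[mu]_x ((g x)%:E + (scaled_integral mu half_closed_region k x)%:E))%E.
    apply/esym; apply: ge0_integralD => //; first [exact/measurable_EFinP
      | by move=> x _; rewrite lee_fin | by move=> x _; rewrite lee_fin scaled_integral_ge0
      | by apply/measurable_EFinP; exact: measurable_scaled_integral].
  by apply: eq_integral => x _; rewrite -EFinD /g subrK.
have W0 : (0 <= \int[mu]_x (g x)%:E)%E by apply: integral_ge0 => x _; rewrite lee_fin.
split.
- by rewrite EE mule_ge0// lee_fin invr_ge0.
- rewrite EE integral_scaled_integral//; move: low.
  rewrite -(fineK fC) -(fineK fN) -!EFinM !lee_fin natrM => low.
  by rewrite ler_pdivlMl// mulrA.
- by rewrite EE; rewrite natrM in up; exact: (upper_bound_normalize n0 fN fF fH W0 up WE).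
Qed.

Theorem lemma1p4 (R : realType) (d m : nat) (hm : (1 <= m <= d)%N)
  (M : set 'rV[R]_d) (hM : smooth_submanifold m M)
  (disp : measure_display) (Omega : measurableType disp)
  (P : probability Omega R)
  (X : {RV P >-> 'rV[R]_d}) (hX : {ae P, forall w, M (X w)})
  (hac : forall (x : 'rV[R]_d), M x ->
     forall (U : set 'rV[R]_d) (psi : 'rV[R]_d -> 'rV[R]_m),
       chart M U psi -> U x -> chart_abs_continuous (distribution P X) U psi)
  (Xs : forall n : nat, 'I_n -> {RV P >-> 'rV[R]_d})
  (hlaw : forall (n : nat) (i : 'I_n) (A : set 'rV[R]_d), measurable A ->
     distribution P (Xs n i) A = distribution P X A)
  (hindep : forall n : nat, mutually_independent P (fun i w => Xs n i w))
  (nn : forall n : nat, n.-tuple 'rV[R]_d -> 'I_n -> 'I_n)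
  (hnn : forall n : nat, nn_rule (nn n)) :
  ('E_P[(fun w => n%:R^-1 *
      #|mutual_pairs (nn n) [tuple Xs n i w | i < n]|%:R : R)%R])%E
    @[n --> \oo] --> (qconst R m)%:E.
Proof.
have m0 : (0 < m)%N by case/andP : hm.
pose mu : probability 'rV[R]_d R := distribution P X.
have mM := measurable_manifold hM.
have muM : mu (~` M) = 0%E.
  rewrite /mu /= /distribution /pushforward.
  have mXM : measurable (X @^-1` (~` M)).
    by apply: measurable_preimageT => //; exact: measurableC.
  exact: (measure_negligible mXM hX).
have muN : mu.-negligible (~` M) by exists (~` M); split=> //; exact: measurableC.
have good := ae_local_measure (mu := mu) m0 hM muN hac.
have lims : {ae mu, forall x,
    [/\ scaled_integral mu first_ball k x @[k --> \oo] --> (1 : R),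
      scaled_integral mu closed_region k x @[k --> \oo] --> qconst R m &
      scaled_integral mu half_closed_region k x @[k --> \oo] --> qconst R m]}.
  apply: filterS good => x [Mx [a a0]]; exact: local_measure_limits.
have [m1 m2 m3] := @measurable_regions R d.
pose F n := ('E_P[(fun w => n%:R^-1 *
      #|mutual_pairs (nn n) [tuple Xs n i w | i < n]|%:R : R)%R])%E.
(* With n = k + 3, the exponent n - 2 is k + 1 and the factor n - 1 is k + 2, as in
   [scaled_integral]. *)
rewrite -/F -(cvg_shiftn 3).
have q0 : 0 <= qconst R m.
  by rewrite divr_ge0// ltW// ?ball_volume_gt0// two_balls_volume_gt0.
have bounds k := expectation_mutual_pairs (mu := mu) (fun i => measurable_funP (Xs k.+3 i))
  (@hindep k.+3) (@hlaw k.+3) (hnn k.+3).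
have FE k : F (k + 3)%N = (\int[P]_w (k.+3%:R^-1 *
    #|mutual_pairs (nn k.+3) (sample (fun i => Xs k.+3 i) w)|%:R)%:E)%E.
  by rewrite addn3 /F unlock.
apply: (squeeze_near (v := fun k => (\int[mu]_x (scaled_integral mu closed_region k x)%:E)%E)
  (w := fun k => (\int[mu]_x (scaled_integral mu first_ball k x -
                   scaled_integral mu half_closed_region k x)%:E)%E)).
- apply: integral_near_lower => //.
  + by move=> k; exact: measurable_scaled_integral.
  + by move=> k x; exact: scaled_integral_ge0.
  + by apply: filterS lims => x [].
- apply: integral_near_lower.
  + rewrite subr_ge0 /qconst ler_pdivrMr ?two_balls_volume_gt0// mul1r.
    exact: (ball_volume_le m0).
  + by move=> k; apply: measurable_funB; exact: measurable_scaled_integral.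
  + by move=> k x; rewrite subr_ge0 scaled_integral_le//; exact: subsetUl.
  + by apply: filterS lims => x [h1 _ h3]; exact: cvgB.
- by move=> k; rewrite FE; have [] := bounds k.
- by move=> k; rewrite FE; have [] := bounds k.
- by move=> k; rewrite FE; have [] := bounds k.
- move=> k; apply: integral_ge0 => x _; rewrite lee_fin subr_ge0 scaled_integral_le//.
  exact: subsetUl.
Qed.
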